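(* Let $N\ge1$, let $\mathbb{K}$ be a field and let $X=(x_1,\dots,x_{N-1})$, $Y=(y_1,\dots,y_{N-2})$ be sequences of elements of $\mathbb{K}$. The Okada algebra $\mathsf{O}_N(X,Y)$ is a cellular algebra with the following cell datum: (1) the cell poset is $\Lambda_N=(\mathbb{YFS}_N,\preceq)$, the set of Fibonacci sets of rank $N$ with the dominance order; (2) for each $S\in\mathbb{YFS}_N$ the index set is $M_S=\mathfrak{H}_N^S$, the set of rank $N$ Okada half arc-diagrams $H$ with $\mathrm{PLab}(H)=S$; (3) the cellular basis element associated to $L,R\in\mathfrak{H}_N^S$ is $C^S_{L,R}=L\Join R$; (4) the involutive anti-isomorphism is the linear extension of the mirror map $\star: L\Join R\mapsto R\Join L$.
   Context: Okada algebra. $\mathsf{O}_N(X,Y)$ is the unital associative $\mathbb{K}$-algebra generated by $\mathsf{E}_1,\dots,\mathsf{E}_{N-1}$ with $\mathsf{E}_i^2=x_i\mathsf{E}_i$; $\mathsf{E}_i\mathsf{E}_j=\mathsf{E}_j\mathsf{E}_i$ for $|i-j|\ge2$; $\mathsf{E}_{i+1}\mathsf{E}_i\mathsf{E}_{i+1}=y_i\mathsf{E}_{i+1}$ for $1\le i\le N-2$. For $\sigma\in\mathfrak{S}_N$ put $c_i=\#\{j<i\mid\sigma^{-1}(j)>\sigma^{-1}(i)\}$ and $\mathsf{E}_\sigma=\prod_{i=1}^N\mathsf{E}_{i-1}\mathsf{E}_{i-2}\cdots\mathsf{E}_{i-c_i}$ (left to right, $i$ increasing); $(\mathsf{E}_\sigma)_{\sigma\in\mathfrak{S}_N}$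 is a basis of $\mathsf{O}_N(X,Y)$. Okada arc-diagrams. Write $[N]=\{1,\dots,N\}$, $\overline a=-a$, $|\overline a|=a$. The node set $V_N=[N]\cup\{\overline N,\dots,\overline1\}$ is ordered by $1<\dots<N<\overline N<\dots<\overline1$. A rank $N$ non-crossing arc-diagram is a perfect matching of $V_N$ into arcs $\{a,b\}$ ($a<b$) with no two arcs $\{a,b\},\{c,d\}$ satisfying $a<c<b<d$. $\{a,b\}$ is nested in $\{c,d\}$ if $c<a<b<d$. A rank $N$ Okada arc-diagram has in addition integer labels ${\bf h}$ on arcs with (1) $1\le{\bf h}(\{a,b\})\le\min(|a|,|b|)$; (2) ${\bf h}(\{a,b\})\equiv\min(|a|,|b|)\pmod2$; (3) ${\bf h}(\{a,b\})>{\bf h}(\{c,d\})$ if $\{a,b\}$ is nested in $\{c,d\}$. $\mathfrak{A}_N$ is the set of these. The mirror $D^\star$ is obtained by exchanging $a\leftrightarrow\overline a$ for all $a$, keeping labels. An arc is propagating if it joins a node of $[N]$ to an overlined node. $\mathfrak{A}_N$ is a monoid under the product $[C\circ D]$ obtained by identifying the node $\overline a$ of $C$ with the node $a$ of $D$ for all $a$, concatenating arcs, giving each resulting arc the minimum of the labels of the arcs composing it, and removing closed loops. $\mathsf{G}_i$ is the diagram with arcs $\{j,\overline j\}$ of label $j$ for $j\ne i,i+1$, and $\{i,i+1\}$, $\{\overline i,\overline{i+1}\}$ of label $i$. Identification. Let $D_\sigma\in\mathfrak{A}_N$ be the monoid product obtained from the defining expression of $\mathsf{E}_\sigma$ by replacing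 each $\mathsf{E}_i$ with $\mathsf{G}_i$. The map $\sigma\mapsto D_\sigma$ is a bijection $\mathfrak{S}_N\to\mathfrak{A}_N$, and the paper identifies the basis element $\mathsf{E}_\sigma$ of $\mathsf{O}_N(X,Y)$ with the diagram $D_\sigma$; thus every Okada arc-diagram is viewed as a basis element of $\mathsf{O}_N(X,Y)$. Half diagrams. A rank $N$ Okada half arc-diagram $H$ is what is obtained by cutting an Okada arc-diagram in the middle: a set of pairwise disjoint pairs in $[N]$ (full arcs $\{a,b\}$, $a<b$), each remaining $a\in[N]$ carrying a (propagating) half arc, such that full arcs do not cross, no half arc node $c$ satisfies $a<c<b$ for a full arc $\{a,b\}$, each full arc $\{a,b\}$ or half arc at $a$ has an integer label $h$ with $1\le h\le a$, $h\equiv a\pmod2$, a full arc nested in a full arc has strictly larger label than it, and any full arc or half arc all of whose nodes are greater than a half arc node $c$ has label strictly larger than that of the half arc at $c$. $\mathrm{PLab}(H)$ is the set of labels of the half arcs. $\langle D|$ is the left half of $D$ (a propagating arc with left node $a$ becomes a half arc at $a$ with the same label) and $|D\rangle=\langle D^\star|$. If $\mathrm{PLab}(L)=\mathrm{PLab}(R)$, then $L\Join R$ is the unique Okada arc-diagram with $\langle L\Join R|=L$ and $|L\Join R\rangle=R$. Fibonacci sets. $\mathbb{YFS}_N$ is the set of subsets $S=\{s_1<\dots<s_k\}$ of $[N]$ with $k\equiv N\pmod2$ and $s_\ell\equiv\ell\pmod2$ for all $\ell$. Dominance order: for $S=\{s_1<\dots<s_k\}$ and $T=\{t_1<\dots<t_\ell\}$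 in $\mathbb{YFS}_N$, $S\preceq T$ iff $k\le\ell$ and $s_{k-i}\le t_{\ell-i}$ for all $0\le i<k$. Cellular algebra (Graham–Lehrer): an algebra $A$ with a finite poset $\Lambda$, finite sets $M_\lambda$ ($\lambda\in\Lambda$), a basis $\{C^\lambda_{L,R}\mid\lambda\in\Lambda,\ L,R\in M_\lambda\}$ and a linear involutive anti-automorphism $*$ with $(C^\lambda_{L,R})^*=C^\lambda_{R,L}$, such that for all $a\in A$, $\lambda\in\Lambda$, $L,R\in M_\lambda$ one has $a\,C^\lambda_{L,R}\equiv\sum_{L'\in M_\lambda}r_a(L',L)\,C^\lambda_{L',R}$ modulo the span of the $C^\mu_{P,Q}$ with $\mu<\lambda$, where the scalars $r_a(L',L)$ do not depend on $R$. *)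

(* Defs.v *)
From HB Require Import structures.
From mathcomp Require Import all_boot all_order all_fingroup all_algebra.
From mathcomp Require Import boolp.

Set Implicit Arguments.
Unset Strict Implicit.
Unset Printing Implicit Defensive.

Import Order.TTheory GRing.Theory.
Local Open Scope ring_scope.
Local Open Scope quotient_scope.

(* Conventions.  A node of [N] is an ordinal a : 'I_N, standing for the integer
   a.+1; an index of a generator or of a parameter is an ordinal i, standing for
   i.+1.  Labels, and the elements of the subsets of [N] made of labels, are
   ordinals of 'I_N.+1 and stand for themselves; that they are not 0 is always
   required explicitly. *)

(* The algebra presented by generators and relations is the set of all
   polynomial expressions in the generators, modulo the least congruence that
   contains the laws of unital associative K-algebras and the relations. *)

Inductive oexpr (K : Type) (N : nat) : Type :=
| OScal of K
| OGen of 'I_N.-1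
| OAdd of oexpr K N & oexpr K N
| OMul of oexpr K N & oexpr K N.
Arguments OScal {K} N _.
Arguments OGen K {N} _.

HB.instance Definition _ K N := gen_eqMixin (oexpr K N).
HB.instance Definition _ K N := gen_choiceMixin (oexpr K N).

Section OkadaAlgebra.
Variables (K : fieldType) (N : nat).
Variables (X : N.-1.-tuple K) (Y : N.-2.-tuple K).

Inductive okada_cong : oexpr K N -> oexpr K N -> Prop :=
| oc_refl s : okada_cong s s
| oc_sym s t : okada_cong s t -> okada_cong t s
| oc_trans t s u : okada_cong s t -> okada_cong t u -> okada_cong s u
| oc_addE s s' t t' : okada_cong s s' -> okada_cong t t' ->
    okada_cong (OAdd s t) (OAdd s' t')
| oc_mulE s s' t t' : okada_cong s s' -> okada_cong t t' ->
    okada_cong (OMul s t) (OMul s' t')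
| oc_addA s t u : okada_cong (OAdd s (OAdd t u)) (OAdd (OAdd s t) u)
| oc_addC s t : okada_cong (OAdd s t) (OAdd t s)
| oc_add0 s : okada_cong (OAdd (OScal N 0) s) s
| oc_addN s : okada_cong (OAdd (OMul (OScal N (-1)) s) s) (OScal N 0)
| oc_mulA s t u : okada_cong (OMul s (OMul t u)) (OMul (OMul s t) u)
| oc_mul1 s : okada_cong (OMul (OScal N 1) s) s
| oc_mulDl s t u :
    okada_cong (OMul (OAdd s t) u) (OAdd (OMul s u) (OMul t u))
| oc_mulDr s t u :
    okada_cong (OMul s (OAdd t u)) (OAdd (OMul s t) (OMul s u))
| oc_scalD a b :
    okada_cong (OScal N (a + b)) (OAdd (OScal N a) (OScal N b))
| oc_scalM a b :
    okada_cong (OScal N (a * b)) (OMul (OScal N a) (OScal N b))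
| oc_scalC a s : okada_cong (OMul (OScal N a) s) (OMul s (OScal N a))
| oc_sq (i : 'I_N.-1) :
    okada_cong (OMul (OGen K i) (OGen K i))
               (OMul (OScal N (tnth X i)) (OGen K i))
| oc_comm (i j : 'I_N.-1) : ((i.+2 <= j) || (j.+2 <= i))%N ->
    okada_cong (OMul (OGen K i) (OGen K j)) (OMul (OGen K j) (OGen K i))
| oc_braid (i j : 'I_N.-1) (k : 'I_N.-2) : j = i.+1 :> nat -> k = i :> nat ->
    okada_cong (OMul (OMul (OGen K j) (OGen K i)) (OGen K j))
               (OMul (OScal N (tnth Y k)) (OGen K j)).

Definition okada_congb : rel (oexpr K N) := fun s t => `[< okada_cong s t >].

Lemma okada_congb_refl : reflexive okada_congb.
Proof. by move=> s; apply/asboolP/oc_refl. Qed.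

Lemma okada_congb_sym : symmetric okada_congb.
Proof.
by move=> s t; apply/asboolP/asboolP => h; apply: oc_sym.
Qed.

Lemma okada_congb_trans : transitive okada_congb.
Proof.
by move=> t s u /asboolP st /asboolP tu; apply/asboolP/(oc_trans st tu).
Qed.

Canonical okada_equiv :=
  EquivRel okada_congb okada_congb_refl okada_congb_sym okada_congb_trans.

Definition okada_algebra := {eq_quot okada_equiv}.

HB.instance Definition _ := Choice.on okada_algebra.
HB.instance Definition _ := EqQuotient.on okada_algebra.

Local Notation A := okada_algebra.
Local Notation cl := (\pi_A).
Local Notation repr := generic_quotient.repr.

Lemma okada_eqP s t : cl s = cl t <-> okada_cong s t.
Proof. by rewrite (rwP eqP) eqmodE; split=> /asboolP. Qed.

Lemma okada_repr s : okada_cong (repr (cl s)) s.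
Proof. by apply/okada_eqP; rewrite reprK. Qed.

Definition oadd (u v : A) : A := cl (OAdd (repr u) (repr v)).
Definition omul (u v : A) : A := cl (OMul (repr u) (repr v)).
Definition oscale (a : K) (u : A) : A := omul (cl (OScal N a)) u.
Definition oopp (u : A) : A := oscale (-1) u.

Lemma oaddE s t : oadd (cl s) (cl t) = cl (OAdd s t).
Proof. by apply/okada_eqP/oc_addE; apply: okada_repr. Qed.

Lemma omulE s t : omul (cl s) (cl t) = cl (OMul s t).
Proof. by apply/okada_eqP/oc_mulE; apply: okada_repr. Qed.

Lemma oaddA : associative oadd.
Proof.
elim/quotW=> s; elim/quotW=> t; elim/quotW=> u.
rewrite (oaddE t u) (oaddE s t) (oaddE s) (oaddE _ u).
exact/okada_eqP/oc_addA.
Qed.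

Lemma oaddC : commutative oadd.
Proof.
elim/quotW=> s; elim/quotW=> t; rewrite (oaddE s t) (oaddE t s).
exact/okada_eqP/oc_addC.
Qed.

Lemma oadd0 : left_id (cl (OScal N 0)) oadd.
Proof.
by elim/quotW=> s; rewrite (oaddE _ s); apply/okada_eqP/oc_add0.
Qed.

Lemma oaddN : left_inverse (cl (OScal N 0)) oopp oadd.
Proof.
elim/quotW=> s; rewrite /oopp /oscale (omulE _ s) (oaddE _ s).
exact/okada_eqP/oc_addN.
Qed.

HB.instance Definition _ := GRing.isZmodule.Build A oaddA oaddC oadd0 oaddN.

Lemma omulA : associative omul.
Proof.
elim/quotW=> s; elim/quotW=> t; elim/quotW=> u.
rewrite (omulE t u) (omulE s t) (omulE s) (omulE _ u).
exact/okada_eqP/oc_mulA.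
Qed.

Lemma omul1 : left_id (cl (OScal N 1)) omul.
Proof. by elim/quotW=> s; rewrite (omulE _ s); apply/okada_eqP/oc_mul1. Qed.

Lemma omul1r : right_id (cl (OScal N 1)) omul.
Proof.
elim/quotW=> s; rewrite (omulE s); apply/okada_eqP.
by apply: (oc_trans (oc_sym (oc_scalC 1 s))); apply: oc_mul1.
Qed.

Lemma omulDl : left_distributive omul oadd.
Proof.
elim/quotW=> s; elim/quotW=> t; elim/quotW=> u.
rewrite (oaddE s t) (omulE _ u) (omulE s u) (omulE t u) (oaddE (OMul _ _)).
exact/okada_eqP/oc_mulDl.
Qed.

Lemma omulDr : right_distributive omul oadd.
Proof.
elim/quotW=> s; elim/quotW=> t; elim/quotW=> u.
rewrite (oaddE t u) (omulE s) (omulE s t) (omulE s u) (oaddE (OMul _ _)).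
exact/okada_eqP/oc_mulDr.
Qed.

(* E_i |-> 0 extends to an algebra morphism onto K, hence 1 != 0. *)
Fixpoint oaug (s : oexpr K N) : K :=
  match s with
  | OScal a => a
  | OGen _ => 0
  | OAdd s t => oaug s + oaug t
  | OMul s t => oaug s * oaug t
  end.

Lemma oaug_cong s t : okada_cong s t -> oaug s = oaug t.
Proof.
elim=> {s t} //=; try by move=> *; rewrite ?mulr0 ?mul0r.
- by move=> s t u _ -> _ ->.
- by move=> s s' t t' _ -> _ ->.
- by move=> s s' t t' _ -> _ ->.
- by move=> s t u; rewrite addrA.
- by move=> s t; rewrite addrC.
- by move=> s; rewrite add0r.
- by move=> s; rewrite mulN1r addNr.
- by move=> s t u; rewrite mulrA.
- by move=> s; rewrite mul1r.
- by move=> s t u; rewrite mulrDl.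
- by move=> s t u; rewrite mulrDr.
- by move=> a s; rewrite mulrC.
Qed.

Lemma one_neq0 : cl (OScal N 1) != 0.
Proof.
by apply/eqP=> /okada_eqP/oaug_cong /= /eqP; rewrite oner_eq0.
Qed.

HB.instance Definition _ :=
  GRing.Zmodule_isNzRing.Build A omulA omul1 omul1r omulDl omulDr one_neq0.

Lemma oscaleA a b (v : A) : oscale a (oscale b v) = oscale (a * b) v.
Proof.
rewrite /oscale omulA (omulE (OScal N a)); congr (omul _ _).
by apply/okada_eqP/oc_sym/oc_scalM.
Qed.

Lemma oscaleDr : right_distributive oscale +%R.
Proof. by move=> a u v; apply: omulDr. Qed.

Lemma oscaleDl (v : A) : {morph oscale^~ v : a b / a + b}.
Proof.
move=> a b; rewrite -[RHS]omulDl (oaddE (OScal N a)); congr (omul _ _).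
by apply/okada_eqP/oc_scalD.
Qed.

HB.instance Definition _ :=
  GRing.Zmodule_isLmodule.Build K A oscaleA omul1 oscaleDr oscaleDl.

Lemma oscaleAl (a : K) (u v : A) : a *: (u * v) = (a *: u) * v.
Proof. exact: omulA. Qed.

HB.instance Definition _ := GRing.Lmodule_isLalgebra.Build K A oscaleAl.

Lemma oscaleAr (a : K) (u v : A) : a *: (u * v) = u * (a *: v).
Proof.
change (omul (cl (OScal N a)) (omul u v) = omul u (omul (cl (OScal N a)) v)).
rewrite !omulA; congr (omul _ _); elim/quotW: u => u.
rewrite (omulE _ u) (omulE u); exact/okada_eqP/oc_scalC.
Qed.

HB.instance Definition _ := GRing.Lalgebra_isAlgebra.Build K A oscaleAr.

(* The generator E_k, for 1 <= k <= N - 1; only used for these k. *)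
Definition okada_gen (k : nat) : okada_algebra :=
  if insub k.-1 is Some i then \pi_okada_algebra (OGen K i) else 0.

End OkadaAlgebra.

Definition perm_code (N : nat) (s : 'S_N) (i : 'I_N) : nat :=
  #|[set j : 'I_N | (j < i)%N && ((s^-1)%g i < (s^-1)%g j)%N]|.

(* The indices of the generators in the defining expression of E_s: the ordinal
   i, that is the integer i.+1, contributes i, i - 1, ..., i.+1 - c. *)
Definition perm_word (N : nat) (s : 'S_N) : seq nat :=
  flatten [seq [seq (i - t)%N | t <- iota 0 (perm_code s i)] | i : 'I_N <- enum 'I_N].

Definition okada_basis (K : fieldType) (N : nat)
    (X : N.-1.-tuple K) (Y : N.-2.-tuple K) (s : 'S_N) : okada_algebra X Y :=
  \prod_(k <- perm_word s) okada_gen X Y k.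

(* (a, false) is the node a of [N], and (a, true) is the overlined node. *)
Definition node (N : nat) : finType := ('I_N * bool)%type.

Definition node_abs (N : nat) (v : node N) : nat := v.1.+1.

(* The rank of a node in 1 < ... < N < \bar N < ... < \bar 1. *)
Definition node_pos (N : nat) (v : node N) : nat :=
  if v.2 then (N.*2 - v.1.+1)%N else v.1.

Definition node_lt (N : nat) (v w : node N) : bool := (node_pos v < node_pos w)%N.

Definition node_bar (N : nat) (v : node N) : node N := (v.1, ~~ v.2).

(* A perfect matching of the nodes is given by the involution mapping each node
   to the other end of its arc, and a labelling of the arcs by the function
   mapping each node to the label of its arc.  The conditions, including that
   the first component is a fixed-point-free involution, are in [is_okada]. *)
Definition diag (N : nat) : finType :=
  ({ffun node N -> node N} * {ffun node N -> 'I_N.+1})%type.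

Definition mate (N : nat) (D : diag N) : {ffun node N -> node N} := D.1.
Definition lab (N : nat) (D : diag N) : {ffun node N -> 'I_N.+1} := D.2.

Definition is_matching (N : nat) (D : diag N) : bool :=
  [forall v, [&& mate D v != v, mate D (mate D v) == v
               & lab D (mate D v) == lab D v]].

Definition is_noncrossing (N : nat) (D : diag N) : bool :=
  [forall a, forall c, ~~ [&& node_lt a c, node_lt c (mate D a)
                            & node_lt (mate D a) (mate D c)]].

Definition is_okada (N : nat) (D : diag N) : bool :=
  [&& is_matching D, is_noncrossing D,
      [forall a, (1 <= lab D a <= minn (node_abs a) (node_abs (mate D a)))%N],
      [forall a, odd (lab D a) == odd (minn (node_abs a) (node_abs (mate D a)))]
    & [forall a, forall c,
        [&& node_lt c a, node_lt a (mate D a) & node_lt (mate D a) (mate D c)]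
          ==> (lab D c < lab D a)%N]].

Definition mirror (N : nat) (D : diag N) : diag N :=
  ([ffun v => node_bar (mate D (node_bar v))], [ffun v => lab D (node_bar v)]).

(* The product.  C and D are put side by side: (false, v) is the node v of C and
   (true, v) the node v of D.  Two of these points are linked when they are the
   ends of an arc of C or of D, or when they are \bar a in C and a in D.  The
   points linked to an outer one form the arc through it. *)

Definition glue_link (N : nat) (C D : diag N) : rel (bool * node N) :=
  fun p q =>
    (q == (p.1, mate (if p.1 then D else C) p.2)) ||
    [&& p.1 != q.1, p.2 == node_bar q.2 & p.2.2 == ~~ p.1].

(* a in C and \bar a in D stay; they become the nodes a and \bar a. *)
Definition outer (N : nat) (v : node N) : bool * node N := (v.2, v).

Definition dmul (N : nat) (C D : diag N) : diag N :=
  ([ffun v => odflt v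
      [pick w | (w != v) && connect (glue_link C D) (outer v) (outer w)]],
   [ffun v => \big[Order.min/ord_max]_(p | connect (glue_link C D) (outer v) p)
      lab (if p.1 then D else C) p.2]).

Definition did (N : nat) : diag N :=
  ([ffun v => node_bar v], [ffun v => inord (node_abs v)]).

(* G_i, for 1 <= i <= N - 1; only used for these i.  The node i is the ordinal
   i.-1 and the node i + 1 is the ordinal i. *)
Definition dgen (N : nat) (i : nat) : diag N :=
  ([ffun v : node N =>
      if node_abs v == i then (insubd v.1 i, v.2)
      else if node_abs v == i.+1 then (insubd v.1 i.-1, v.2)
      else node_bar v],
   [ffun v : node N => if node_abs v == i.+1 then inord i
                       else inord (node_abs v)]).

Definition perm_diag (N : nat) (s : 'S_N) : diag N :=
  foldr (@dmul N) (did N) [seq dgen N k | k <- perm_word s].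

(* The element of the Okada algebra identified with an Okada arc-diagram D: the
   basis element E_s, for the unique s with D_s = D; s exists for every Okada
   arc-diagram, so that the default value 0 is never used for these. *)
Definition diag_elt (K : fieldType) (N : nat)
    (X : N.-1.-tuple K) (Y : N.-2.-tuple K) (D : diag N) : okada_algebra X Y :=
  if [pick s : 'S_N | perm_diag s == D] is Some s then okada_basis X Y s else 0.

(* The involution maps each end of a full arc to its other end, and fixes the
   nodes carrying a half arc. *)
Definition half (N : nat) : finType :=
  ({ffun 'I_N -> 'I_N} * {ffun 'I_N -> 'I_N.+1})%type.

Definition hmate (N : nat) (H : half N) : {ffun 'I_N -> 'I_N} := H.1.
Definition hlab (N : nat) (H : half N) : {ffun 'I_N -> 'I_N.+1} := H.2.
Definition prop_node (N : nat) (H : half N) (a : 'I_N) : bool := hmate H a == a.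

Definition is_half (N : nat) (H : half N) : bool :=
  let m := hmate H in let h := hlab H in
  [&& [forall a : 'I_N, (m (m a) == a) && (h (m a) == h a)],
      [forall a : 'I_N, forall c : 'I_N, ~~ [&& (a < c)%N, (c < m a)%N & (m a < m c)%N]],
      [forall a : 'I_N, forall c : 'I_N, prop_node H c ==> ~~ (a < c < m a)%N],
      [forall a : 'I_N, (1 <= h a <= (minn a (m a)).+1)%N &&
                 (odd (h a) == odd (minn a (m a)).+1)],
      [forall a : 'I_N, forall c : 'I_N,
        [&& (c < a)%N, (a < m a)%N & (m a < m c)%N] ==> (h c < h a)%N]
    & [forall a : 'I_N, forall c : 'I_N,
        [&& prop_node H c, (c < a)%N & (c < m a)%N] ==> (h c < h a)%N]].

Definition plab (N : nat) (H : half N) : {set 'I_N.+1} :=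
  [set hlab H a | a in [pred a | prop_node H a]].

Definition lhalf (N : nat) (D : diag N) : half N :=
  ([ffun a => let w := mate D (a, false) in if w.2 then a else w.1],
   [ffun a => lab D (a, false)]).

Definition rhalf (N : nat) (D : diag N) : half N := lhalf (mirror D).

(* If plab L = plab R, the picked diagram exists and is unique. *)
Definition join (N : nat) (L R : half N) : diag N :=
  odflt (did N) [pick D | [&& is_okada D, lhalf D == L & rhalf D == R]].

Definition elts (N : nat) (S : {set 'I_N.+1}) : seq nat :=
  sort leq [seq val a | a <- enum S].

Definition is_yfs (N : nat) (S : {set 'I_N.+1}) : bool :=
  [&& ord0 \notin S, odd #|S| == odd N
    & [forall l : 'I_#|S|, odd (nth 0%N (elts S) l) == odd l.+1]].

Definition yfs (N : nat) : finType := {S : {set 'I_N.+1} | is_yfs S}.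

Definition dominance (N : nat) : rel (yfs N) := fun S T =>
  let k := #|val S| in let l := #|val T| in
  (k <= l)%N &&
  [forall i : 'I_k,
     (nth 0 (elts (val S)) (k - i.+1) <= nth 0 (elts (val T)) (l - i.+1))%N].

Definition half_with (N : nat) (S : yfs N) : finType :=
  {H : half N | is_half H && (plab H == val S)}.

Definition okada_cell (K : fieldType) (N : nat)
    (X : N.-1.-tuple K) (Y : N.-2.-tuple K) (S : yfs N)
    (L R : half_with S) : okada_algebra X Y :=
  diag_elt X Y (join (val L) (val R)).

Section Cellular.
Variables (K : fieldType) (A : algType K) (Lam : finType) (le : rel Lam).
Variables (M : Lam -> finType) (C : forall l : Lam, M l -> M l -> A).
Variable star : {linear A -> A}.

Definition cell_index : finType := {l : Lam & (M l * M l)%type}.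

Definition cell_elt (i : cell_index) : A :=
  C (tagged i).1 (tagged i).2.

Definition in_lower_span (l : Lam) (v : A) : Prop :=
  exists c : cell_index -> K,
    v = \sum_(i : cell_index | le (tag i) l && (tag i != l)) c i *: cell_elt i.

Record is_cell_datum : Prop := IsCellDatum {
  cell_order_refl : reflexive le;
  cell_order_anti : antisymmetric le;
  cell_order_trans : transitive le;
  cell_free : forall c : cell_index -> K,
    \sum_i c i *: cell_elt i = 0 -> forall i, c i = 0;
  cell_span : forall a : A,
    exists c : cell_index -> K, a = \sum_i c i *: cell_elt i;
  cell_star_invol : involutive star;
  cell_star1 : star 1 = 1;
  cell_starM : forall a b : A, star (a * b) = star b * star a;
  cell_starC : forall (l : Lam) (L R : M l), star (C L R) = C R L;
  cell_mul : forall (a : A) (l : Lam), exists r : M l -> M l -> K,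
    forall L R : M l,
      in_lower_span l (a * C L R - \sum_(L' : M l) r L' L *: C L' R)
}.

End Cellular.

Arguments is_cell_datum {K} A Lam le M C star.

(* Main.v *)
(* Read the nodes of a diagram along the line 1 < ... < N < \bar N < ... <
   \bar 1.  A diagram is then a planar perfect matching of 2N positions whose
   labels increase strictly under nesting, and left multiplication by G_i only
   rewires the arcs at the adjacent positions i and i + 1.  On the vector space
   spanned by the diagrams, let E_i map D to c * (G_i D), where c is a monomial
   in X and Y that depends only on i and on the larger label at i and i + 1;
   checking the defining relations makes this space a module over the Okada
   algebra.  If w is a word whose letters number half of the total defect, that
   is the sum over all nodes of height minus label, of its diagram, then all
   the coefficients met are 1.  The words of the basis elements E_s are of this
   kind, every diagram has such a word, and the permutation can be read off the
   labels of D_s; hence u |-> u * id identifies the algebra with the module and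
   E_s with D_s.  Products and the involution can now be computed on diagrams:
   reversing words mirrors diagrams without creating a coefficient, and left
   multiplication acts on the left half alone, unless it lowers the set of
   propagating labels for the dominance order. *)

From HB Require Import structures.
From mathcomp Require Import all_boot all_order all_fingroup all_algebra.
From mathcomp Require Import zify.
Require Import Defs.

Set Implicit Arguments.
Unset Strict Implicit.
Unset Printing Implicit Defensive.

(** * Planar labelled matchings of a line *)

(** Only products of a generator with a diagram are ever computed, on the left by rewiring and on
    the right through [mirror]; what is needed of associativity is that rewirings at disjoint pairs
    of positions commute. Linear independence of the $E_s$ does not come from a confluence argument:
    the module supplies it, once the action is known to respect the relations. The delicate relation
    there is commutation, since one rewiring can change the label that the other generator sees; the
    coefficients must factor through a common label for the two orders to agree. Spanning is a
    separate matter: right multiplication by a generator keeps the span of the code words. The two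
    together also make $s\mapsto D_s$ onto without counting diagrams: a reduced word for $D$ is a
    combination of the $E_s$, so the basis vector of $D$ is a combination of those of the $D_s$.
    Planarity enters mostly through parity: a block of positions closed under the matching has even
    length, which fixes the parity of labels after a rewiring and guarantees a place to cut an arc
    when a generator is to be split off. *)

Definition height (N x : nat) : nat := minn x.+1 (N.*2 - x).

(* The positions 0, ..., 2N - 1 are the nodes in increasing order, [m] is the
   mate and [h] the label.  In a planar matching min(|a|, |b|) has the parity of
   x + 1, where x is the position opening the arc, be it propagating or not;
   this is the form given to the parity condition. *)
Record okd (N : nat) (m h : nat -> nat) : Prop := Okd {
  okd_lt : forall x, x < N.*2 -> m x < N.*2;
  okd_neq : forall x, x < N.*2 -> m x <> x;
  okd_inv : forall x, x < N.*2 -> m (m x) = x;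
  okd_lab : forall x, x < N.*2 -> h (m x) = h x;
  okd_bnd : forall x, x < N.*2 -> 0 < h x <= height N x;
  okd_par : forall x, x < N.*2 -> x < m x -> odd (h x) = ~~ odd x;
  okd_nest : forall x y, x < N.*2 -> x < y < m x -> x < m y < m x /\ h x < h y
}.

(** The block splits into the arc at [a], the closed block under this arc and the closed block after
    it; induct on the length. *)
Lemma closed_even (m : nat -> nat) (a b : nat) :
  a <= b ->
  (forall x, a <= x < b -> m x <> x /\ m (m x) = x /\ a <= m x < b) ->
  (forall x y, a <= x < b -> x < y < m x -> x < m y < m x) ->
  odd a = odd b.
Proof.
move: {2}(b - a) (leqnn (b - a)) => k; elim: k a b => [|k IH] a b lek leab cl nc.
  by congr odd; lia.
case: (ltngtP a b) leab => // [ltab _|-> //].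
have [na [ia ra]] : m a <> a /\ m (m a) = a /\ a <= m a < b by apply: cl; lia.
have e1 : odd a.+1 = odd (m a).
  apply: IH; [lia|lia| |].
    move=> x rx; have [n1 [i1 r1]] : m x <> x /\ m (m x) = x /\ a <= m x < b
      by apply: cl; lia.
    by have := nc a x; split => //; split => //; lia.
  by move=> x y rx; apply: nc; lia.
have e2 : odd (m a).+1 = odd b.
  apply: IH; [lia|lia| |].
    move=> x rx; have [n1 [i1 r1]] : m x <> x /\ m (m x) = x /\ a <= m x < b
      by apply: cl; lia.
    split=> //; split=> //.
    have := nc a (m x); rewrite i1.
    case: (eqVneq (m x) (m a)) => [e|ne]; first by move: i1; rewrite e ia; lia.
    case: (eqVneq (m x) a) => [e|ne2]; first by move: i1; rewrite e; lia.
    lia.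
  by move=> x y rx; apply: nc; lia.
lia.
Qed.

Section Okd.
Variables (N : nat) (m h : nat -> nat).
Hypothesis ok : okd N m h.

Lemma okd_posparity x : x < N.*2 -> odd (m x) = ~~ odd x.
Proof.
move=> lx.
wlog lt : x lx / x < m x.
  move=> H; case: (ltngtP x (m x)) => [/H->//|lt|e]; last by have := okd_neq ok lx; lia.
  have := H (m x) (okd_lt ok lx); rewrite (okd_inv ok) // => /(_ lt) ->.
  by rewrite negbK.
have lmx := okd_lt ok lx.
suff : odd x.+1 = odd (m x) by move <-.
apply: (@closed_even m) => // [y ry|y z ry].
  have ly : y < N.*2 by lia.
  have [/andP[h1 h2] _] := okd_nest ok lx ry.
  by split; [exact: (okd_neq ok)|split; [exact: (okd_inv ok)|lia]].
have ly : y < N.*2 by lia.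
by move=> rz; case: (okd_nest ok ly rz).
Qed.

(** The two ends of an arc have opposite parities and share a label, so the label alone tells which
    end opens. *)
Lemma okd_par_iff x : x < N.*2 -> (x < m x) = (odd (h x) != odd x).
Proof.
move=> lx; have := okd_par ok lx; have := okd_par ok (okd_lt ok lx).
rewrite (okd_inv ok) // (okd_lab ok) // okd_posparity // => p1 p2.
by case: (ltngtP x (m x)) p1 p2 (okd_neq ok lx) => [||<-//] _ p1 p2 _;
  [rewrite p2|rewrite p1]; rewrite // ?negbK; case: (odd x).
Qed.

End Okd.

(* [rwm] and [rwl] join a to a.+1, and join their former mates. *)
Definition rwm (a : nat) (m : nat -> nat) (x : nat) : nat :=
  if x == a then a.+1 else if x == a.+1 then a
  else if x == m a then m a.+1 else if x == m a.+1 then m a else m x.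

(** The label [l] is separate from [a] because multiplication on the right rewires the positions
    [N.*2 - a.+2] and the next one, while still giving the new arc the label [a.+1]. *)
Definition rwl (l a : nat) (m h : nat -> nat) (x : nat) : nat :=
  if (x == a) || (x == a.+1) then l
  else if (x == m a) || (x == m a.+1) then minn (h a) (h a.+1) else h x.


Section RwOkd.
Variables (N : nat) (m h : nat -> nat) (a : nat).
Hypotheses (ok : okd N m h) (ltaN : a.+1 < N).

Let la : a < N.*2. Proof. lia. Qed.
Let la1 : a.+1 < N.*2. Proof. lia. Qed.
Let lp := okd_lt ok la.
Let lq := okd_lt ok la1.
Let ip : m (m a) = a := okd_inv ok la.
Let iq : m (m a.+1) = a.+1 := okd_inv ok la1.

Variant rw_shape : Prop :=
| RwLoop of m a = a.+1 & m a.+1 = a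
| RwThrough of m a < a & a.+1 < m a.+1
| RwLeft of m a.+1 < m a & m a < a
| RwRight of a.+1 < m a.+1 & m a.+1 < m a.

(** If [a.+1] closes while [a] opens, planarity forces them to be mates; two ends facing the same
    way belong to nested arcs. *)
Lemma rw_shapeP : rw_shape.
Proof.
case: (eqVneq (m a) a.+1) => e; first by apply: RwLoop; rewrite // -e.
have e1 : m a.+1 <> a by move=> e1; move: iq e; rewrite e1 => ->; lia.
have e2 : m a.+1 <> m a by move=> e2; move: iq ip; rewrite e2 => ->; lia.
have np := okd_neq ok la; have nq := okd_neq ok la1.
case: (ltngtP (m a) a) => // lt.
- case: (ltngtP (m a.+1) a.+1) => // lt1; last by apply: RwThrough.
  have r : m a.+1 < a < m (m a.+1) by rewrite iq; lia.
  by have [/andP[l1 _] _] := okd_nest ok lq r; apply: RwLeft.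
- have r : a < a.+1 < m a by lia.
  by have [/andP[l1 l2] _] := okd_nest ok la r; apply: RwRight => //; lia.
Qed.

Lemma rwm_neqs : m a <> a.+1 ->
  [/\ m a <> m a.+1, m a.+1 <> a, m a.+1 <> a.+1 & m a <> a].
Proof.
move=> e; split.
- by move=> e2; move: iq ip; rewrite -e2 => ->; lia.
- by move=> e1; move: iq e; rewrite e1 => ->; lia.
- exact: (okd_neq ok la1).
- exact: (okd_neq ok la).
Qed.

Variant rw_spec (x : nat) : nat -> nat -> Type :=
| RwA of x = a : rw_spec x a.+1 a.+1
| RwB of x = a.+1 : rw_spec x a a.+1
| RwP of x = m a & m a <> a.+1 & m a.+1 <> a & x <> a & x <> a.+1 :
    rw_spec x (m a.+1) (minn (h a) (h a.+1))
| RwQ of x = m a.+1 & m a <> a.+1 & m a.+1 <> a & x <> a & x <> a.+1 & x <> m a: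
    rw_spec x (m a) (minn (h a) (h a.+1))
| RwO of x <> a & x <> a.+1 & x <> m a & x <> m a.+1 : rw_spec x (m x) (h x).

Lemma rw_natP x : rw_spec x (rwm a m x) (rwl a.+1 a m h x).
Proof.
rewrite /rwm /rwl; case: (eqVneq x a) => [->|na]; first by apply: RwA.
case: (eqVneq x a.+1) => [->|nb]; first by apply: RwB.
have H : x = m a \/ x = m a.+1 -> m a <> a.+1 /\ m a.+1 <> a.
  move=> H; case: rw_shapeP na nb H => [-> ->|||]; lia.
case: (eqVneq x (m a)) => [e|np] /=.
  by have [u v] := H (or_introl _ e); apply: RwP => //; lia.
case: (eqVneq x (m a.+1)) => [e|nq].
  by have [u v] := H (or_intror _ e); apply: RwQ => //; lia.
by apply: RwO; lia.
Qed.



Let nst x y : x < N.*2 -> x < y -> y < m x -> [/\ x < m y, m y < m x & h x < h y].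
Proof.
by move=> lx l1 l2; have [|/andP[]] := @okd_nest _ _ _ ok x y lx; rewrite ?l1.
Qed.

(** The arc joining the former mates takes the smaller label, so it stays below whatever was nested
    in either old arc. The arc from [a] to [a.+1] has label [a.+1], and an arc around it opens at
    some [x < a], hence has label at most [x.+1]. *)
Lemma rw_nest x y : x < N.*2 -> x < y < rwm a m x ->
  x < rwm a m y < rwm a m x /\ rwl a.+1 a m h x < rwl a.+1 a m h y.
Proof.
move=> lx.
have lo z : z < N.*2 -> h z <= z.+1.
  by move=> lz; have := okd_bnd ok lz; rewrite /height; lia.
have ba := lo _ la; have ba1 := lo _ la1.
have hp : h (m a) = h a := okd_lab ok la.
have hq : h (m a.+1) = h a.+1 := okd_lab ok la1.
have bp := lo _ lp; have bq := lo _ lq; have bx := lo _ lx.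
rewrite hp in bp; rewrite hq in bq.
have nx y' := @nst x y' lx.
case: (rw_natP x) => [ex|ex|ex n1 n2 n3 n4|ex n1 n2 n3 n4 n5|n1 n2 n3 n4] /andP[r1 r2].
- by move: r1 r2; clear -ex; lia.
- by move: r1 r2; clear -ex; lia.
- case: rw_shapeP => s1 s2; try by clear -ex r1 r2 s1 s2; lia.
  case: rw_natP => [ey|ey|ey ? ? ? ?|ey ? ? ? ? ?|k1 k2 k3 k4];
    try by clear -ex ey r1 r2 s1 s2 bp; lia.
  case: (ltngtP y a) k1 => // l1 _.
    by have [] := @nst (m a) y lp; rewrite ?ip ?hp; clear -ex l1 r1 r2 s1 s2; lia.
  have [] := @nst a.+1 y la1; clear -ex l1 r1 r2 s1 s2 k2; lia.
(* The old arcs were nested, and the new one spans the gap between their ends on one side. An arc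
   starting in the gap lies in the outer arc and cannot reach into the inner one, so it stays in the
   gap. *)
- have ly : y < N.*2 by move: lp r2; clear; lia.
  have iy := okd_inv ok ly; have lmy := okd_lt ok ly.
  case: rw_shapeP => s1 s2; try by clear -ex r1 r2 s1 s2; lia.
    case: rw_natP => [ey|ey|ey ? ? ? ?|ey ? ? ? ? ?|k1 k2 k3 k4];
      try by clear -ex ey r1 r2 s1 s2; lia.
    have [] := @nst (m a.+1) y lq; rewrite ?iq ?hq; try by clear -ex r1 r2 s1 s2; lia.
    move=> t1 t2 t3.
    suff : ~ m a < m y by case: (eqVneq (m y) (m a)) => e;
      [move: iy; rewrite e ip; lia | clear -ex e t1 t2 t3; lia].
    move=> t4.
    have t5 : m y <> a by move=> e; move: iy; rewrite e; lia.
    have t7 : m y < m (m a) by rewrite ip; clear -ex t2 t5 r2 s1 s2 t4 ; lia.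
    by have [t6 _ _] := nst lp t4 t7; move: t6; rewrite iy; clear -ex r1 r2; lia.
  case: rw_natP => [ey|ey|ey ? ? ? ?|ey ? ? ? ? ?|k1 k2 k3 k4];
    try by clear -ex ey r1 r2 s1 s2; lia.
  have [] := @nst a y la; try by clear -ex r1 r2 s1 s2; lia.
  move=> t1 t2 t3.
  suff : m a.+1 < m y by clear -ex t2 t3; lia.
  case: (ltngtP (m y) (m a.+1)) => // [t4|e].
    have t5 : m y <> a.+1 by move=> e; move: iy; rewrite e; lia.
    have t6 : a.+1 < m y by clear -t1 t5; lia.
    have [] := @nst a.+1 (m y) la1 t6 t4; rewrite iy; clear -ex r1 r2; lia.
  by move: iy; rewrite e iq; lia.
- case: (rw_natP y) => [ey|ey|ey ? ? ? ?|ey ? ? ? ? ?|k1 k2 k3 k4].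
  + have [||f1 f2 f3] := nx a; [by clear -r1 ey; lia|by clear -r2 ey; lia|].
    have nm : m x <> a.+1 by move=> e; move: (okd_inv ok lx); rewrite e; lia.
    split; first by clear -r1 r2 ey nm; lia.
    by clear -f3 ba; lia.
  + have nm : m x <> a by move=> e; move: (okd_inv ok lx); rewrite e; lia.
    have nm1 : m x <> a.+1 by move=> e; move: (okd_inv ok lx); rewrite e; lia.
    have [||f1 f2 f3] := nx a; [by clear -r1 ey n1; lia|by clear -r2 ey; lia|].
    split; first by clear -r1 r2 ey nm n1; lia.
    by clear -f3 ba; lia.
  + have [||f1 f2 f3] := nx (m a); [by rewrite -ey|by rewrite -ey|].
    rewrite ip in f1 f2.
    have nm1 : m x <> a.+1 by move=> e; move: (okd_inv ok lx); rewrite e; lia.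
    have [||f4 f5 f6] := nx a.+1; [by clear -f1; lia|by clear -f2 nm1; lia|].
    rewrite hp in f3; split; first by rewrite f4.
    by clear -f3 f6; lia.
  + have [||f1 f2 f3] := nx (m a.+1); [by rewrite -ey|by rewrite -ey|].
    rewrite iq in f1 f2.
    have [||f4 f5 f6] := nx a; [by clear -f1 n1; lia|by clear -f2; lia|].
    rewrite hq in f3; split; first by rewrite f4.
    by clear -f3 f6; lia.
  + by have [-> -> ->] := nx y r1 r2.
Qed.

Lemma rw_okd : okd N (rwm a m) (rwl a.+1 a m h).
Proof.
have hp : h (m a) = h a := okd_lab ok la.
have hq : h (m a.+1) = h a.+1 := okd_lab ok la1.
have ina x : x < N.*2 -> x <> m a -> m x <> a.
  by move=> lx n e; move: n; rewrite -e (okd_inv ok lx).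
have inb x : x < N.*2 -> x <> m a.+1 -> m x <> a.+1.
  by move=> lx n e; move: n; rewrite -e (okd_inv ok lx).
have inp x : x < N.*2 -> x <> a -> m x <> m a.
  by move=> lx n e; move: n; rewrite -ip -e (okd_inv ok lx).
have inq x : x < N.*2 -> x <> a.+1 -> m x <> m a.+1.
  by move=> lx n e; move: n; rewrite -iq -e (okd_inv ok lx).
have nab : a.+1 == a = false by lia.
split=> [x lx|x lx|x lx|x lx|x lx|x lx|]; last exact: rw_nest.
- case: (rw_natP x) => *; [exact: la1|exact: la|exact: lq|exact: lp|exact: (okd_lt ok)].
- case: (rw_natP x) => [->|->|-> n1 n2 n3 n4|-> n1 n2 n3 n4 n5|n1 n2 n3 n4]; try lia.
  + by have [] := rwm_neqs n1; lia.
  + exact: (okd_neq ok).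
- case: (rw_natP x) => [->|->|-> n1 n2 n3 n4|-> n1 n2 n3 n4 n5|n1 n2 n3 n4]; rewrite /rwm ?nab ?eqxx //.
  + have [/eqP/negbTE h1 /eqP/negbTE h2 /eqP/negbTE h3 _] := rwm_neqs n1.
    by rewrite h2 h3 eq_sym h1.
  + have [/eqP/negbTE h1 /eqP/negbTE h2 /eqP/negbTE h3 /eqP/negbTE h4] := rwm_neqs n1.
    by move/eqP/negbTE: n1 => n1; rewrite h4 n1.
  + have /eqP/negbTE -> := ina _ lx n3; have /eqP/negbTE -> := inb _ lx n4.
    have /eqP/negbTE -> := inp _ lx n1; have /eqP/negbTE -> := inq _ lx n2.
    exact: (okd_inv ok).
- case: (rw_natP x) => [_|_|_ n1 n2 n3 n4|_ n1 n2 n3 n4 n5|n1 n2 n3 n4]; rewrite /rwl ?nab ?eqxx ?orbT //.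
  + have [/eqP/negbTE h1 /eqP/negbTE h2 /eqP/negbTE h3 _] := rwm_neqs n1.
    by rewrite h2 h3.
  + have [/eqP/negbTE h1 /eqP/negbTE h2 /eqP/negbTE h3 /eqP/negbTE h4] := rwm_neqs n1.
    by move/eqP/negbTE: n1 => n1; rewrite h4 n1.
  + have /eqP/negbTE -> := ina _ lx n3; have /eqP/negbTE -> := inb _ lx n4.
    have /eqP/negbTE -> := inp _ lx n1; have /eqP/negbTE -> := inq _ lx n2.
    exact: (okd_lab ok).
- have ba := okd_bnd ok la; have ba1 := okd_bnd ok la1.
  have bp := okd_bnd ok lp; have bq := okd_bnd ok lq; have bx := okd_bnd ok lx.
  rewrite hp in bp; rewrite hq in bq; clear hp hq.
  case: (rw_natP x) => [ex|ex|ex n1 n2 n3 n4|ex n1 n2 n3 n4 n5|n1 n2 n3 n4] //.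
  + by rewrite ex /height; clear -ltaN; lia.
  + by rewrite ex /height; clear -ltaN; lia.
  + by rewrite ex /minn; case: ifP => l1; clear -bp ba1 l1; lia.
  + by rewrite ex /minn; case: ifP => l1; clear -ba bq l1; lia.
- have pp := okd_posparity ok la; have pq := okd_posparity ok la1.
  have pa := okd_par_iff ok la; have pa1 := okd_par_iff ok la1.
  case: (rw_natP x) => [->|->|-> n1 n2 n3 n4|-> n1 n2 n3 n4 n5|n1 n2 n3 n4] lt; try by clear -lt; lia.
  (* Only the shape with [m a < a] and [a.+1 < m a.+1] is left. The arcs open at [m a] and [a.+1],
     of equal parity, so both labels have the right parity and so has their minimum. *)
  + rewrite pp; case: rw_shapeP lt => s1 s2 lt; try by clear -lt n1 s1 s2; lia.
    have e1 : a < m a = false by clear -s1; lia.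
    have e2 : a.+1 < m a.+1 by clear -s2; lia.
    rewrite e1 in pa; rewrite e2 /= in pa1.
    by rewrite /minn; case: ifP; move: pa pa1; do 3!case: (odd _).
  + rewrite pq; case: rw_shapeP lt => s1 s2 lt; try by clear -lt n1 s1 s2; lia.
    * have r : m a < m (m a.+1) by rewrite iq; clear -s2; lia.
      have [_ _] := nst lq s1 r; rewrite hq hp => l1.
      have -> : minn (h a) (h a.+1) = h a.+1 by clear -l1; lia.
      have e1 : a.+1 < m a.+1 = false by clear -s1 s2; lia.
      by move: pa1; rewrite e1 /=; do 2!case: (odd _).
    * have r : a.+1 < m a by clear -s1 s2; lia.
      have [_ _ l1] := nst la (ltnSn a) r.
      have -> : minn (h a) (h a.+1) = h a by clear -l1; lia.
      have e1 : a < m a by clear -s1 s2; lia.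
      by move: pa; rewrite e1 /=; do 2!case: (odd _).
  + exact: (okd_par ok).
Qed.

End RwOkd.

Ltac split_ifs := repeat (case: eqP => ?; try lia).

Lemma rwm_idem a m x : rwm a (rwm a m) x = rwm a m x.
Proof.
rewrite {1}/rwm; case: eqP => [->|/eqP/negbTE na]; first by rewrite /rwm eqxx.
case: eqP => [->|/eqP/negbTE nb]; first by rewrite /rwm eqxx ifN //; lia.
have -> : rwm a m a = a.+1 by rewrite /rwm eqxx.
have -> : rwm a m a.+1 = a by rewrite /rwm eqxx ifN //; lia.
by rewrite na nb.
Qed.

Lemma rwl_idem l a m h x : rwl l a (rwm a m) (rwl l a m h) x = rwl l a m h x.
Proof.
rewrite {1}/rwl; case: ifP => [e|]; first by rewrite /rwl e.
have -> : rwm a m a = a.+1 by rewrite /rwm eqxx.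
have -> : rwm a m a.+1 = a by rewrite /rwm eqxx ifN //; lia.
by rewrite orbC => ->.
Qed.

Section Braid.
Variables (N : nat) (m h : nat -> nat) (a : nat).
Hypotheses (ok : okd N m h) (ltaN : a.+2 < N).
Hypotheses (m12 : m a.+1 = a.+2) (h1 : h a.+1 = a.+2).

Let m21 : m a.+2 = a.+1. Proof. by rewrite -m12 (okd_inv ok) //; lia. Qed.
Let h2 : h a.+2 = a.+2. Proof. by rewrite -m12 (okd_lab ok) //; lia. Qed.

Let neqs : [/\ m a <> a, m a <> a.+1 & m a <> a.+2].
Proof.
have la : a < N.*2 by lia.
split; first exact: (okd_neq ok la).
  by move=> e; move: (okd_inv ok la); rewrite e m12; lia.
by move=> e; move: (okd_inv ok la); rewrite e m21; lia.
Qed.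

(** Rewiring at [a] hands the mate of [a] over to [a.+2], and rewiring at [a.+1] hands it back. No
    label is lost on the way, since [h a <= a.+1] lies below [h a.+1]. *)
Lemma rwm_braid x : x < N.*2 -> rwm a.+1 (rwm a m) x = m x.
Proof.
move=> lx; have [na na1 na2] := neqs; have la : a < N.*2 by lia.
have e1 : rwm a m a.+1 = a by rewrite /rwm ifN ?eqxx //; lia.
have e2 : rwm a m a.+2 = m a by rewrite /rwm m12 eqxx !ifN //; lia.
rewrite {1}/rwm e1 e2.
case: eqP => [->//|n1]; case: eqP => [->//|n2]; case: eqP => [->//|n3].
case: eqP => [->|n4]; first by rewrite (okd_inv ok).
by rewrite /rwm m12 !ifN //; lia.
Qed.

Lemma rwl_braid x : x < N.*2 ->
  rwl a.+2 a.+1 (rwm a m) (rwl a.+1 a m h) x = h x.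
Proof.
move=> lx; have [na na1 na2] := neqs; have la : a < N.*2 by lia.
have := okd_bnd ok la; rewrite /height => ba.
have e1 : rwm a m a.+1 = a by rewrite /rwm ifN ?eqxx //; lia.
have e2 : rwm a m a.+2 = m a by rewrite /rwm m12 eqxx !ifN //; lia.
have e3 : rwl a.+1 a m h a.+1 = a.+1 by rewrite /rwl eqxx orbT.
have e4 : rwl a.+1 a m h a.+2 = h a.
  rewrite /rwl ifN ?m12 ?eqxx ?orbT ?h1; lia.
rewrite {1}/rwl e1 e2 e3 e4.
case: eqP => [->//|n1]; case: eqP => [->//|n2]; case: eqP => [->|n3] /=; first lia.
case: eqP => [->|n4]; first by rewrite (okd_lab ok) //; lia.
by rewrite /rwl m12 !ifN //; lia.
Qed.

End Braid.


(** * Commutation of rewirings at disjoint pairs of positions *)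

Section Follow.
Variables (n : nat) (m : nat -> nat) (a : nat).
Hypotheses (la : a < n) (la1 : a.+1 < n).
Hypotheses (lt : forall x, x < n -> m x < n).
Hypotheses (inv : forall x, x < n -> m (m x) = x).
Hypotheses (neq : forall x, x < n -> m x <> x).

Lemma inv_eq x y : x < n -> y < n -> (x == m y) = (m x == y).
Proof. by move=> lx ly; apply/eqP/eqP => [->|<-]; rewrite inv. Qed.

(** The tests are moved from [x] to [m x], so that they compare with [a] and [a.+1] only; composed
    rewirings can then be evaluated by following the arc from [x]. *)
Lemma rwm_follow x : x < n -> x <> a -> x <> a.+1 ->
  rwm a m x = if m x == a then m a.+1 else if m x == a.+1 then m a else m x.
Proof.
by move=> lx /eqP/negbTE n1 /eqP/negbTE n2; rewrite /rwm n1 n2 !inv_eq.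
Qed.

Lemma rwl_follow l h x : x < n -> x <> a -> x <> a.+1 ->
  rwl l a m h x =
  if (m x == a) || (m x == a.+1) then minn (h a) (h a.+1) else h x.
Proof.
by move=> lx /eqP/negbTE n1 /eqP/negbTE n2; rewrite /rwl n1 n2 !inv_eq.
Qed.

Lemma rwm_lt x : x < n -> rwm a m x < n.
Proof. by move=> lx; rewrite /rwm; do ![case: ifP => _ //]; apply: lt. Qed.

Lemma rwm_inv x : x < n -> rwm a m (rwm a m x) = x.
Proof.
move=> lx.
have aa : rwm a m a = a.+1 by rewrite /rwm eqxx.
have ab : rwm a m a.+1 = a by rewrite /rwm eqxx ifN //; lia.
case: (eqVneq x a) => [->|n1]; first by rewrite aa ab.
case: (eqVneq x a.+1) => [->|n2]; first by rewrite ab aa.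
have [p q] := (neq la, neq la1).
have := inv la; have := inv la1; have := inv lx => e e1 e2.
rewrite (rwm_follow lx); [|lia|lia].
have mneq u v : u < n -> v < n -> m u = v -> m v = u by move=> lu lv <-; apply: inv.
case: (eqVneq (m x) a) => [/(mneq _ _ lx la) xa|n3].
  have q' : m a.+1 <> a by move=> f; move: e1; rewrite f xa; lia.
  by rewrite rwm_follow ?e1 ?eqxx ?lt // ifN //; lia.
case: (eqVneq (m x) a.+1) => [/(mneq _ _ lx la1) xa|n4].
  have q' : m a <> a.+1 by move=> f; move: e2; rewrite f xa; lia.
  by rewrite rwm_follow ?e2 ?eqxx ?lt.
by rewrite rwm_follow ?lt ?e ?(negbTE n1) ?(negbTE n2) //; lia.
Qed.

End Follow.

Section Comm.
Variables (n : nat) (m h : nat -> nat) (a b : nat).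
Hypotheses (ltab : a.+1 < b) (ltb : b.+1 < n).
Hypotheses (lt : forall x, x < n -> m x < n).
Hypotheses (inv : forall x, x < n -> m (m x) = x).
Hypotheses (lab : forall x, x < n -> h (m x) = h x).
Hypotheses (neq : forall x, x < n -> m x <> x).

Let la : a < n. Proof. lia. Qed.
Let la1 : a.+1 < n. Proof. lia. Qed.
Let lb : b < n. Proof. lia. Qed.

Let inj x y : x < n -> y < n -> m x = m y -> x = y.
Proof. by move=> lx ly e; rewrite -(inv lx) e inv. Qed.

(** If [m x] is none of the four rewired positions nothing happens to [x]; otherwise the answer
    depends only on which of the four it is and on which arcs join the pair at [a] to the pair at
    [b]. The pairs may lie anywhere below [n], so that one of them can act on the right half. *)
Lemma rwm_comm x : x < n -> rwm b (rwm a m) x = rwm a (rwm b m) x.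
Proof.
move=> lx.
have lta := rwm_lt la la1 lt; have ltb' := rwm_lt lb ltb lt.
have ia := rwm_inv la la1 lt inv neq; have ib := rwm_inv lb ltb lt inv neq.
have aa : rwm a m a = a.+1 by rewrite /rwm eqxx.
have ab : rwm a m a.+1 = a by rewrite /rwm eqxx ifN //; lia.
have ba : rwm b m b = b.+1 by rewrite /rwm eqxx.
have bb : rwm b m b.+1 = b by rewrite /rwm eqxx ifN //; lia.
case: (eqVneq x a) => [->|xa].
  by rewrite (rwm_follow lb ltb ia) ?aa; [rewrite !ifN /rwm ?eqxx //|..]; lia.
case: (eqVneq x a.+1) => [->|xa1].
  rewrite (rwm_follow lb ltb ia) ?ab; [rewrite !ifN /rwm ?eqxx //|..]; try lia.
  by rewrite ifN //; lia.
case: (eqVneq x b) => [->|xb].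
  rewrite (rwm_follow la la1 ib) ?ba; [rewrite !ifN /rwm ?eqxx //|..]; lia.
case: (eqVneq x b.+1) => [->|xb1].
  rewrite (rwm_follow la la1 ib) ?bb; [rewrite !ifN /rwm ?eqxx //|..]; try lia.
  by rewrite ifN //; lia.
rewrite (rwm_follow la la1 ib) ?(rwm_follow lb ltb ia); try lia.
rewrite !(rwm_follow la la1 inv) ?(rwm_follow lb ltb inv); try lia.
have t u v : u < n -> v < n -> (m u == v) = (m v == u).
  by move=> lu lv; rewrite eq_sym (inv_eq inv).
have na := neq la; have na1 := neq la1; have nb := neq lb; have nb1 := neq ltb.
have t1 := (t _ _ lb la, t _ _ ltb la, t _ _ lb la1, t _ _ ltb la1).
have t2 := (t _ _ la lb, t _ _ la ltb, t _ _ la1 lb, t _ _ la1 ltb).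
have e u v : u < n -> v < n -> m u = v -> m v = u by move=> lu lv <-; apply: inv.
have i1 : m a <> m b by move/inj => j; have := j la lb; lia.
have i2 : m a <> m b.+1 by move/inj => j; have := j la ltb; lia.
have i3 : m a.+1 <> m b by move/inj => j; have := j la1 lb; lia.
have i4 : m a.+1 <> m b.+1 by move/inj => j; have := j la1 ltb; lia.
have e1 := e _ _ lx la; have e2 := e _ _ lx la1; have e3 := e _ _ lx lb.
have e4 := e _ _ lx ltb.
clear -e1 e2 e3 e4 i1 i2 i3 i4 na na1 nb nb1 xa xa1 xb xb1 ltab t1 t2.
have d1 : (a == b) = false by clear -ltab; lia.
have d2 : (a.+1 == b) = false by clear -ltab; lia.
have d3 : (a == b.+1) = false by clear -ltab; lia.
have d4 : (a.+1 == b.+1) = false by clear -ltab; lia.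
have dd := (d1, d2, d3, d4, eq_sym b a, eq_sym b a.+1, eq_sym b.+1 a, eq_sym b.+1 a.+1,
  negbTE xa, negbTE xa1, negbTE xb, negbTE xb1).
have sa : (a.+1 == a) = false by clear; lia.
have sb : (b.+1 == b) = false by clear; lia.
clear -e1 e2 e3 e4 i1 i2 i3 i4 na na1 nb nb1 dd sa sb t1 t2.
case: (eqVneq (m x) a) => [ex|n1].
  rewrite ?ex !t1 (e1 ex) ?dd ?eqxx; clear -i1 i2 i3 i4 na na1 nb nb1.
  by split_ifs.
case: (eqVneq (m x) a.+1) => [ex|n2].
  rewrite ?ex !t1 (e2 ex) ?dd ?eqxx ?sa; clear -i1 i2 i3 i4 na na1 nb nb1.
  by split_ifs.
case: (eqVneq (m x) b) => [ex|n3].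
  rewrite ?ex !t2 (e3 ex) ?dd ?eqxx; clear -i1 i2 i3 i4 na na1 nb nb1.
  by split_ifs.
case: (eqVneq (m x) b.+1) => [ex|n4].
  rewrite ?ex !t2 (e4 ex) ?dd ?eqxx ?sb; clear -i1 i2 i3 i4 na na1 nb nb1.
  by split_ifs.
by rewrite (negbTE n1) (negbTE n2).
Qed.


Lemma rwl_comm k l x : x < n ->
  rwl l b (rwm a m) (rwl k a m h) x = rwl k a (rwm b m) (rwl l b m h) x.
Proof.
move=> lx.
have lta := rwm_lt la la1 lt; have ltb' := rwm_lt lb ltb lt.
have ia := rwm_inv la la1 lt inv neq; have ib := rwm_inv lb ltb lt inv neq.
have aa : rwm a m a = a.+1 by rewrite /rwm eqxx.
have ab : rwm a m a.+1 = a by rewrite /rwm eqxx ifN //; lia.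
have ba : rwm b m b = b.+1 by rewrite /rwm eqxx.
have bb : rwm b m b.+1 = b by rewrite /rwm eqxx ifN //; lia.
case: (eqVneq x a) => [->|xa].
  by rewrite (rwl_follow lb ltb ia) ?aa; [rewrite ifN /rwl ?eqxx //|..]; lia.
case: (eqVneq x a.+1) => [->|xa1].
  by rewrite (rwl_follow lb ltb ia) ?ab; [rewrite ifN /rwl ?eqxx ?orbT //|..]; lia.
case: (eqVneq x b) => [->|xb].
  by rewrite (rwl_follow la la1 ib) ?ba; [rewrite ifN /rwl ?eqxx //|..]; lia.
case: (eqVneq x b.+1) => [->|xb1].
  by rewrite (rwl_follow la la1 ib) ?bb; [rewrite ifN /rwl ?eqxx ?orbT //|..]; lia.
rewrite (rwl_follow la la1 ib) ?(rwl_follow lb ltb ia); try lia.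
rewrite (rwm_follow la la1 inv) ?(rwm_follow lb ltb inv); try lia.
rewrite !(rwl_follow la la1 inv) ?(rwl_follow lb ltb inv); try lia.
have t u v : u < n -> v < n -> (m u == v) = (m v == u).
  by move=> lu lv; rewrite eq_sym (inv_eq inv).
have e u v : u < n -> v < n -> m u = v -> m v = u by move=> lu lv <-; apply: inv.
have f u v : u < n -> v < n -> m u = v -> h u = h v by move=> lu lv <-; rewrite lab.
have e1 := e _ _ lx la; have e2 := e _ _ lx la1; have e3 := e _ _ lx lb.
have e4 := e _ _ lx ltb.
have f1 := f _ _ lx la; have f2 := f _ _ lx la1; have f3 := f _ _ lx lb.
have f4 := f _ _ lx ltb.
have g1 := f _ _ la lb; have g2 := f _ _ la1 lb; have g3 := f _ _ la ltb.
have g4 := f _ _ la1 ltb.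
have k1 := f _ _ lb la; have k2 := f _ _ lb la1; have k3 := f _ _ ltb la.
have k4 := f _ _ ltb la1.
have t1 := (t _ _ lb la, t _ _ ltb la, t _ _ lb la1, t _ _ ltb la1).
have t2 := (t _ _ la lb, t _ _ la ltb, t _ _ la1 lb, t _ _ la1 ltb).
clear -e1 e2 e3 e4 f1 f2 f3 f4 g1 g2 g3 g4 k1 k2 k3 k4 xa xa1 xb xb1 ltab t1 t2.
have d1 : (a == b) = false by clear -ltab; lia.
have d2 : (a.+1 == b) = false by clear -ltab; lia.
have d3 : (a == b.+1) = false by clear -ltab; lia.
have d4 : (a.+1 == b.+1) = false by clear -ltab; lia.
have dd := (d1, d2, d3, d4, eq_sym b a, eq_sym b a.+1, eq_sym b.+1 a, eq_sym b.+1 a.+1,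
  negbTE xa, negbTE xa1, negbTE xb, negbTE xb1).
have sa : (a.+1 == a) = false by clear; lia.
have sb : (b.+1 == b) = false by clear; lia.
clear -e1 e2 e3 e4 f1 f2 f3 f4 g1 g2 g3 g4 k1 k2 k3 k4 dd sa sb t1 t2.
case: (eqVneq (m x) a) => [ex|n1].
  rewrite (f1 ex) ?ex !t1 (e1 ex) ?dd ?eqxx; clear -g1 g2 g3 g4.
  by split_ifs => /=; lia.
case: (eqVneq (m x) a.+1) => [ex|n2].
  rewrite (f2 ex) ?ex !t1 (e2 ex) ?dd ?eqxx ?sa; clear -g1 g2 g3 g4.
  by split_ifs => /=; lia.
case: (eqVneq (m x) b) => [ex|n3].
  rewrite (f3 ex) ?ex !t2 (e3 ex) ?dd ?eqxx; clear -k1 k2 k3 k4.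
  by split_ifs => /=; lia.
case: (eqVneq (m x) b.+1) => [ex|n4].
  rewrite (f4 ex) ?ex !t2 (e4 ex) ?dd ?eqxx ?sb; clear -k1 k2 k3 k4.
  by split_ifs => /=; lia.
by rewrite ?(negbTE n1) ?(negbTE n2) ?(negbTE n3) ?(negbTE n4).
Qed.

End Comm.

(** * The total of the labels and its change under rewiring *)

Lemma sumn_patch (n : nat) (f g : nat -> nat) (s : seq nat) :
  uniq s -> (forall x, x \in s -> x < n) ->
  (forall x, x < n -> x \notin s -> f x = g x) ->
  \sum_(0 <= x < n) f x + \sum_(x <- s) g x =
  \sum_(0 <= x < n) g x + \sum_(x <- s) f x.
Proof.
move=> us ls e.
have sp F : \sum_(0 <= x < n) F x =
    \sum_(x <- s) F x + \sum_(0 <= x < n | x \notin s) F x.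
  rewrite (bigID (fun x => x \in s)) /=; congr addn.
  rewrite -big_filter; apply: perm_big; apply: uniq_perm => //.
    exact: filter_uniq (iota_uniq _ _).
  move=> x; rewrite mem_filter mem_index_iota /=.
  by case xs: (x \in s) => //=; rewrite ls.
rewrite !sp.
have -> : \sum_(0 <= x < n | x \notin s) f x = \sum_(0 <= x < n | x \notin s) g x.
  rewrite big_nat_cond [RHS]big_nat_cond.
  by apply: eq_bigr => x /andP[/andP[_ lx] ns]; apply: e.
lia.
Qed.

Definition weight (n : nat) (h : nat -> nat) : nat := \sum_(0 <= x < n) h x.

(** The four ends carry twice [h a + h a.+1] before, and twice [a.+1] plus the minimum after, which
    leaves the maximum to account for. When [a] and [a.+1] are already mates only two ends count,
    and the balance is the same. *)
Lemma weight_rw N m h a : okd N m h -> a.+1 < N ->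
  weight N.*2 (rwl a.+1 a m h) + (maxn (h a) (h a.+1)).*2 =
  weight N.*2 h + a.+1.*2.
Proof.
move=> ok ltaN; rewrite /weight.
have la : a < N.*2 by lia.
have la1 : a.+1 < N.*2 by lia.
have lp := okd_lt ok la; have lq := okd_lt ok la1.
have hp : h (m a) = h a := okd_lab ok la.
have hq : h (m a.+1) = h a.+1 := okd_lab ok la1.
have va : rwl a.+1 a m h a = a.+1 by rewrite /rwl eqxx.
have vb : rwl a.+1 a m h a.+1 = a.+1 by rewrite /rwl eqxx orbT.
case: (eqVneq (m a) a.+1) => [e|/eqP n1].
  have e1 : m a.+1 = a by rewrite -e (okd_inv ok).
  have u : uniq [:: a; a.+1] by rewrite /= !inE; lia.
  have l x : x \in [:: a; a.+1] -> x < N.*2 by rewrite !inE => /orP[] /eqP ->.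
  have f x : x < N.*2 -> x \notin [:: a; a.+1] -> rwl a.+1 a m h x = h x.
    by move=> lx; rewrite !inE /rwl e e1 [(x == a.+1) || _]orbC => /negbTE ->.
  have ee : h a.+1 = h a by rewrite -hp e.
  have := sumn_patch u l f; rewrite !big_cons !big_nil va vb ee maxnn.
  by clear; lia.
have [n2 n3 n4 n5] := rwm_neqs ok ltaN n1.
have vp : rwl a.+1 a m h (m a) = minn (h a) (h a.+1).
  by rewrite /rwl eqxx ifN //; lia.
have vq : rwl a.+1 a m h (m a.+1) = minn (h a) (h a.+1).
  by rewrite /rwl eqxx orbT ifN //; lia.
have u : uniq [:: a; a.+1; m a; m a.+1] by rewrite /= !inE; lia.
have l x : x \in [:: a; a.+1; m a; m a.+1] -> x < N.*2.
  by rewrite !inE => /or4P[] /eqP ->.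
have f x : x < N.*2 -> x \notin [:: a; a.+1; m a; m a.+1] -> rwl a.+1 a m h x = h x.
  move=> lx; rewrite !inE /rwl !negb_or => /and4P[/negbTE -> /negbTE ->].
  by move=> /negbTE -> /negbTE ->.
have := sumn_patch u l f; rewrite !big_cons !big_nil va vb vp vq hp hq.
by clear; lia.
Qed.

Lemma weight_max N m h : okd N m h -> weight N.*2 h <= weight N.*2 (height N).
Proof.
move=> ok; rewrite /weight !big_mkord; apply: leq_sum => -[x lx] _.
by case/andP: (okd_bnd ok lx).
Qed.

(** * The coefficients of the generators on diagrams *)

Section Coef.
Import GRing.Theory.
Local Open Scope ring_scope.
Variables (K : comNzRingType) (X Y : nat -> K).

(* The coefficient of E_{i+1} D, where [m] is the larger label of D at the
   positions i and i.+1: reducing E_{i+1} D to a diagram deletes i + 2 - m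
   letters, two for each factor y and one for a factor x. *)
Fixpoint coef (i m : nat) : K :=
  if m == i.+2 then 1 else if m == i.+1 then X i else
  match i with
  | i'.+2 => Y i'.+1 * coef i' m
  | 1%N => Y 0%N
  | 0%N => 1
  end.

(** For labels [0 < m <= i.+2] the recursion ends in one of the two tests, or at [i = 1] and
    [m = 1], where a single factor $y_1$ remains; the value at [i = 0] is then only a filler. *)
Lemma coefE i m : coef i m =
  if m == i.+2 then 1 else if m == i.+1 then X i else
  match i with
  | i'.+2 => Y i'.+1 * coef i' m
  | 1%N => Y 0%N
  | 0%N => 1
  end.
Proof. by case: i. Qed.

Lemma coef_red i : coef i i.+2 = 1.
Proof. by rewrite coefE eqxx. Qed.

Lemma coef_sq i : coef i i.+1 = X i.
Proof. by rewrite coefE eqxx ifN //; lia. Qed.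

Lemma coef_braid i : coef i.+1 i.+1 = Y i.
Proof.
rewrite coefE ifN ?ifN; try lia.
by case: i => // i; rewrite coef_red mulr1.
Qed.

(** Going down from [i] by steps of two reaches [h.-2] because of the parities. The factors met
    before that form [coef i h], the others [coef h.-2 m]. *)
Lemma coef_chain i h m : (0 < m < h)%N -> (h <= i.+2)%N -> odd h = odd i ->
  coef i m = coef i h * coef h.-2 m.
Proof.
elim/ltn_ind: i h => i IH h /andP[m0 mh] hi od.
case: (eqVneq h i.+2) => [->|ne]; first by rewrite coef_red mul1r.
case: i => [|[|i]] in IH hi od ne *; [lia|lia|].
have e1 : (m == i.+4) = false by lia.
have e2 : (m == i.+3) = false by lia.
have e3 : (h == i.+4) = false by lia.
have e4 : (h == i.+3) = false by lia.
rewrite [LHS]coefE [in RHS](coefE i.+2 h) e1 e2 e3 e4 -mulrA; congr (_ * _).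
apply: IH; lia.
Qed.

(* [h] is the label of an arc from a + 1 to b, [p] and [q] those of the arcs
   through a and b + 1. *)
Lemma coef_swap a b h p q : (0 < p)%N -> (0 < q)%N ->
  (h <= a.+2)%N -> (h <= b.+2)%N -> odd h = odd a -> odd h = odd b ->
  coef a (maxn p h) * coef b (maxn (minn p h) q) =
  coef b (maxn h q) * coef a (maxn p (minn h q)).
Proof.
move=> p0 q0 ha hb oa ob.
case hp: (h <= p)%N.
  have -> : maxn p (minn h q) = p by lia.
  have -> : maxn p h = p by lia.
  have -> : minn p h = h by lia.
  by rewrite mulrC.
have -> : maxn p h = h by lia.
have -> : minn p h = p by lia.
case hq: (h <= q)%N.
  have -> : maxn p q = q by lia.
  have -> : minn h q = h by lia.
  have -> : maxn h q = q by lia.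
  have -> : maxn p h = h by lia.
  by rewrite mulrC.
have -> : minn h q = q by lia.
have -> : maxn h q = h by lia.
(* Both descents pass through [h], so that both sides become the product of [coef a h], [coef b h]
   and [coef h.-2 (maxn p q)]. *)
rewrite (@coef_chain b h (maxn p q)) ?(@coef_chain a h (maxn p q)) //; try lia.
by rewrite mulrCA.
Qed.

(** The two generators interact only when an arc joins the pair at [a] to the pair at [b], for then
    one rewiring changes a label that the other one reads. *)
Lemma coef_comm N m h a b : okd N m h -> (a.+1 < b)%N -> (b.+1 < N)%N ->
  let M (l : nat -> nat) (i : nat) := maxn (l i) (l i.+1) in
  coef a (M h a) * coef b (M (rwl a.+1 a m h) b) =
  coef b (M h b) * coef a (M (rwl b.+1 b m h) a).
Proof.
move=> ok ltab ltbN M.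
have la : (a < N.*2)%N by lia.
have la1 : (a.+1 < N.*2)%N by lia.
have lb : (b < N.*2)%N by lia.
have lb1 : (b.+1 < N.*2)%N by lia.
have inv := okd_inv ok; have lab := okd_lab ok.
have bd x : (x < N.*2)%N -> (0 < h x <= x.+1)%N.
  by move=> lx; have := okd_bnd ok lx; rewrite /height; clear; lia.
have [[[ba ba1] bb] bb1] := (bd _ la, bd _ la1, bd _ lb, bd _ lb1).
have t u v : (u < N.*2)%N -> (v < N.*2)%N -> (u == m v) = (m v == u).
  by move=> _ _; rewrite eq_sym.
have t' u v : (u < N.*2)%N -> (v < N.*2)%N -> (u == m v) = (v == m u).
  by move=> lu lv; apply/eqP/eqP => ->; rewrite inv.
rewrite /M /rwl.
have -> : (b == a) || (b == a.+1) = false by lia.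
have -> : (b.+1 == a) || (b.+1 == a.+1) = false by lia.
have -> : (a == b) || (a == b.+1) = false by lia.
have -> : (a.+1 == b) || (a.+1 == b.+1) = false by lia.
rewrite (t' a b) // (t' a b.+1) // (t' a.+1 b) // (t' a.+1 b.+1) //.
have nst x y lx r := @okd_nest _ _ _ ok x y lx r.
(* An arc from [a.+1] to [b] is the one case where the maxima really change; there [coef_swap] is
   needed. *)
case: (eqVneq b (m a.+1)) => [e1|n1].
  have hb : h b = h a.+1 by rewrite e1 lab.
  have o1 : odd b = ~~ odd a.+1 by rewrite e1; apply: (okd_posparity ok la1).
  have o2 : odd (h a.+1) = ~~ odd a.+1 by apply: (okd_par ok); rewrite // -e1; lia.
  rewrite hb.
  case: (eqVneq b.+1 (m a)) => [e2|n2].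
    have hb1 : h b.+1 = h a by rewrite e2 lab.
    have -> : (b == m a) = false by lia.
    have -> : (b.+1 == m a.+1) = false by lia.
    rewrite /= hb1; have [|_ lt] := nst a a.+1 la; first lia.
    have -> : maxn (minn (h a) (h a.+1)) (minn (h a) (h a.+1)) = maxn (minn (h a) (h a.+1)) (h a) by lia.
    have -> : maxn (minn (h a.+1) (h a)) (minn (h a.+1) (h a)) = maxn (h a) (minn (h a.+1) (h a)) by lia.
    apply: coef_swap; lia.
  have -> : (b == m a) = false.
    by case: eqP => // e3; move: (inv _ la) (inv _ la1); rewrite -e1 -e3; lia.
  have -> : (b.+1 == m a.+1) = false by lia.
  rewrite /=; apply: coef_swap; lia.
(* In the three other ways of joining the pairs, the joining arc contains [a.+1] or [b] in its
   interior. The label there is larger, so neither maximum is affected. *)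
case: (eqVneq b.+1 (m a)) => [e2|n2] /=.
  have [|_ lt1] := nst a a.+1 la; first lia.
  have [|_ lt2] := nst a b la; first lia.
  have -> : (b == m a) = false by lia.
  have -> : (b.+1 == m a.+1) = false by case: eqP => // e3; move: (inv _ la) (inv _ la1); rewrite -e2 -e3; lia.
  have hb : h b.+1 = h a by rewrite e2 lab.
  rewrite /= hb mulrC; congr (coef _ _ * coef _ _); lia.
case: (eqVneq b (m a)) => [e1|n3] /=.
  have [|_ lt1] := nst a a.+1 la; first lia.
  have -> : (b.+1 == m a.+1) = false.
    case: eqP => // e3; have [|lt _] := nst a a.+1 la; lia.
  have hb : h b = h a by rewrite e1 lab.
  rewrite /= hb mulrC; congr (coef _ _ * coef _ _); lia.
case: (eqVneq b.+1 (m a.+1)) => [e1|n4] /=; last by rewrite mulrC.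
have [|_ lt1] := nst a.+1 b la1; first lia.
have hb : h b.+1 = h a.+1 by rewrite e1 lab.
rewrite hb mulrC; congr (coef _ _ * coef _ _); lia.
Qed.

End Coef.

(** * Splitting a generator off a diagram at its first defect *)

Section Cut.
Variables (N : nat) (m h : nat -> nat) (a : nat).
Hypotheses (ok : okd N m h) (ltaN : a.+1 < N).
Hypotheses (ma : m a = a.+1) (ha : h a = a.+1).
Hypothesis low : forall x, x < a -> h x = x.+1.

Let lt := okd_lt ok.
Let inv := okd_inv ok.
Let lab := okd_lab ok.
Let la : a < N.*2. Proof. by clear -ltaN; lia. Qed.
Let la1 : a.+1 < N.*2. Proof. by clear -ltaN; lia. Qed.
Let ma1 : m a.+1 = a. Proof. by rewrite -ma inv. Qed.
Let ha1 : h a.+1 = a.+1. Proof. by rewrite -{1}ma lab. Qed.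
Let nst x y : x < N.*2 -> x < y -> y < m x -> [/\ x < m y, m y < m x & h x < h y].
Proof.
by move=> lx l1 l2; have [|/andP[]] := @okd_nest _ _ _ ok x y lx; rewrite ?l1.
Qed.

Let low1 x : x < a.+2 -> h x <= a.+1.
Proof.
move=> lx; case: (ltngtP x a) => [l|l|->]; last by rewrite ha.
  by rewrite low //; move: l; clear; lia.
have -> : x = a.+1 by move: lx l; clear; lia.
by rewrite ha1.
Qed.

(* To undo the multiplication by G_{a+1} where the labels first fall short of
   the height, cut the arc through the first position q after a.+1 whose label
   does not exceed that of the arc from a to a.+1. *)
Definition cut_node (q : nat) : Prop :=
  [/\ a.+1 < q, q <= N.*2 - a.+2, h q <= a.+1 &
      forall x, a.+1 < x < q -> a.+1 < h x].

Section CutAt.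
Variable q : nat.
Hypothesis cq : cut_node q.
Let aq : a.+1 < q. Proof. by case: cq. Qed.
Let qN : q <= N.*2 - a.+2. Proof. by case: cq. Qed.
Let hq : h q <= a.+1. Proof. by case: cq. Qed.
Let hI x : a.+1 < x < q -> a.+1 < h x. Proof. by case: cq => _ _ _; apply. Qed.
Let lq : q < N.*2. Proof. by move: qN ltaN; clear; lia. Qed.
Let p := m q.
Let lp : p < N.*2. Proof. exact: lt. Qed.
Let mp : m p = q. Proof. exact: inv. Qed.
Let hp : h p = h q. Proof. exact: lab. Qed.

Let pP : p < a \/ q < p.
Proof.
have n1 : p <> a by move=> e; move: mp; rewrite e ma; move: aq; clear; lia.
have n2 : p <> a.+1 by move=> e; move: mp; rewrite e ma1; move: aq; clear; lia.
have n3 : ~ (a.+1 < p < q) by move=> /hI; rewrite hp; move: hq; clear; lia.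
have n4 : p <> q by apply: (okd_neq ok).
by move: n1 n2 n3 n4; clear; lia.
Qed.

Let inI x : a.+1 < x < q -> a.+1 < m x < q.
Proof.
move=> rx; have hx := hI rx; have lx : x < N.*2 by move: rx lq; clear; lia.
have n1 : a.+1 < m x.
  by rewrite ltnNge; apply/negP => /low1; rewrite lab //; move: hx; clear; lia.
rewrite n1; case: (ltngtP (m x) q) => // [l|e].
  have [||_ _] := @nst x q lx; [by case/andP: rx|by []|].
  by move: hq hx; clear; lia.
by move: hx; rewrite -(lab lx) e; move: hq; clear; lia.
Qed.

Let notI x : x < N.*2 -> ~ (a.+1 < x < q) -> ~ (a.+1 < m x < q).
Proof. by move=> lx n /inI; rewrite inv. Qed.

Let oq : odd q = odd a.
Proof.
suff : odd a.+2 = odd q by move <-; rewrite /= negbK.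
apply: (@closed_even m) => // [x rx|x y rx /andP[l1 l2]].
  have lx : x < N.*2 by move: rx lq; clear; lia.
  by split; [exact: (okd_neq ok)|split; [exact: inv|exact: inI]].
have lx : x < N.*2 by move: rx lq; clear; lia.
by have [-> -> _] := nst lx l1 l2.
Qed.

(** Needed because the arc from [a.+1] to [q] will get the label [a.+2]. An arc of this label
    between them would be outermost there, all labels being at least [a.+2]; a closed block would
    precede its opening [x], so [x] would have the parity of [a], which contradicts the parity of
    its label. *)
Let hI2 x : a.+1 < x < q -> a.+2 < h x.
Proof.
wlog op : x / x < m x.
  move=> H rx; have lx : x < N.*2 by move: rx lq; clear; lia.
  case: (ltngtP x (m x)) => [/H-> //|l|e]; last by case: (okd_neq ok lx).
  by rewrite -(lab lx); apply: H; rewrite ?inv //; apply: inI.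
move=> rx; have lx : x < N.*2 by move: rx lq; clear; lia.
have hx := hI rx; rewrite ltn_neqAle hx andbT; apply/eqP => e.
have o1 := okd_par ok lx op; rewrite -e in o1.
have : odd a.+2 = odd x.
  have r y : a.+1 < y < x -> a.+1 < y < q by move: rx; clear; lia.
  apply: (@closed_even m) => [|y ry|y z ry /andP[l1 l2]]; first by case/andP: rx.
    have ly : y < N.*2 by move: ry lx; clear; lia.
    split; first exact: (okd_neq ok).
    split; first exact: inv.
    have := inI (r _ ry); have := hI (r _ ry) => hy /andP[-> l1] /=.
    rewrite ltnNge leq_eqVlt; apply/negP => /orP[/eqP f|f].
      by move: op; rewrite {2}f inv //; move: ry; clear; lia.
    by have [||_ _] := @nst y x ly; move: ry f hy e; clear; lia.
  have ly : y < N.*2 by move: ry lx; clear; lia.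
  by have [-> -> _] := nst ly l1 l2.
by move: o1; rewrite /=; case: (odd a); case: (odd x).
Qed.

(** The arc from [p] to [q] is cut and its ends are tied to [a] and [a.+1]. Rewiring at [a] reunites
    them with the minimum of [h q] and [a.+2], which is [h q]; the label [a.+2] is what makes this
    rewiring a reduced one. *)
Definition cutm x :=
  if x == a then m q else if x == m q then a
  else if x == a.+1 then q else if x == q then a.+1 else m x.
Definition cutl x :=
  if (x == a.+1) || (x == q) then a.+2 else if x == a then h q else h x.

Variant cut_spec (x : nat) : nat -> nat -> Type :=
| CutA of x = a : cut_spec x p (h q)
| CutB of x = a.+1 : cut_spec x q a.+2
| CutP of x = p : cut_spec x a (h q)
| CutQ of x = q : cut_spec x a.+1 a.+2
| CutO of x <> a & x <> a.+1 & x <> p & x <> q : cut_spec x (m x) (h x).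

Lemma cutP x : cut_spec x (cutm x) (cutl x).
Proof.
have np : p <> q by apply: (okd_neq ok).
rewrite /cutm /cutl -/p; case: (eqVneq x a) => [e|na].
  rewrite ifN; first exact: CutA.
  by move: e aq; clear; lia.
case: (eqVneq x p) => [e|n1].
  rewrite ifN e ?hp; first exact: CutP.
  by move: aq np pP; clear; lia.
case: (eqVneq x a.+1) => [e|n2] /=; first exact: CutB.
case: (eqVneq x q) => [e|n3]; first exact: CutQ.
by apply: CutO; apply/eqP.
Qed.

Lemma cut_nest x y : x < N.*2 -> x < y < cutm x ->
  x < cutm y < cutm x /\ cutl x < cutl y.
Proof.
move=> lx; case: (cutP x) => [ex|ex|ex|ex|n1 n2 n3 n4] /andP[r1 r2].
- have qp : q < p by move: pP r1 r2 ex; clear; lia.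
  case: (cutP y) => [ey|ey|ey|ey|k1 k2 k3 k4];
    try by move: r1 r2 ex ey aq hq qp; clear; lia.
  case: (ltngtP y q) k4 => // l _.
    have ry : a.+1 < y < q by move: r1 l ex k2; clear; lia.
    by have := inI ry; have := hI ry; move: hq ex qp; clear; lia.
  have [||t1 t2 t3] := @nst q y lq; [by []|by []|].
  by rewrite -/p in t2; move: t1 t2 t3 aq ex; clear; lia.
- have ry : a.+1 < y < q by move: r1 r2 ex; clear; lia.
  case: (cutP y) => [ey|ey|ey|ey|k1 k2 k3 k4];
    try by move: ry ey aq pP; clear; lia.
  by have := inI ry; have := hI2 ry; move: ex; clear; lia.
- have pa : p < a by move: pP r1 r2 ex aq; clear; lia.
  case: (cutP y) => [ey|ey|ey|ey|k1 k2 k3 k4];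
    try by move: r1 r2 ey aq pa ex; clear; lia.
  have ly : y < N.*2 by move: r2 la; clear; lia.
  have [||t1 t2 t3] := @nst p y lp; [by rewrite -ex|by rewrite mp; move: r2 aq; clear; lia|].
  have n : ~ (a.+1 < m y < q) by apply: notI => //; move: r2; clear; lia.
  have n2 : m y <> a by move=> e; move: k2; rewrite -(inv ly) e ma.
  have n3 : m y <> a.+1 by move=> e; move: k1; rewrite -(inv ly) e ma1.
  rewrite mp in t2; rewrite hp in t3.
  by move: n n2 n3 t1 t2 t3 ex; clear; lia.
- by move: r1 r2 ex aq; clear; lia.
have xI : ~ (a.+1 < x < q) -> ~ (a.+1 < m x < q) by apply: notI.
have m1 : m x <> a by move=> e; move: n2; rewrite -(inv lx) e ma.
have m2 : m x <> a.+1 by move=> e; move: n1; rewrite -(inv lx) e ma1.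
have m3 : m x <> q by move=> e; move: n3; rewrite -(inv lx) e.
have m4 : m x <> p by move=> e; move: n4; rewrite -(inv lx) e mp.
(* An arc around [a] cannot end in the closed gap between [a.+1] and [q], so it encloses [q], hence
   also the mate [p]. *)
have key : x < a -> a < m x -> [/\ x < q, q < m x, x < p, p < m x & h x < h q].
  move=> l1 l2; have l3 : q < m x.
    by have := xI; move: l1 l2 m1 m2 m3 m4; clear; lia.
  have l4 : x < q by move: l1 aq; clear; lia.
  by have [] := nst lx l4 l3.
case: (cutP y) => [ey|ey|ey|ey|k1 k2 k3 k4].
- have [||_ _ -> -> ->] // := key; [by rewrite -ey|by rewrite -ey].
- have xa : x < a by move: r1 ey n1; clear; lia.
  have am : a < m x by move: r2 ey; clear; lia.
  have [-> -> _ _ _] := key xa am; rewrite low //.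
  by move: xa; clear; lia.
- have [||t1 t2 t3] := @nst x p lx; [by rewrite -ey|by rewrite -ey|].
  rewrite mp in t1 t2; rewrite hp in t3; split=> //.
  case: pP => pc; first by move: pc t1 t2 ey r1 r2 aq; clear; lia.
  have xa : ~ (a.+1 < x < q).
    by move=> /inI; move: r2 ey pc; clear; lia.
  by move: xa n1 n2 t1 t2 aq; clear; lia.
- have [||t1 t2 t3] := @nst x q lx; [by rewrite -ey|by rewrite -ey|].
  have xa' : ~ (a.+1 < x < q) by move=> /inI; move: r2 ey; clear; lia.
  have xa : x < a by move: r1 ey xa' n1 n2; clear; lia.
  rewrite low //; move: xa r2 ey aq; clear; lia.
by have [-> -> ->] := nst lx r1 r2.
Qed.

Lemma cut_okd : okd N cutm cutl.
Proof.
have np : p <> q by apply: (okd_neq ok).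
have mO x : x < N.*2 -> x <> a -> x <> a.+1 -> x <> p -> x <> q ->
    [/\ m x <> a, m x <> a.+1, m x <> p & m x <> q].
  move=> lx n1 n2 n3 n4; split=> e; move: (inv lx); rewrite e ?ma ?ma1 ?mp //;
  by move/esym.
have cA : cutm a = p by rewrite /cutm eqxx.
have cB : cutm a.+1 = q.
  by rewrite /cutm eqxx !ifN //; move: pP aq; rewrite -/p; clear; lia.
have cP : cutm p = a.
  by rewrite /cutm eqxx ifN //; move: pP aq; clear; lia.
have cQ : cutm q = a.+1.
  by rewrite /cutm eqxx -/p !ifN //; move: np pP aq; clear; lia.
have lA : cutl a = h q by rewrite /cutl eqxx ifN //; move: aq; clear; lia.
have lB : cutl a.+1 = a.+2 by rewrite /cutl eqxx.
have lP : cutl p = h q.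
  by rewrite /cutl hp !ifN //; move: np pP aq; clear; lia.
have lQ : cutl q = a.+2 by rewrite /cutl eqxx orbT.
split; last exact: cut_nest.
- by move=> x lx; case: (cutP x) => // *; apply: lt.
- move=> x lx; case: (cutP x) => [->|->|->|->|*]; last exact: (okd_neq ok).
  + by move: pP aq; clear; lia.
  + by move: aq; clear; lia.
  + by move: pP aq; clear; lia.
  + by move: aq; clear; lia.
- move=> x lx; case: (cutP x) => [->|->|->|->|n1 n2 n3 n4] //.
  have [k1 k2 k3 k4] := mO _ lx n1 n2 n3 n4.
  by case: (cutP (m x)) => // _ _ _ _; apply: inv.
- move=> x lx; case: (cutP x) => [ex|ex|ex|ex|n1 n2 n3 n4] //.
  have [k1 k2 k3 k4] := mO _ lx n1 n2 n3 n4.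
  by case: (cutP (m x)) => // _ _ _ _; apply: lab.
- have ba := okd_bnd ok la; have bq := okd_bnd ok lq; have bp := okd_bnd ok lp.
  rewrite hp in bp.
  move=> x lx; case: (cutP x) => [->|->|->|->|*] //; last exact: (okd_bnd ok).
  + by move: bq hq ltaN; rewrite /height; clear; lia.
  + by move: ltaN; rewrite /height; clear; lia.
  + by move: ltaN aq qN; rewrite /height; clear; lia.
- move=> x lx; case: (cutP x) => [->|->|->|->|*]; last exact: (okd_par ok).
  + move=> l; have qp : q < m q by rewrite -/p; move: l pP; clear; lia.
    by rewrite (okd_par ok lq qp) oq.
  + by [].
  + move=> l; rewrite -hp; apply: (okd_par ok) => //; rewrite mp.
    by move: l aq; clear; lia.
  + by move: aq; clear; lia.
Qed.

Lemma rwm_cut x : x < N.*2 -> rwm a cutm x = m x.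
Proof.
have np : p <> q by apply: (okd_neq ok).
have cA : cutm a = p by rewrite /cutm eqxx.
have cB : cutm a.+1 = q.
  by rewrite /cutm eqxx !ifN //; move: pP aq; rewrite -/p; clear; lia.
move=> lx; rewrite /rwm cA cB.
case: eqP => [->//|n1]; case: eqP => [->//|n2].
case: eqP => [->//|n3]; case: eqP => [->//|n4].
by case: (cutP x).
Qed.

Lemma rwl_cut x : x < N.*2 -> rwl a.+1 a cutm cutl x = h x.
Proof.
have np : p <> q by apply: (okd_neq ok).
have cA : cutm a = p by rewrite /cutm eqxx.
have cB : cutm a.+1 = q.
  by rewrite /cutm eqxx !ifN //; move: pP aq; rewrite -/p; clear; lia.
have lA : cutl a = h q by rewrite /cutl eqxx ifN //; move: aq; clear; lia.
have lB : cutl a.+1 = a.+2 by rewrite /cutl eqxx.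
have mn : minn (h q) a.+2 = h q by move: hq; clear; lia.
move=> lx; rewrite /rwl cA cB lA lB mn.
case: eqP => [->//|n1]; case: eqP => [->//|n2] /=.
case: eqP => [->//|n3]; case: eqP => [->//|n4] /=.
by case: (cutP x).
Qed.

End CutAt.

(** Positions before [a.+2] or from [N.*2 - a.+1] on have labels at most [a.+1]. If all labels in
    between exceeded [a.+1], the positions in between would form a closed block of odd length.
    Taking [q] at most [N.*2 - a.+2] leaves room there for the label [a.+2]. *)
Lemma cut_node_exists : exists q, cut_node q.
Proof.
have ex : exists x, (a.+1 < x <= N.*2 - a.+2) && (h x <= a.+1).
  have [/hasP[x]|/hasPn no] := boolP (has (fun x => h x <= a.+1) (iota a.+2 (N.*2 - a.+2 - a.+1))).
    rewrite mem_iota => rx hx; exists x; rewrite hx andbT.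
    by move: rx ltaN; clear; lia.
  have no' x : a.+2 <= x < (N.*2 - a.+1) -> a.+1 < h x.
    by move=> rx; rewrite ltnNge; apply: no; rewrite mem_iota; move: rx; clear; lia.
  have : odd a.+2 = odd (N.*2 - a.+1).
    apply: (@closed_even m); first by move: ltaN; clear; lia.
      move=> x rx; have lx : x < N.*2 by move: rx; clear; lia.
      have hx := no' _ rx; split; first exact: (okd_neq ok).
      split; first exact: inv.
      rewrite -(lab lx) in hx.
      have := @low1 (m x); have := okd_bnd ok (lt lx); rewrite /height.
      by move: hx; clear; lia.
    move=> x y rx /andP[l1 l2]; have lx : x < N.*2 by move: rx; clear; lia.
    by have [-> -> _] := nst lx l1 l2.
  by move: ltaN; clear; lia.
case: (ex_minnP ex) => q /andP[/andP[q1 q2] q3] qm; exists q; split=> // x rx.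
rewrite ltnNge; apply/negP => hx.
by have := qm x; rewrite hx; move: rx q2; clear; lia.
Qed.

Lemma cut_exists : exists m' h', [/\ okd N m' h', h' a.+1 = a.+2,
  forall x, x < N.*2 -> rwm a m' x = m x &
  forall x, x < N.*2 -> rwl a.+1 a m' h' x = h x].
Proof.
have [q cq] := cut_node_exists; exists (cutm q), (cutl q); split.
- exact: cut_okd.
- by rewrite /cutl eqxx.
- exact: rwm_cut.
- exact: rwl_cut.
Qed.

End Cut.

Lemma first_defect N m h : okd N m h ->
  (forall x, x < N -> h x = x.+1 /\ m x = N.*2 - x.+1) \/
  (exists a, [/\ a.+1 < N, m a = a.+1, h a = a.+1 & forall x, x < a -> h x = x.+1]).
Proof.
move=> ok; have lt := okd_lt ok; have inv := okd_inv ok; have lab := okd_lab ok.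
have d x : x < N -> x < N.*2 by clear; lia.
have [/hasP[x]|/hasPn no] := boolP (has (fun x => h x != x.+1) (iota 0 N)).
  rewrite mem_iota add0n /= => x0 h0; right.
  have ex : exists x, (x < N) && (h x != x.+1) by exists x; rewrite x0.
  case: (ex_minnP ex) => {x x0 h0 ex} x /andP[ltx hx] xmin.
  have lx := d _ ltx.
  have low y : y < x -> h y = y.+1.
    move=> ly; apply/eqP; apply: contraLR ly => hy; rewrite -leqNgt.
    case: (ltnP y N) => lN; first by apply: xmin; rewrite hy lN.
    by move: lN ltx; clear; lia.
  have bx := okd_bnd ok lx; rewrite /height in bx.
  have hx' : h x <= x by move: bx hx; clear; lia.
  have mx : m x < x.
    case: (ltngtP (m x) x) => // [op|e]; last by case: (okd_neq ok lx).
    have par := okd_par ok lx op.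
    (* Were [x] an opening position, [k] would be an earlier opening position with the same label.
       Its mate cannot come before [x], where labels are distinct, nor after [x], which would then
       be nested in an arc of equal label. *)
    pose k := (h x).-1.
    have kx : k < x by rewrite /k; move: bx hx'; clear; lia.
    have hk : h k = h x by rewrite low // /k; move: bx; clear; lia.
    have lk : k < N.*2 by move: kx lx; clear; lia.
    have kop : k < m k.
      rewrite (okd_par_iff ok lk) hk; rewrite (low _ kx) in hk.
      by rewrite -hk /=; case: (odd k).
    case: (ltngtP (m k) x) => [l|l|e].
    - by have := low _ l; rewrite lab // low //; move: kop; clear; lia.
    - have [|_] := @okd_nest _ _ _ ok k x lk; first by rewrite kx.
      by rewrite hk ltnn.
    - by move: op; rewrite -e inv //; move: kx; rewrite -e; clear; lia.
  have hm : h (m x) = (m x).+1 by apply: low.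
  have e1 : (m x).+1 = x.
    apply/eqP; rewrite eqn_leq mx leqNgt; apply/negP => l.
    have [|/andP[l1 l2] _] := @okd_nest _ _ _ ok (m x) (m x).+1 (lt _ lx).
      by rewrite inv // l ltnSn.
    rewrite inv // in l2.
    have := low _ l2; rewrite lab ?low //; last by move: l lx; clear; lia.
    by have := @okd_neq _ _ _ ok (m x).+1; move: l lx; clear; lia.
  exists (m x); split; rewrite ?inv ?hm ?e1 //.
  by move=> y ly; apply: low; move: ly e1; clear; lia.
left=> x ltx.
have hh y : y < N -> h y = y.+1.
  by move=> ly; apply/eqP; have := no y; rewrite mem_iota add0n ly negbK; apply.
split; first exact: hh.
have far y : y < N -> N <= m y.
  move=> ly; rewrite leqNgt; apply/negP => l; have := hh _ l.
  by rewrite lab ?hh ?d // => -[] /esym; apply: (okd_neq ok); apply: d.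
(* All arcs propagate and are nested, so their right ends climb by at least one per step outwards;
   the height of the right end gives the opposite bound. *)
have lo k : k < N -> N.*2 - (N - k) <= m (N - k.+1).
  elim: k => [|k IH] lk; first by have := far (N - 1); move: lk; clear; lia.
  have e : (N - k.+2).+1 = N - k.+1 by move: lk; clear; lia.
  have l : N - k.+2 < N.*2 by move: lk; clear; lia.
  have [|/andP[_ l2] _] := @okd_nest _ _ _ ok _ (N - k.+1) l.
    by have := far (N - k.+2); move: lk; clear; lia.
  by have := IH (ltnW lk); move: l2 lk; clear; lia.
have := lo (N - x.+1); have := okd_bnd ok (lt _ (d _ ltx)).
rewrite lab ?d // hh // /height.
have -> : N - (N - x.+1).+1 = x by move: ltx; clear; lia.
by move: ltx; clear; lia.
Qed.

(** * Arc-diagrams as labelled matchings of positions *)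

Lemma okd_ext N m h m' h' :
  (forall x, x < N.*2 -> m' x = m x) -> (forall x, x < N.*2 -> h' x = h x) ->
  okd N m h -> okd N m' h'.
Proof.
move=> em eh [lt neq inv lab bnd par nest].
split=> [x lx|x lx|x lx|x lx|x lx|x lx|x y lx].
- by rewrite em // lt.
- by rewrite em //; apply: neq.
- by rewrite !em ?lt ?inv.
- by rewrite em // !eh ?lt ?lab.
- by rewrite eh ?bnd.
- by rewrite em // eh //; apply: par.
- rewrite em // => /andP[l1 l2]; have ly : y < N.*2 by have := lt _ lx; lia.
  by rewrite em // !eh //; apply: nest => //; rewrite l1.
Qed.

Lemma odd_min_height N x y : x < y < N.*2 -> odd y = ~~ odd x ->
  odd (minn (height N x) (height N y)) = ~~ odd x.
Proof.
rewrite /height => r o; case: (leqP x.+1 (N.*2 - y)) => l.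
  have -> : minn (minn x.+1 (N.*2 - x)) (minn y.+1 (N.*2 - y)) = x.+1 by lia.
  by [].
have -> : minn (minn x.+1 (N.*2 - x)) (minn y.+1 (N.*2 - y)) = N.*2 - y by lia.
by rewrite oddB ?odd_double ?o //; lia.
Qed.

Section Encoding.
Variable n : nat.
Local Notation N := n.+1.

Definition node_at (k : nat) : node N :=
  if k < N then (inord k, false) else (inord (N.*2 - k.+1), true).

Lemma node_pos_lt (v : node N) : node_pos v < N.*2.
Proof. by case: v => [[i li] []]; rewrite /node_pos /=; lia. Qed.

Lemma node_posK : cancel (@node_pos N) node_at.
Proof.
case=> i s; have li := ltn_ord i; rewrite /node_pos /node_at /=; case: s.
  have -> : N.*2 - i.+1 < N = false by lia.
  congr pair; apply: val_inj; rewrite /= inordK; lia.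
by rewrite li inord_val.
Qed.

Lemma node_atK k : k < N.*2 -> node_pos (node_at k) = k.
Proof.
rewrite /node_pos /node_at => lk; case: ltnP => l /=; rewrite inordK; lia.
Qed.

Lemma node_pos_inj : injective (@node_pos N).
Proof. exact: can_inj node_posK. Qed.

Lemma node_pos_eq (v w : node N) : (node_pos v == node_pos w) = (v == w).
Proof. exact/inj_eq/node_pos_inj. Qed.

Lemma node_absE (v : node N) : node_abs v = height N (node_pos v).
Proof.
by case: v => i []; have li := ltn_ord i; rewrite /node_abs /node_pos /height /=; lia.
Qed.

Lemma node_barE (v : node N) : node_pos (node_bar v) = N.*2 - (node_pos v).+1.
Proof.
by case: v => i []; have li := ltn_ord i; rewrite /node_bar /node_pos /=; lia.
Qed.

Definition pm (D : diag N) (k : nat) : nat := node_pos (mate D (node_at k)).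
Definition pl (D : diag N) (k : nat) : nat := lab D (node_at k).

Lemma pm_pos D (v : node N) : pm D (node_pos v) = node_pos (mate D v).
Proof. by rewrite /pm node_posK. Qed.

Lemma pl_pos D (v : node N) : pl D (node_pos v) = lab D v.
Proof. by rewrite /pl node_posK. Qed.

Lemma pm_lt D k : pm D k < N.*2.
Proof. exact: node_pos_lt. Qed.

Lemma node_at_pm D k : node_at (pm D k) = mate D (node_at k).
Proof. exact: node_posK. Qed.

Lemma diag_eqP (D E : diag N) :
  (forall k, k < N.*2 -> pm D k = pm E k) ->
  (forall k, k < N.*2 -> pl D k = pl E k) -> D = E.
Proof.
case: D => mD lD; case: E => mE lE em el; congr pair; apply/ffunP => v.
  by have := em _ (node_pos_lt v); rewrite !pm_pos => /node_pos_inj.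
by have := el _ (node_pos_lt v); rewrite !pl_pos => /val_inj.
Qed.

(** Three conversions are hidden here: one forbidden crossing pattern must exclude both ways of
    crossing, nesting of labels is given only at opening ends, and the parity of $\min(|a|,|b|)$ is
    turned into that of the opening position. *)
Lemma okdP (D : diag N) : reflect (okd N (pm D) (pl D)) (is_okada D).
Proof.
apply: (iffP idP).
- case/and5P => /forallP mt /forallP nc /forallP bd /forallP pr /forallP ns.
  have lt x : x < N.*2 -> pm D x < N.*2 by rewrite pm_lt.
  have neq x : x < N.*2 -> pm D x <> x.
    move=> lx e; have /and3P[/eqP + _ _] := mt (node_at x); apply.
    by apply: node_pos_inj; rewrite -/(pm D x) e node_atK.
  have inv x : x < N.*2 -> pm D (pm D x) = x.
    move=> lx; have /and3P[_ /eqP e _] := mt (node_at x).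
    by rewrite {1}/pm node_at_pm e node_atK.
  have lb x : x < N.*2 -> pl D (pm D x) = pl D x.
    move=> lx; have /and3P[_ _ /eqP e] := mt (node_at x).
    by rewrite {1}/pl node_at_pm e.
  have nc' x y : x < N.*2 -> y < N.*2 -> x < y -> y < pm D x -> pm D x < pm D y -> False.
    move=> lx ly l1 l2 l3; have /forallP/(_ (node_at y)) := nc (node_at x).
    by rewrite /node_lt -/(pm D x) -/(pm D y) !node_atK // l1 l2 l3.
  have inside x y : x < N.*2 -> x < y -> y < pm D x -> x < pm D y /\ pm D y < pm D x.
    move=> lx l1 l2; have ly : y < N.*2 by have := lt _ lx; lia.
    have n1 : pm D y <> x by move=> e; move: l2; rewrite -e inv // ltnn.
    have n2 : pm D y <> pm D x by move=> e; move: l1; rewrite -(inv y) // e inv // ltnn.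
    have n3 := nc' _ _ lx ly l1 l2.
    (* The other crossing is the forbidden pattern read from the arc that opens at [pm D y]. *)
    have n4 : ~ pm D y < x.
      move=> l; apply: (nc' (pm D y) x); rewrite ?inv ?lt //.
    by move: n1 n2 n3 n4; clear; lia.
  have par1 x : x < N.*2 -> x < pm D x -> odd (pm D x) = ~~ odd x.
    move=> lx l; suff : odd x.+1 = odd (pm D x) by move <-.
    apply: (@closed_even (pm D)) => // [y ry|y z ry /andP[l1 l2]].
      have ly : y < N.*2 by have := lt _ lx; lia.
      case/andP: ry => r1 r2; have [i1 i2] := inside _ _ lx r1 r2.
      by split; [exact: neq|split; [exact: inv|rewrite i1 i2]].
    have ly : y < N.*2 by have := lt _ lx; lia.
    by have [-> ->] := inside _ _ ly l1 l2.
  split=> // [x lx|x lx lo|x y lx /andP[l1 l2]].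
  + have := bd (node_at x); rewrite -/(pl D x) !node_absE node_atK //.
    by rewrite leq_min => /and3P[-> ->].
  + have /eqP := pr (node_at x); rewrite -/(pl D x) !node_absE node_atK // -/(pm D x).
    by move=> ->; apply: odd_min_height; rewrite ?lo ?par1 ?lt.
  + have [i1 i2] := inside _ _ lx l1 l2; rewrite i1 i2; split=> //.
    have ly : y < N.*2 by have := lt _ lx; lia.
    wlog op : y l1 l2 i1 i2 ly / y < pm D y.
      move=> H; case: (ltngtP y (pm D y)) => [|l|e]; first exact: H.
        by rewrite -(lb y) //; apply: H; rewrite ?inv ?lt.
      by case: (neq _ ly).
    have /forallP/(_ (node_at x)) := ns (node_at y).
    rewrite /node_lt -/(pm D x) -/(pm D y) -/(pl D x) -/(pl D y) !node_atK //.
    by rewrite l1 op i2.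
move=> ok.
have eqm (v : node N) : node_pos (mate D v) = pm D (node_pos v) by rewrite pm_pos.
have eql (v : node N) : lab D v = pl D (node_pos v) :> nat by rewrite pl_pos.
apply/and5P; split; apply/forallP => v; have lv := node_pos_lt v.
- apply/and3P; split.
  + by rewrite -node_pos_eq eqm; apply/eqP/(okd_neq ok).
  + by rewrite -node_pos_eq !eqm; apply/eqP/(okd_inv ok).
  + by apply/eqP/val_inj; rewrite /= !eql eqm; apply: (okd_lab ok).
- apply/forallP => w; apply/negP; rewrite /node_lt !eqm => /and3P[l1 l2 l3].
  have [|/andP[_]] := @okd_nest _ _ _ ok _ (node_pos w) lv; first by rewrite l1.
  by rewrite ltnNge (ltnW l3).
- rewrite leq_min !node_absE eql eqm.
  have := okd_bnd ok lv; have := okd_bnd ok (okd_lt ok lv).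
  by rewrite (okd_lab ok) // => /andP[_ ->] /andP[-> ->].
- rewrite !node_absE eql eqm.
  have lm := okd_lt ok lv; have o := okd_posparity ok lv.
  case: (ltngtP (node_pos v) (pm D (node_pos v))) => [l|l|e].
  + by rewrite (okd_par ok) // odd_min_height ?l.
  + have := okd_par ok lm; rewrite (okd_inv ok) // (okd_lab ok) // => /(_ l) ->.
    by rewrite minnC odd_min_height ?l //= o negbK.
  + by case: (okd_neq ok lv).
- apply/forallP => w; apply/implyP; rewrite /node_lt !eqm !eql => /and3P[l1 l2 l3].
  have lw := node_pos_lt w.
  have [|_ ->//] := @okd_nest _ _ _ ok _ (node_pos v) lw.
  by rewrite l1 (ltn_trans l2 l3).
Qed.

Definition mkd (m h : nat -> nat) : diag N :=
  ([ffun v => node_at (m (node_pos v))], [ffun v => inord (h (node_pos v))]).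

Lemma pm_mkd m h k : okd N m h -> k < N.*2 -> pm (mkd m h) k = m k.
Proof.
move=> ok lk.
by rewrite /pm ffunE !node_atK //; apply: (okd_lt ok).
Qed.

Lemma pl_mkd m h k : okd N m h -> k < N.*2 -> pl (mkd m h) k = h k.
Proof.
move=> ok lk; rewrite /pl ffunE node_atK // inordK //.
by have := okd_bnd ok lk; rewrite /height; lia.
Qed.

Lemma mkd_okada m h : okd N m h -> is_okada (mkd m h).
Proof.
move=> ok; apply/okdP; apply: okd_ext (ok) => x lx; first exact: pm_mkd.
exact: pl_mkd.
Qed.

Lemma pm_did k : k < N.*2 -> pm (did N) k = N.*2 - k.+1.
Proof. by move=> lk; rewrite /pm ffunE node_barE node_atK. Qed.

Lemma pl_did k : k < N.*2 -> pl (did N) k = height N k.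
Proof.
move=> lk; rewrite /pl ffunE node_absE node_atK // inordK //.
by rewrite /height; lia.
Qed.

Lemma did_okada : is_okada (did N).
Proof.
apply/okdP; apply: okd_ext pm_did pl_did _.
by split=> [x|x|x|x|x|x|x y]; rewrite /height; lia.
Qed.

Lemma pm_mirror D k : k < N.*2 -> pm (mirror D) k = N.*2 - (pm D (N.*2 - k.+1)).+1.
Proof.
move=> lk; rewrite /pm ffunE node_barE; congr (_ - (node_pos (mate D _)).+1).
by apply: node_pos_inj; rewrite node_barE !node_atK //; lia.
Qed.

Lemma pl_mirror D k : k < N.*2 -> pl (mirror D) k = pl D (N.*2 - k.+1).
Proof.
move=> lk; rewrite /pl ffunE; congr (nat_of_ord (lab D _)).
by apply: node_pos_inj; rewrite node_barE !node_atK //; lia.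
Qed.

Lemma mirrorK : involutive (@mirror N).
Proof.
move=> D; apply: diag_eqP => k lk.
  rewrite !pm_mirror ?pm_lt; try lia.
  have -> : N.*2 - (N.*2 - k.+1).+1 = k by lia.
  by have := pm_lt D k; lia.
rewrite !pl_mirror; try lia.
by congr (pl D _); lia.
Qed.

Lemma mirror_okada (D : diag N) : is_okada D -> is_okada (mirror D).
Proof.
move/okdP => ok; apply/okdP; apply: okd_ext (@pm_mirror D) (@pl_mirror D) _.
have r x : x < N.*2 -> N.*2 - x.+1 < N.*2 by lia.
split=> [x lx|x lx e|x lx|x lx|x lx|x lx l|x y lx rxy].
- by lia.
- apply: (okd_neq ok (r _ lx)).
  by have := pm_lt D (N.*2 - x.+1); lia.
- have lm := pm_lt D (N.*2 - x.+1).
  have -> : N.*2 - (N.*2 - (pm D (N.*2 - x.+1)).+1).+1 = pm D (N.*2 - x.+1) by lia.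
  by rewrite (okd_inv ok) ?r //; lia.
- have lm := pm_lt D (N.*2 - x.+1).
  have -> : N.*2 - (N.*2 - (pm D (N.*2 - x.+1)).+1).+1 = pm D (N.*2 - x.+1) by lia.
  by rewrite (okd_lab ok) ?r.
- by have := okd_bnd ok (r _ lx); rewrite /height; lia.
- have lm := pm_lt D (N.*2 - x.+1).
  have o := okd_posparity ok (r _ lx).
  have := okd_par_iff ok (r _ lx).
  have -> : N.*2 - x.+1 < pm D (N.*2 - x.+1) = false by lia.
  by rewrite oddB ?odd_double //=; do 2!case: (odd _).
- have lm := pm_lt D (N.*2 - x.+1); have lx' := r _ lx.
  have lm' := pm_lt D (N.*2 - y.+1).
  have i := okd_inv ok lx'.
  have [|i1 i2] := @okd_nest _ _ _ ok (pm D (N.*2 - x.+1)) (N.*2 - y.+1) lm.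
    by rewrite i; lia.
  by move: i1 i2; rewrite i (okd_lab ok) //; lia.
Qed.

End Encoding.

(** * Left multiplication by a generator *)

Lemma connect_invariant (T : finType) (e : rel T) (P : pred T) x y :
  (forall u v, P u -> e u v -> P v) -> P x -> connect e x y -> P y.
Proof.
move=> st Px /connectP[s es ->]; elim: s x Px es => //= z s IH x Px /andP[xz].
by apply: IH; apply: st xz.
Qed.

Section GenMul.
Variables (n : nat).
Local Notation N := n.+1.
Variables (D : diag N) (a : nat).
Hypotheses (okD : is_okada D) (ltaN : a.+1 < N).

Definition rwd : diag N :=
  mkd n (rwm a (pm D)) (rwl a.+1 a (pm D) (pl D)).

Let ok : okd N (pm D) (pl D). Proof. exact/okdP. Qed.
Let ok' := rw_okd ok ltaN.

Lemma rwd_okada : is_okada rwd.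
Proof. exact: mkd_okada. Qed.

Lemma pm_rwd k : k < N.*2 -> pm rwd k = rwm a (pm D) k.
Proof. exact: pm_mkd. Qed.

Lemma pl_rwd k : k < N.*2 -> pl rwd k = rwl a.+1 a (pm D) (pl D) k.
Proof. exact: pl_mkd. Qed.

Let u0 : node N := (inord a, false).
Let u1 : node N := (inord a.+1, false).
Let md := mate D.
Let G := dgen N a.+1.
Let p0 : node_pos u0 = a. Proof. by rewrite /node_pos /= inordK //; lia. Qed.
Let p1 : node_pos u1 = a.+1. Proof. by rewrite /node_pos /= inordK. Qed.

Let rw_mate (v : node N) : mate rwd v =
  if v == u0 then u1 else if v == u1 then u0
  else if v == md u0 then md u1 else if v == md u1 then md u0 else md v.
Proof.
apply: node_pos_inj; rewrite -pm_pos pm_rwd ?node_pos_lt // /rwm.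
rewrite -!node_pos_eq !p0 !p1 -!pm_pos p0 p1.
by do ![case: ifP => _]; rewrite ?p0 ?p1 // -pm_pos ?p0 ?p1.
Qed.

Let rw_lab (v : node N) : lab rwd v =
  (if (v == u0) || (v == u1) then a.+1
   else if (v == md u0) || (v == md u1) then minn (lab D u0) (lab D u1)
   else lab D v) :> nat.
Proof.
rewrite -pl_pos pl_rwd ?node_pos_lt // /rwl.
rewrite -!node_pos_eq !p0 !p1 -!pm_pos p0 p1 -!pl_pos p0 p1 //.
Qed.

Let mdK v : md (md v) = v.
Proof. by apply: node_pos_inj; rewrite -!pm_pos (okd_inv ok) ?node_pos_lt. Qed.

Let md_neq v : md v != v.
Proof.
by rewrite -node_pos_eq -pm_pos; apply/eqP/(okd_neq ok)/node_pos_lt.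
Qed.

Let labmd v : lab D (md v) = lab D v.
Proof.
by apply: val_inj; rewrite /= -!pl_pos -pm_pos (okd_lab ok) ?node_pos_lt.
Qed.

Let mateG (v : node N) : mate G v =
  if v.1 == inord a then (inord a.+1, v.2)
  else if v.1 == inord a.+1 then (inord a, v.2) else node_bar v.
Proof.
case: v => i s; rewrite ffunE /= /node_abs /= !eqSS.
rewrite -!(inj_eq val_inj) /= !inordK; try lia.
by do ![case: ifP => _] => //; congr pair; apply: val_inj;
  rewrite /= val_insubd ?ltaN ?(ltnW ltaN) inordK //; lia.
Qed.

Let labG (v : node N) : lab G v = (if v.1 == inord a.+1 then a.+1 else v.1.+1) :> nat.
Proof.
case: v => i s; have li := ltn_ord i; rewrite ffunE /= /node_abs /= eqSS.
rewrite -!(inj_eq val_inj) /= !inordK; try lia.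
by case: ifP => _; rewrite inordK; lia.
Qed.

Let lk := glue_link G D.

Let linkE (p q : bool * node N) : lk p q = (q == (p.1, mate (if p.1 then D else G) p.2)) ||
    [&& p.1 != q.1, p.2 == node_bar q.2 & p.2.2 == ~~ p.1].
Proof. by []. Qed.

Let barK : involutive (@node_bar N).
Proof. by case=> i s; rewrite /node_bar /= negbK. Qed.

Let mateGK v : mate G (mate G v) = v.
Proof.
rewrite (mateG v); case: v => i s /=.
have d : (inord a.+1 == inord a :> 'I_N) = false.
  by rewrite -(inj_eq val_inj) /= !inordK; lia.
case: eqP => [->|n1]; first by rewrite mateG /= d eqxx.
case: eqP => [->|n2]; first by rewrite mateG /= eqxx.
by rewrite mateG /node_bar /= !ifN ?negbK //; apply/eqP.
Qed.

Let lk_sym : connect_sym lk.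
Proof.
apply: sym_connect_sym => -[s v] [t w]; rewrite !linkE /=; congr orb.
  rewrite !xpair_eqE eq_sym; case: eqP => //= -> {s}.
  by apply/eqP/eqP => ->; case: t; rewrite ?mdK ?mateGK.
rewrite (eq_sym t); case: eqP => //= ne.
have -> : (w == node_bar v) = (v == node_bar w) by apply/eqP/eqP => ->; rewrite barK.
case: eqP => //= ->; case: w => i r; rewrite /node_bar /=.
by case: s t r ne => [] [] [].
Qed.

(* The node of the product that lies on the same arc as the point p; the points
   of a closed loop have none. *)
Let rho (p : bool * node N) : option (node N) :=
  let f v := if (v == u0) || (v == u1) then
               if md u0 == u1 then None else Some (md v) else Some v in
  if p.1 then f p.2
  else if p.2.2 then f (p.2.1, false)
  else Some p.2.

Let same (x y : option (node N)) : bool :=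
  match x, y with
  | Some v, Some w => (w == v) || (w == mate rwd v)
  | None, None => true
  | _, _ => false
  end.

Let rwK v : mate rwd (mate rwd v) = v.
Proof.
apply: node_pos_inj; rewrite -!pm_pos.
by have := okd_inv (okdP _ rwd_okada) (node_pos_lt v).
Qed.

Let rw_neq v : mate rwd v != v.
Proof.
rewrite -node_pos_eq -pm_pos.
by apply/eqP/(okd_neq (okdP _ rwd_okada))/node_pos_lt.
Qed.

Let same_sym x y : same x y -> same y x.
Proof.
case: x y => [v|] [w|] //= /orP[] /eqP ->; first by rewrite eqxx.
by rewrite rwK eqxx orbT.
Qed.

Let same_trans x y z : same x y -> same y z -> same x z.
Proof.
case: x y z => [v|] [w|] [x|] //= /orP[] /eqP -> // /orP[] /eqP ->.
  by rewrite eqxx orbT.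
by rewrite rwK eqxx.
Qed.

Let rwp : md u0 != u1 -> mate rwd (md u0) = md u1.
Proof. by move=> e; rewrite rw_mate (negbTE (md_neq u0)) (negbTE e) eqxx. Qed.

Let rho_link p q : lk p q -> same (rho p) (rho q).
Proof.
have refl x : same x x by case: x => [v|] //=; rewrite eqxx.
have loop v : md u0 == u1 -> (v == u0) || (v == u1) -> (md v == u0) || (md v == u1).
  by move=> /eqP e /orP[] /eqP ->; rewrite -?e ?mdK ?eqxx ?orbT.
have nloop v : md u0 == u1 = false -> (v == u0) || (v == u1) ->
    (md v == u0) || (md v == u1) = false.
  move=> e; have e' : md u1 == u0 = false.
    by apply/negP => /eqP f; move: e; rewrite -f mdK eqxx.
  by move=> /orP[] /eqP ->; rewrite ?e ?e' (negbTE (md_neq _)).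
rewrite linkE => /orP[/eqP ->|].
- case: p => -[] v /=; rewrite /rho /=.
  + case: ifP => cv.
      case: ifP => e; first by rewrite loop.
      by rewrite nloop // refl.
    case: ifP => cm.
      have : (md (md v) == u0) || (md (md v) == u1) = false by rewrite mdK.
      case: ifP => e f; first by have := loop _ e cm; rewrite f.
      by rewrite mdK refl.
    rewrite /= rw_mate; move/norP: (negbT cv) => [/negbTE -> /negbTE ->].
    rewrite !ifN ?eqxx ?orbT //; apply/negP => /eqP f.
      by move: cm; rewrite f mdK eqxx orbT.
    by move: cm; rewrite f mdK eqxx.
  + case: v => i s; rewrite mateG /=.
    have ff j : ((j, false) == u0 :> node N) || ((j, false) == u1) = (j == inord a) || (j == inord a.+1).
      by rewrite !xpair_eqE !andbT.
    have swap t : same (rho (false, (inord a, t))) (rho (false, (inord a.+1, t))).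
      case: t; rewrite /rho /= ?ff ?eqxx ?orbT; last by rewrite rw_mate !eqxx orbT.
      by case: ifP => e //; rewrite /= rwp ?e ?eqxx ?orbT.
    case: (eqVneq i (inord a)) => [->|/negbTE n1]; first exact: (swap s).
    case: (eqVneq i (inord a.+1)) => [->|/negbTE n2]; first exact: (same_sym (swap s)).
    by rewrite /node_bar /=; case: s; rewrite /= ?ff n1 n2 /= eqxx.
case: p q => [s v] [t w] /=; rewrite /rho /=.
case: s t => [] [] //= /andP[/eqP -> /eqP]; case: w => i r /=; rewrite /node_bar /=.
  by move=> h; rewrite -[r]negbK h refl.
by move=> h; rewrite h -[r]negbK h refl.
Qed.

Let rho_outer v : rho (outer v) = Some v.
Proof.
case: v => i []; rewrite /rho /outer //=.
by have -> : ((i, true) == u0 :> node N) || ((i, true) == u1) = false by rewrite !xpair_eqE !andbF.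
Qed.

Let connect_outer v p : connect lk (outer v) p -> same (Some v) (rho p).
Proof.
apply: (connect_invariant (P := fun p => same (Some v) (rho p))) => [u w s e|]; first exact: same_trans s (rho_link e).
by rewrite rho_outer /= eqxx.
Qed.

Let cglue i : connect lk (false, (i, true)) (true, (i, false)).
Proof. by apply: connect1; rewrite linkE /node_bar /= eqxx ?orbT. Qed.

Let cgen v : connect lk (false, v) (false, mate G v).
Proof. by apply: connect1; rewrite linkE eqxx. Qed.

Let cdiag v : connect lk (true, v) (true, md v).
Proof. by apply: connect1; rewrite linkE eqxx. Qed.

Let cin v : v != u0 -> v != u1 -> connect lk (outer v) (true, v).
Proof.
case: v => i [] n0 n1; first exact: connect0.
move: n0 n1; rewrite !xpair_eqE !andbT => n0 n1.
apply: connect_trans (cglue i); have := cgen (i, false).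
by rewrite mateG /= (negbTE n0) (negbTE n1).
Qed.

Let cu : connect lk (true, u0) (true, u1).
Proof.
apply: connect_trans (cglue _); have := cgen (inord a, true).
rewrite mateG /= eqxx => c; apply: connect_trans c.
by rewrite lk_sym; apply: cglue.
Qed.

Let cmate v : connect lk (outer v) (outer (mate rwd v)).
Proof.
rewrite rw_mate; case: eqP => [->|/eqP n0].
  by have := cgen u0; rewrite mateG /= eqxx.
case: eqP => [->|/eqP n1].
  by rewrite lk_sym; have := cgen u0; rewrite mateG /= eqxx.
have nm u : md v != u -> v != md u by apply: contraNneq => ->; rewrite mdK.
have mn u : v != md u -> md v != u by apply: contraNneq => <-; rewrite mdK.
apply: (connect_trans (cin n0 n1)).
case: eqP => [e|/eqP n2].
  have ne : md u0 != u1 by rewrite -e.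
  have ne' : md u1 != u0 by apply: contraNneq ne => <-; rewrite mdK.
  rewrite e; apply: (connect_trans (cdiag _)); rewrite mdK.
  apply: (connect_trans cu); apply: (connect_trans (cdiag _)).
  by rewrite lk_sym; apply: cin; rewrite // md_neq.
case: eqP => [e|/eqP n3].
  have ne : md u1 != u0 by rewrite -e.
  have ne' : md u0 != u1 by apply: contraNneq ne => <-; rewrite mdK.
  rewrite e; apply: (connect_trans (cdiag _)); rewrite mdK.
  rewrite lk_sym; apply: connect_trans cu; rewrite lk_sym.
  by apply: (connect_trans (cdiag _)); rewrite lk_sym; apply: cin; rewrite // md_neq.
apply: (connect_trans (cdiag _)); rewrite lk_sym.
by apply: cin; apply: mn.
Qed.

Let lab_le (v : node N) : lab D v <= v.1.+1.
Proof.
have := okd_bnd ok (node_pos_lt v); rewrite pl_pos -node_absE /node_abs.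
by case/andP.
Qed.

(** Apart from the arc at [u0] and [u1], the labels of [G] never lower a minimum: the arc at $j$
    carries $j$, the largest label that [D] allows there, and the arc at the overlined nodes carries
    [a.+1], which is at least [lab D u0]. *)
Let rho_lab p w : rho p = Some w ->
  lab rwd w <= lab (if p.1 then D else G) p.2.
Proof.
have i0 : (inord a : 'I_N) = a :> nat by rewrite inordK //; lia.
have i1 : (inord a.+1 : 'I_N) = a.+1 :> nat by rewrite inordK.
have cup v : v = u0 \/ v = u1 -> md u0 == u1 = false ->
    lab rwd (md v) = minn (lab D u0) (lab D u1) :> nat.
  move=> cv e; have e' : md u1 == u0 = false.
    by apply/negP => /eqP f; move: e; rewrite -f mdK eqxx.
  by rewrite rw_lab; case: cv => ->; rewrite (negbTE (md_neq _)) ?e ?e' ?eqxx ?orbT.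
have other v : (v == u0) || (v == u1) = false -> lab rwd v <= lab D v.
  rewrite rw_lab => ->; case: ifP => [/orP[] /eqP ->|] //; rewrite labmd.
    exact: geq_minl.
  exact: geq_minr.
have ff j : ((j, false) == u0 :> node N) || ((j, false) == u1) = (j == inord a) || (j == inord a.+1).
  by rewrite !xpair_eqE !andbT.
case: p => -[] v; rewrite /rho /=.
  case: ifP => [cv|cv [<-]]; last exact: other.
  case: ifP => // e [<-]; rewrite cup ?e //.
    by case/orP: cv => /eqP ->; rewrite ?geq_minl ?geq_minr.
  by case/orP: cv => /eqP ->; [left|right].
case: v => i [] /=; rewrite labG /=.
  rewrite ff; case: ifP => [cv|cv [<-]].
    case: ifP => // e [<-]; rewrite cup ?e //.
      have : lab D u0 <= a.+1 by have := lab_le u0; rewrite /= i0.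
      by case: eqP => [_|_]; [|case/orP: cv => /eqP ->; rewrite ?i0 ?i1]; lia.
    by case/orP: cv => /eqP ->; [left|right].
  case/norP: (negbT cv) => _ /negbTE ->.
  by apply: (leq_trans (other _ _)); rewrite ?ff //; apply: lab_le.
move=> [<-]; rewrite rw_lab ff; case: ifP => [/orP[]/eqP ->|/norP[_ /negbTE ->]].
- by case: ifP => _; rewrite ?i0.
- by rewrite eqxx.
have := lab_le (i, false); case: ifP => [/orP[] /eqP e|] //=; rewrite e labmd.
  by apply: leq_trans; exact: geq_minl.
by apply: leq_trans; exact: geq_minr.
Qed.

(** The invariant [rho] shows that linked points lie on one arc of [rwd], and [cmate] gives a path
    along each arc. For labels, [rho_lab] bounds the minimum from below, and a point attaining it is
    exhibited; closed loops are not linked to outer points. *)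
Lemma dmul_dgen : dmul G D = rwd.
Proof.
rewrite [RHS]surjective_pairing; congr pair; apply/ffunP => v; rewrite ffunE.
  case: pickP => [w /= /andP[nw /connect_outer]|/(_ (mate rwd v))] /=.
    by rewrite rho_outer /= (negbTE nw) => /eqP ->.
  by rewrite rw_neq -/lk cmate.
apply: val_inj; apply/eqP; rewrite eqn_leq /=; apply/andP; split.
  have get p : connect lk (outer v) p -> lab (if p.1 then D else G) p.2 <= lab rwd v ->
      \big[Order.min/ord_max]_(p | connect (glue_link (dgen N a.+1) D) (outer v) p)
         lab (if p.1 then D else G) p.2 <= lab rwd v.
    move=> c; apply: leq_trans.
    exact: (@Order.TotalTheory.bigmin_le_cond _ _ _ ord_max p _ (fun p => lab (if p.1 then D else G) p.2) c).
  have labGu : lab G u0 = a.+1 :> nat.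
    rewrite labG /=; case: eqP => // _; rewrite inordK //; lia.
  have labGu1 : lab G u1 = a.+1 :> nat by rewrite labG /= eqxx.
  case e0: (v == u0).
    by apply: (get (outer v)); rewrite ?connect0 // (eqP e0) labGu rw_lab eqxx.
  case e1: (v == u1).
    by apply: (get (outer v)); rewrite ?connect0 // (eqP e1) labGu1 rw_lab eqxx orbT.
  have cv := cin (negbT e0) (negbT e1).
  rewrite rw_lab e0 e1 /= in get *.
  case em: ((v == md u0) || (v == md u1)); last by rewrite em in get; apply: (get (true, v)).
  have [c0 c1] : connect lk (outer v) (true, u0) /\ connect lk (outer v) (true, u1).
    case/orP: em => /eqP e.
      have c0 : connect lk (outer v) (true, u0).
        by apply: (connect_trans cv); rewrite e -{2}(mdK u0); apply: cdiag.
      by split=> //; apply: connect_trans c0 cu.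
    have c0 : connect lk (outer v) (true, u1).
      by apply: (connect_trans cv); rewrite e -{2}(mdK u1); apply: cdiag.
    by split=> //; apply: (connect_trans c0); rewrite lk_sym cu.
  rewrite em in get; rewrite /minn in get *.
  by case: ifP get => l get; [apply: (get (true, u0))|apply: (get (true, u1))].
suff H : ((lab rwd v : 'I_N.+1) <= \big[Order.min/ord_max]_(p | connect lk (outer v) p)
    lab (if p.1 then D else G) p.2)%O by [].
apply/Order.TotalTheory.bigmin_geP; split; first exact: leq_ord.
move=> p /connect_outer; case e: (rho p) => [w|] //= /orP[] /eqP ew.
  by have := rho_lab e; rewrite ew.
have -> : lab rwd v = lab rwd w; last exact: rho_lab e.
have {}ew : w = mate rwd v := ew.
rewrite ew; apply: ord_inj; rewrite -!pl_pos -pm_pos.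
by rewrite (okd_lab (okdP _ rwd_okada)) ?node_pos_lt.
Qed.

End GenMul.

(** * Words in the generators *)

Section Words.
Variable n : nat.
Local Notation N := n.+1.
Implicit Types (D : diag N) (w : seq nat).

(* The generator E_k acts at the positions k - 1 and k. *)
Definition wd w D : diag N := foldr (fun k D => rwd D k.-1) D w.

Definition gens w : bool := all (fun k => 0 < k < N) w.

Lemma wd_cat w1 w2 D : wd (w1 ++ w2) D = wd w1 (wd w2 D).
Proof. by rewrite /wd foldr_cat. Qed.

Lemma wd_okada w D : gens w -> is_okada D -> is_okada (wd w D).
Proof.
move=> gw okD; elim: w gw => //= k w IH /andP[rk /IH okw].
by apply: rwd_okada => //; lia.
Qed.

Lemma wdE w D : gens w -> is_okada D ->
  foldr (@dmul N) D [seq dgen N k | k <- w] = wd w D.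
Proof.
move=> + okD; elim: w => //= k w IH /andP[rk gw].
have e : k.-1.+1 = k by lia.
by rewrite IH // -{1}e dmul_dgen ?wd_okada // e; case/andP: rk.
Qed.

(** This is right multiplication by the generator. On positions it is again a rewiring, at the
    mirror pair in the right half. *)
Definition rwr D a : diag N := mirror (rwd (mirror D) a).

Lemma rwr_okada D a : is_okada D -> a.+1 < N -> is_okada (rwr D a).
Proof. by move=> ok la; apply/mirror_okada/rwd_okada/la/mirror_okada. Qed.

Let mirror_pos D a k (okD : is_okada D) (la : a.+1 < N) (lk : k < N.*2) :
  [/\ pm (rwr D a) k = rwm (N.*2 - a.+2) (pm D) k &
      pl (rwr D a) k = rwl a.+1 (N.*2 - a.+2) (pm D) (pl D) k].
Proof.
have okM := mirror_okada okD.
have lk' : N.*2 - k.+1 < N.*2 by move: lk; clear; lia.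
pose c := N.*2 - a.+2.
have ea : N.*2 - a.+1 = c.+1 by rewrite /c; move: la; clear; lia.
have l0 : a < N.*2 by move: la; clear; lia.
have l1 : a.+1 < N.*2 by move: la; clear; lia.
have kk : N.*2 - (N.*2 - k.+1).+1 = k by move: lk; clear; lia.
have p0 := pm_lt D c; have p1 := pm_lt D c.+1; have p2 := pm_lt D k.
have e1 : (N.*2 - k.+1 == a) = (k == c.+1) by rewrite /c; move: lk la; clear; lia.
have e2 : (N.*2 - k.+1 == a.+1) = (k == c) by rewrite /c; move: lk la; clear; lia.
have e3 y : y < N.*2 -> (N.*2 - k.+1 == N.*2 - y.+1) = (k == y) by move: lk; clear; lia.
have e4 y : y < N.*2 -> N.*2 - (N.*2 - y.+1).+1 = y by clear; lia.
rewrite -/c /rwr pm_mirror // pl_mirror // pm_rwd // pl_rwd //.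
rewrite /rwm /rwl !pm_mirror // !pl_mirror // ea -/c kk e1 e2 !e3 // minnC.
split; last by rewrite orbC [(k == pm _ _) || _]orbC.
have e5 : N.*2 - a.+2 = c by [].
have e6 : (k == c.+1) && (k == c) = false by clear; lia.
case: (k == c.+1) e6 => /= [->|_] //.
case: (k == c); first by rewrite ea.
case: ifP => [/eqP ->|n1]; case: ifP => [/eqP e|n2]; rewrite ?e4 //.
Qed.

(** One rewiring acts at positions below [N], the other at positions from [N] on, so [rwm_comm] and
    [rwl_comm] apply with the bound [N.*2]. *)
Lemma rwd_rwr D a b : is_okada D -> a.+1 < N -> b.+1 < N ->
  rwd (rwr D b) a = rwr (rwd D a) b.
Proof.
move=> okD la lb.
have okR := rwr_okada okD lb; have okL := rwd_okada okD la.
pose c := N.*2 - b.+2.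
have rc : a.+1 < c by rewrite /c; move: la lb; clear; lia.
have lc : c.+1 < N.*2 by rewrite /c; move: lb; clear; lia.
have /okdP ok := okD.
have la1 : a.+1 < N.*2 by move: la; clear; lia.
have la0 : a < N.*2 by move: la; clear; lia.
have em x : x < N.*2 -> pm (rwr D b) x = rwm c (pm D) x.
  by move=> lx; have [] := mirror_pos okD lb lx.
have el x : x < N.*2 -> pl (rwr D b) x = rwl b.+1 c (pm D) (pl D) x.
  by move=> lx; have [] := mirror_pos okD lb lx.
have lc0 : c < N.*2 by apply: ltnW.
apply: diag_eqP => k lk; have [e1 e2] := mirror_pos okL lb lk.
- rewrite pm_rwd // e1 -/c {1}/rwm !em //.
  rewrite -/(rwm a (rwm c (pm D)) k).
  rewrite -(@rwm_comm N.*2) //; [|exact: okd_lt ok|exact: okd_inv ok|exact: okd_neq ok].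
  by rewrite [in RHS]/rwm !pm_rwd.
- rewrite pl_rwd // e2 -/c {1}/rwl !em // !el //.
  rewrite -/(rwl a.+1 a (rwm c (pm D)) (rwl b.+1 c (pm D) (pl D)) k).
  rewrite -(@rwl_comm N.*2) //;
    [|exact: okd_lt ok|exact: okd_inv ok|exact: okd_lab ok|exact: okd_neq ok].
  by rewrite [in RHS]/rwl !pm_rwd // !pl_rwd.
Qed.

Lemma rwd_did a : a.+1 < N -> rwr (did N) a = rwd (did N) a.
Proof.
move=> la; have okI := did_okada n.
have l0 : a < N.*2 by move: la; clear; lia.
have l1 : a.+1 < N.*2 by move: la; clear; lia.
have c0 : N.*2 - a.+2 < N.*2 by move: la; clear; lia.
have c1 : (N.*2 - a.+2).+1 < N.*2 by move: la; clear; lia.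
apply: diag_eqP => k lk; have [e1 e2] := mirror_pos okI la lk.
  by rewrite e1 pm_rwd // /rwm !pm_did //; move: la lk; clear; split_ifs.
rewrite e2 pl_rwd // /rwl !pm_did // !pl_did //; clear e1 e2.
have -> : minn (height N (N.*2 - a.+2)) (height N (N.*2 - a.+2).+1) = a.+1.
  by rewrite /height; move: la; clear; lia.
have -> : minn (height N a) (height N a.+1) = a.+1.
  by rewrite /height; move: la; clear; lia.
have -> : N.*2 - (N.*2 - a.+2).+1 = a.+1 by move: la; clear; lia.
have -> : N.*2 - (N.*2 - a.+2).+2 = a by move: la; clear; lia.
have -> : N.*2 - a.+1 = (N.*2 - a.+2).+1 by move: la; clear; lia.
by do 4 case: eqP => //=.
Qed.

Lemma wd_rwr w D a : gens w -> is_okada D -> a.+1 < N ->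
  wd w (rwr D a) = rwr (wd w D) a.
Proof.
move=> + okD la; elim: w => //= k w IH /andP[rk gw].
by rewrite IH // rwd_rwr ?wd_okada //; lia.
Qed.

(** The first letter of [w] acts first in the reversed word. On the identity it may be moved to the
    right side, where it commutes with all other letters. *)
Lemma wd_rev w : gens w -> wd (rev w) (did N) = mirror (wd w (did N)).
Proof.
have md : mirror (did N) = did N.
  apply: diag_eqP => k lk; have l : N.*2 - k.+1 < N.*2 by lia.
    by rewrite pm_mirror // !pm_did //; lia.
  by rewrite pl_mirror // !pl_did // /height; lia.
elim: w => [|k w IH] /= => [_|/andP[rk gw]]; first by rewrite md.
have la : k.-1.+1 < N by lia.
have gr : gens (rev w) by rewrite /gens all_rev.
rewrite rev_cons -cats1 wd_cat /= -rwd_did // wd_rwr ?did_okada //.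
by rewrite IH // /rwr mirrorK.
Qed.

Definition dweight D : nat := weight N.*2 (pl D).

Lemma weight_ext (f g : nat -> nat) m : (forall x, x < m -> f x = g x) ->
  weight m f = weight m g.
Proof. by move=> e; apply: eq_big_nat => x /andP[_]; apply: e. Qed.

Lemma dweight_mirror D : dweight (mirror D) = dweight D.
Proof.
rewrite /dweight (weight_ext (@pl_mirror _ D)) /weight [RHS]big_nat_rev /=.
by apply: eq_big_nat => x _; rewrite add0n.
Qed.

Lemma dweight_rwd D a : is_okada D -> a.+1 < N ->
  dweight (rwd D a) + (maxn (pl D a) (pl D a.+1)).*2 = dweight D + a.+1.*2.
Proof.
move=> okD la; rewrite -(weight_rw (okdP _ okD) la); congr addn.
by apply: weight_ext => x lx; apply: pl_rwd.
Qed.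

Lemma dweight_max D : is_okada D -> dweight D <= dweight (did N).
Proof.
move/okdP/weight_max; rewrite /dweight [weight _ (pl (did N))](@weight_ext _ (height N)) //.
exact: pl_did.
Qed.

Lemma maxn_lab D a : is_okada D -> a.+1 < N ->
  maxn (pl D a) (pl D a.+1) <= a.+2.
Proof.
move/okdP => ok la.
have l0 : a < N.*2 by move: la; clear; lia.
have l1 : a.+1 < N.*2 by move: la; clear; lia.
by have := okd_bnd ok l0; have := okd_bnd ok l1; rewrite /height; clear; lia.
Qed.

(** The drop at a letter is twice the larger label minus [a.+1], hence at most two. A reduced word
    is thus one that drops by exactly two at every letter. *)
Lemma dweight_word w D : gens w -> is_okada D ->
  dweight D <= dweight (wd w D) + (size w).*2.
Proof.
move=> gw okD; elim: w gw => [|k w IH] /= => [_|/andP[rk gw]]; first by lia.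
have la : k.-1.+1 < N by lia.
have := dweight_rwd (wd_okada gw okD) la; have := maxn_lab (wd_okada gw okD) la.
by have := IH gw; lia.
Qed.

(** Induction on the missing weight: at the first defect, [cut_exists] writes the diagram as a
    generator applied to a diagram whose weight is larger by two. *)
Lemma okada_word D : is_okada D ->
  exists w, [/\ gens w, wd w (did N) = D &
    dweight D + (size w).*2 = dweight (did N)].
Proof.
move: {2}(dweight (did N) - dweight D) (leqnn (dweight (did N) - dweight D)) => k.
elim/ltn_ind: k D => k IH D lek okD; have /okdP ok := okD.
have d x : x < N -> x < N.*2 by clear; lia.
case: (first_defect ok) => [id|[a [la ma ha low]]].
  have e : D = did N.
    apply: diag_eqP => x lx.
      rewrite pm_did //; case: (ltnP x N) => l; first by have [] := id x l.
      have l' : N.*2 - x.+1 < N by move: l; clear; lia.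
      have [_ e] := id _ l'; have := okd_inv ok (d _ l'); rewrite e.
      by have -> : N.*2 - (N.*2 - x.+1).+1 = x by move: lx; clear; lia.
    rewrite pl_did // /height; case: (ltnP x N) => l.
      by have [-> _] := id x l; move: l; clear; lia.
    have l' : N.*2 - x.+1 < N by move: l; clear; lia.
    have [e1 e2] := id _ l'; have := okd_lab ok (d _ l'); rewrite e1 e2.
    have -> : N.*2 - (N.*2 - x.+1).+1 = x by move: lx; clear; lia.
    by move=> ->; move: l lx; clear; lia.
  by exists [::]; rewrite e; split => //=; lia.
have [m' [h' [ok' r em eh]]] := cut_exists ok la ma ha low.
pose D' := mkd n m' h'.
have okD' : is_okada D' by apply: mkd_okada.
have l0 : a < N.*2 by move: la; clear; lia.
have l1 : a.+1 < N.*2 by move: la; clear; lia.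
have eD : rwd D' a = D.
  apply: diag_eqP => x lx.
    by rewrite pm_rwd // -em // /rwm !(pm_mkd ok').
  by rewrite pl_rwd // -eh // /rwl !(pm_mkd ok') // !(pl_mkd ok').
have wt : dweight D' = dweight D + 2.
  have := dweight_rwd okD' la; have := maxn_lab okD' la.
  by rewrite eD (pl_mkd ok' l1) r; clear; lia.
have mx := dweight_max okD'.
have [|w [gw ew sw]] := IH (dweight (did N) - dweight D') _ D' (leqnn _) okD'.
  by move: lek wt mx; clear; lia.
exists (a.+1 :: w); split=> /=; first by rewrite la.
  by rewrite ew.
by move: sw wt; clear; lia.
Qed.

End Words.

(** * Codes and permutations *)

Section Blocks.
Variable n : nat.
Local Notation N := n.+1.
Implicit Types (D : diag N) (c : nat -> nat).

Definition blk (i t : nat) : seq nat := [seq i - s | s <- iota 0 t].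

Definition code_word c (j : nat) : seq nat :=
  flatten [seq blk i (c i) | i <- iota 0 j].

Lemma code_word_rec c j : code_word c j.+1 = code_word c j ++ blk j (c j).
Proof.
by rewrite /code_word -addn1 iotaD map_cat flatten_cat /= cats0.
Qed.

Lemma blk_rec i t : blk i t.+1 = rcons (blk i t) (i - t).
Proof. by rewrite /blk -addn1 iotaD map_cat cats1. Qed.

Lemma gens_blk i t : t <= i -> i < N -> gens n (blk i t).
Proof.
by move=> ti iN; apply/allP => k /mapP[s]; rewrite mem_iota => rs ->; lia.
Qed.

Lemma gens_code_word c j : (forall i, c i <= i) -> j <= N -> gens n (code_word c j).
Proof.
move=> cP; elim: j => // j IH lj; rewrite code_word_rec /gens all_cat.
by apply/andP; split; [exact/IH/ltnW|exact: gens_blk].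
Qed.

(* The lines from [j] on are those of the identity diagram. *)
Definition idle (j : nat) D : Prop :=
  is_okada D /\
  (forall x, j <= x < N -> pm D x = N.*2 - x.+1 /\ pl D x = x.+1).

(* The labels of E_{j-t+1} ... E_j D, for [idle j D]. *)
Definition blk_lab (j t : nat) D (x : nat) : nat :=
  if t == 0 then pl D x
  else if x < j - t then pl D x else if x <= (j - t).+1 then (j - t).+1
  else if x <= j then pl D (x - 2)
  else if x == N.*2 - j.+1 then pl D j.-1 else pl D x.

(** Blocks are reversed because [wd] applies the last letter first: the letters then act in the
    order [j], [j - 1], and so on. Each one meets at its upper position the largest possible label,
    first on an idle line and then on the arc just created, so every step is reduced. *)
Lemma blk_step j t D : t <= j -> j < N -> idle j D ->
  let E := wd (rev (blk j t)) D in
  [/\ is_okada E, forall x, x < N.*2 -> pl E x = blk_lab j t D x,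
      forall x, j < x < N -> pm E x = N.*2 - x.+1,
      pm E (j - t) = (if t == 0 then N.*2 - j.+1 else (j - t).+1) &
      dweight E + t.*2 = dweight D].
Proof.
move=> tj jN [okD idl].
elim: t tj => [|t IH] tj /=.
  split=> //; last by lia.
    by move=> x rx; have [|] := idl x; lia.
  by rewrite subn0; have [|] := idl j; lia.
have [okE lE mE m1 wE] := IH (ltnW tj).
set E := wd (rev (blk j t)) D in okE lE mE m1 wE.
rewrite blk_rec rev_rcons /= -/E.
pose a := (j - t).-1.
have ea : j - t = a.+1 by rewrite /a; lia.
have ea' : j - t.+1 = a by rewrite /a; lia.
have la : a.+1 < N by rewrite /a; lia.
have l0 : a < N.*2 by lia.
have l1 : a.+1 < N.*2 by lia.
have /okdP ok := okE; have /okdP okd := okD.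
rewrite ea /=.
have bd x : x < N.*2 -> pl D x <= x.+1.
  by move=> lx; have := okd_bnd okd lx; rewrite /height; lia.
have h1 : pl E a.+1 = a.+2.
  rewrite lE // /blk_lab ea; case: eqP => [t0|t0].
    by have [|_ ->] := idl a.+1; lia.
  by rewrite ltnn leqW.
have h0 : pl E a = pl D a.
  by rewrite lE // /blk_lab ea ltnSn; case: ifP.
have mn : minn (pl E a) (pl E a.+1) = pl D a.
  by rewrite h0 h1; have := bd _ l0; lia.
have m1' : pm E a.+1 = if t == 0 then N.*2 - j.+1 else a.+2 by rewrite -ea m1 ea.
split.
- exact: rwd_okada.
- move=> x lx; rewrite pl_rwd // /rwl mn /blk_lab [t.+1 == 0]/= ea'.
  case: ifP => [xa|xa].
    have -> : x < a = false by move: xa; clear; lia.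
    by rewrite ifT //; move: xa; clear; lia.
  (* At the mate of [a] the minimum is the label already there, so only the mate of [a.+1] is really
     changed. *)
  have -> : (if (x == pm E a) || (x == pm E a.+1) then pl D a else pl E x) =
      if x == pm E a.+1 then pl D a else pl E x.
    case: (x == pm E a.+1); rewrite ?orbT // orbF.
    by case: eqP => // ->; rewrite (okd_lab ok).
  rewrite m1' lE // /blk_lab ea.
  case: (eqVneq t 0) => [t0|t0].
    have -> : a = j.-1 by move: ea t0; clear; lia.
    have e : (x <= j.-1.+1) = (x <= j) by congr leq; move: ea t0; clear; lia.
    rewrite e; case: eqP => [xj|xj].
      by rewrite !ifN //; move: xj xa ea t0 jN; clear; lia.
    case: (ltnP x j.-1) => // l.
    by have -> : x <= j = false by move: l xa ea t0; clear; lia.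
  case: (eqVneq x a.+2) => [->|xb].
    have -> : a.+2 < a = false by clear; lia.
    have -> : a.+2 <= a.+1 = false by clear; lia.
    have -> : a.+2 <= j by move: t0 ea tj; clear; lia.
    by rewrite subn2.
  have -> : (x < a.+1) = (x < a) by move: xa; clear; lia.
  case: ifP => // l.
  have -> : x <= a.+2 = false by move: l xa xb; clear; lia.
  by have -> : x <= a.+1 = false by move: l xa; clear; lia.
- move=> x rx; have lx : x < N.*2 by move: rx; clear; lia.
  rewrite pm_rwd // (rwm_follow l0 l1 (okd_inv ok)) //;
    try by move: rx ea; clear; lia.
  by rewrite mE // !ifN //; move: rx ea jN; clear; lia.
- by rewrite ea' pm_rwd // /rwm eqxx.
- have := dweight_rwd okE la.
  have -> : maxn (pl E a) (pl E a.+1) = a.+2 by rewrite h0 h1; have := bd _ l0; lia.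
  by move: wE; clear; lia.
Qed.

Lemma blk_idle j t D : t <= j -> j < N -> idle j D -> idle j.+1 (wd (rev (blk j t)) D).
Proof.
move=> tj jN idD; have [okE lE mE _ _] := blk_step tj jN idD.
split=> // x rx; case: (idD) => okD idl; have lx : x < N.*2 by lia.
rewrite mE // lE // /blk_lab; split=> //.
have [|_ e] := idl x; first by lia.
case: (eqVneq t 0) => // t0.
have -> : x < j - t = false by move: rx; clear; lia.
have -> : x <= (j - t).+1 = false by move: rx tj t0; clear; lia.
have -> : x <= j = false by move: rx; clear; lia.
by have -> : x == N.*2 - j.+1 = false by move: rx; clear; lia.
Qed.

(** For [s < s'], the shorter block leaves at [(j - s).+1], or at [j] when [s = 0], a label larger
    than any label moved there from two positions earlier by the longer block. Once [t] is known,
    shifting back by two, and reading position [N.*2 - j.+1] for [j.-1], recovers the labels of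
    [D]. *)
Lemma blk_inj j t t' D D' : t <= j -> t' <= j -> j < N -> idle j D -> idle j D' ->
  (forall x, x < N.*2 -> blk_lab j t D x = blk_lab j t' D' x) ->
  t = t' /\ (forall x, x < N.*2 -> pl D x = pl D' x).
Proof.
move=> tj tj' jN id id' e.
have bd (E : diag N) x : idle j E -> x < N.*2 -> pl E x <= x.+1.
  by case=> /okdP ok _ lx; have := okd_bnd ok lx; rewrite /height; lia.
have jj (E : diag N) : idle j E -> pl E j = j.+1 by case=> _ /(_ j) []; lia.
have jb (E : diag N) : idle j E -> pl E (N.*2 - j.+1) = j.+1.
  case=> /okdP ok /(_ j) []; first by lia.
  by move=> <- <-; rewrite (okd_lab ok) //; lia.
have lt s s' (E E' : diag N) : s <= j -> s' <= j -> idle j E -> idle j E' ->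
    (forall x, x < N.*2 -> blk_lab j s E x = blk_lab j s' E' x) -> ~ s < s'.
  move=> sj sj' iE iE' ee ls; have s'0 : s' == 0 = false by lia.
  have bE x := @bd E' x iE'.
  case: (eqVneq s 0) => [s0|s0].
    have lj : j < N.*2 by lia.
    have := ee j lj; rewrite /blk_lab s0 s'0 eqxx jj //.
    have -> : j < j - s' = false by lia.
    rewrite leqnn; case: ifP => l; first by lia.
    by have := bE (j - 2); lia.
  have lj : (j - s).+1 < N.*2 by lia.
  have := ee _ lj; rewrite /blk_lab (negbTE s0) s'0.
  have -> : (j - s).+1 < j - s = false by lia.
  have -> : (j - s).+1 < j - s' = false by lia.
  have -> : (j - s).+1 <= (j - s').+1 = false by lia.
  have -> : (j - s).+1 <= j by lia.
  by rewrite leqnn; have := bE ((j - s).+1 - 2); lia.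
have tt : t = t'.
  case: (ltngtP t t') => // l; first by case: (lt _ _ _ _ tj tj' id id' e).
  by case: (lt _ _ _ _ tj' tj id' id (fun x lx => esym (e x lx))).
split=> //; subst t'; case: (eqVneq t 0) => [t0|t0] x lx.
  by have := e x lx; rewrite /blk_lab t0.
case: (ltnP x (j - t)) => l1.
  by have := e x lx; rewrite /blk_lab (negbTE t0) l1.
case: (ltnP x j.-1) => l2.
  have l : x.+2 < N.*2 by lia.
  have := e _ l; rewrite /blk_lab (negbTE t0) subn2 /=.
  have -> : x.+2 < j - t = false by lia.
  have -> : x.+2 <= (j - t).+1 = false by lia.
  by have -> : x.+2 <= j by lia.
have lb : N.*2 - j.+1 < N.*2 by lia.
case: (eqVneq x j.-1) => [->|x1].
  have := e _ lb; rewrite /blk_lab (negbTE t0) eqxx.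
  have -> : N.*2 - j.+1 < j - t = false by lia.
  have -> : N.*2 - j.+1 <= (j - t).+1 = false by lia.
  by have -> : N.*2 - j.+1 <= j = false by lia.
case: (eqVneq x j) => [->|x2]; first by rewrite !jj.
case: (eqVneq x (N.*2 - j.+1)) => [->|x3]; first by rewrite !jb.
have := e x lx; rewrite /blk_lab (negbTE t0) (negbTE x3).
have -> : x < j - t = false by lia.
have -> : x <= (j - t).+1 = false by lia.
by have -> : x <= j = false by lia.
Qed.

Lemma code_idle c j : (forall i, c i <= i) -> j <= N ->
  idle j (wd (rev (code_word c j)) (did N)) /\
  dweight (wd (rev (code_word c j)) (did N)) + (size (code_word c j)).*2 =
  dweight (did N).
Proof.
move=> cP; elim: j => [|j IH] jN.
  split; last by rewrite /= addn0.
  split; first exact: did_okada.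
  by move=> x rx; rewrite /= pm_did ?pl_did /height; lia.
have [id wt] := IH (ltnW jN).
rewrite code_word_rec rev_cat wd_cat; split; first exact: blk_idle.
have [_ _ _ _] := blk_step (cP j) jN id.
by rewrite size_cat [size (blk _ _)]size_map size_iota; move: wt; clear; lia.
Qed.

Lemma code_word_inj c c' j : (forall i, c i <= i) -> (forall i, c' i <= i) ->
  j <= N ->
  (forall x, x < N.*2 -> pl (wd (rev (code_word c j)) (did N)) x =
     pl (wd (rev (code_word c' j)) (did N)) x) ->
  forall i, i < j -> c i = c' i.
Proof.
move=> cP cP'; elim: j => // j IH jN e.
have [id _] := code_idle cP (ltnW jN); have [id' _] := code_idle cP' (ltnW jN).
have [_ lE _ _ _] := blk_step (cP j) jN id.
have [_ lE' _ _ _] := blk_step (cP' j) jN id'.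
have [|ej el] := blk_inj (cP j) (cP' j) jN id id'.
  by move=> x lx; rewrite -lE // -lE' // -!wd_cat -!rev_cat -!code_word_rec e.
move=> i; rewrite ltnS leq_eqVlt => /orP[/eqP -> //|]; apply: IH el i.
exact: ltnW.
Qed.


End Blocks.

Section Codes.
Variable N : nat.
Implicit Types s t : 'S_N.

Lemma perm_code_le s (i : 'I_N) : perm_code s i <= i.
Proof.
rewrite -[X in _ <= X]card_ord -(card_image (f := widen_ord (ltnW (ltn_ord i)))); last first.
  by move=> x y /(congr1 val) /= /val_inj.
apply: subset_leq_card; apply/subsetP => j; rewrite inE => /andP[lj _].
apply/imageP; exists (Ordinal lj) => //; exact: val_inj.
Qed.

(** By induction on [k], the code determines how the inverse permutation orders the images of the
    first [k] indices; each value is then recovered as the number of smaller ones. *)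
Lemma perm_code_inj s t : perm_code s =1 perm_code t -> s = t.
Proof.
move=> e; apply: invg_inj; move: e; rewrite /perm_code.
move: (s^-1)%g (t^-1)%g => u v e.
have ne (w : 'S_N) i j : i != j -> (w i < w j) = ~~ (w j < w i).
  by move=> nij; rewrite -leqNgt ltn_neqAle (inj_eq val_inj) (inj_eq perm_inj) nij.
have ord k : forall i j : 'I_N, i < k -> j < k -> (u i < u j) = (v i < v j).
  elim: k => // k IH i j.
  have top (x y : 'I_N) : x = k :> nat -> y < k -> (u x < u y) = (v x < v y).
    move=> xk yk.
    pose A (w : 'S_N) := [set z : 'I_N | (z < x)%N && (w x < w z)].
    have cA : #|A u| = #|A v| := e x.
    have AE w z : (z \in A w) = (z < k) && (w x < w z) by rewrite inE xk.
    (* On the indices below [k] the two orders agree by induction, and both sets are upper sets for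
       it. Upper sets of a total order are comparable, so equal sizes make them equal. *)
    have up : A u \subset A v \/ A v \subset A u.
      case: (boolP (A u \subset A v)) => [|/subsetPn[a]]; first by left.
      rewrite !AE => /andP[ak ua]; rewrite ak /= -leqNgt => va; right.
      apply/subsetP => b; rewrite !AE => /andP[bk vb]; rewrite bk /=.
      rewrite (ltn_trans ua) // IH //; exact: leq_ltn_trans va vb.
    have eA : A u = A v.
      by case: up => up; [|apply: esym]; apply/eqP; rewrite eqEcard up cA leqnn.
    by have := AE u y; rewrite eA AE yk.
  rewrite !ltnS (leq_eqVlt i) (leq_eqVlt j) => /orP[/eqP ik|ik] /orP[/eqP jk|jk].
  - have -> : i = j by apply: val_inj; rewrite /= ik.
    by rewrite !ltnn.
  - exact: top.
  - have nij : i != j by rewrite -(inj_eq val_inj) /= jk; move: ik; clear; lia.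
    by rewrite !(ne _ _ _ nij) top.
  - exact: IH.
have val_perm (w : 'S_N) i : w i = #|[set j | w j < w i]| :> nat.
  have -> : #|[set j | w j < w i]| = #|[set j : 'I_N | j < w i]|.
    rewrite -(card_preimset [set j : 'I_N | j < w i] (@perm_inj _ w)).
    by apply: eq_card => j; rewrite !inE.
  rewrite -[LHS]card_ord -(card_image (f := widen_ord (ltnW (ltn_ord (w i))))); last first.
    by move=> x y /(congr1 val) /= /val_inj.
  apply: eq_card => j; rewrite !inE; apply/imageP/idP => [[x _ ->]|lj] /=.
    exact: ltn_ord.
  by exists (Ordinal lj) => //; apply: val_inj.
apply/permP => i; apply: val_inj; rewrite /= (val_perm u i) (val_perm v i).
by apply: eq_card => j; rewrite !inE (ord N).
Qed.

Definition code_of s (i : nat) : nat :=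
  if insub i is Some j then perm_code s j else 0.

Lemma code_of_le s i : code_of s i <= i.
Proof. by rewrite /code_of; case: insubP => // j _ <-; apply: perm_code_le. Qed.

Lemma code_ofE s (i : 'I_N) : code_of s i = perm_code s i.
Proof. by rewrite /code_of valK. Qed.

(** There are $N!$ codes and $N!$ permutations, so injectivity of the code suffices. *)
Lemma code_of_surj c : (forall i, c i <= i) ->
  exists s, forall i, i < N -> code_of s i = c i.
Proof.
move=> cP.
pose T := {dffun forall i : 'I_N, 'I_i.+1}.
have le_ord (i : 'I_N) (x : 'I_i.+1) : x <= i by rewrite -ltnS.
pose f s : T := [ffun i : 'I_N => inord (perm_code s i) : 'I_i.+1].
have fE s i : f s i = perm_code s i :> nat.
  by rewrite ffunE inordK // ltnS perm_code_le.
have injf : injective f.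
  by move=> s t e; apply: perm_code_inj => i; rewrite -!fE e.
have cT : #|T| <= #|'S_N|.
  rewrite card_dep_ffun card_Sn fact_prod foldrE big_map big_enum /=.
  rewrite big_add1 /= big_mkord; apply: eq_leq.
  by apply: eq_bigr => i _; rewrite card_ord.
have /codomP[s es] := inj_card_onto injf cT [ffun i : 'I_N => inord (c i) : 'I_i.+1].
exists s => i iN; rewrite (code_ofE s (Ordinal iN)) -fE -es ffunE inordK //.
by rewrite ltnS cP.
Qed.

Lemma perm_wordE (s : 'S_N) : perm_word s = code_word (code_of s) N.
Proof.
rewrite /perm_word /code_word -val_enum_ord -map_comp; congr flatten.
by apply: eq_map => i; rewrite /= code_ofE.
Qed.

End Codes.

(** * Half diagrams and the join *)

(** A half arc is a fixed point of [m]. [okh_nest] joins planarity with the ban on half arcs under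
    full arcs; [okh_prop] speaks of all later positions, because an arc cannot reach back across a
    half arc. *)
Record okh (N : nat) (m h : nat -> nat) : Prop := Okh {
  okh_lt : forall x, x < N -> m x < N;
  okh_inv : forall x, x < N -> m (m x) = x;
  okh_lab : forall x, x < N -> h (m x) = h x;
  okh_bnd : forall x, x < N -> 0 < h x <= (minn x (m x)).+1;
  okh_par : forall x, x < N -> odd (h x) = odd (minn x (m x)).+1;
  okh_nest : forall x y, x < N -> x < y < m x ->
    [/\ m y <> y, x < m y < m x & h x < h y];
  okh_prop : forall x y, x < y < N -> m x = x -> h x < h y
}.

Section Halves.
Variable n : nat.
Local Notation N := n.+1.
Implicit Types (D : diag N) (H L R : half N).

Definition qm H (x : nat) : nat := hmate H (inord x).
Definition ql H (x : nat) : nat := hlab H (inord x).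

Lemma qm_ord H (a : 'I_N) : qm H a = hmate H a.
Proof. by rewrite /qm inord_val. Qed.

Lemma ql_ord H (a : 'I_N) : ql H a = hlab H a.
Proof. by rewrite /ql inord_val. Qed.

Lemma half_eqP H H' : (forall x, x < N -> qm H x = qm H' x) ->
  (forall x, x < N -> ql H x = ql H' x) -> H = H'.
Proof.
case: H H' => m h [m' h'] em eh; congr pair; apply/ffunP => a; apply: val_inj.
  by have := em _ (ltn_ord a); rewrite !qm_ord.
by have := eh _ (ltn_ord a); rewrite !ql_ord.
Qed.

Lemma prop_nodeE H (a : 'I_N) : prop_node H a = (qm H a == a).
Proof. by rewrite qm_ord. Qed.

Lemma okhP H : reflect (okh N (qm H) (ql H)) (is_half H).
Proof.
apply: (iffP idP).
- rewrite /is_half => /and5P[/forallP mt /forallP nc /forallP up /forallP bp].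
  move=> /andP[/forallP ns /forallP pr].
  have lt x : x < N -> qm H x < N by move=> _; apply: ltn_ord.
  have inv x : x < N -> qm H (qm H x) = x.
    move=> lx; have /andP[/eqP e _] := mt (inord x).
    by rewrite {1}/qm inord_val e inordK.
  have lab x : x < N -> ql H (qm H x) = ql H x.
    move=> lx; have /andP[_ /eqP e] := mt (inord x).
    by rewrite {1}/ql inord_val e.
  have nc' x y : x < N -> y < N -> x < y -> y < qm H x -> qm H x < qm H y -> False.
    move=> lx ly l1 l2 l3; have /forallP/(_ (inord y)) := nc (inord x).
    by rewrite -/(qm H x) -/(qm H y) !inordK // l1 l2 l3.
  have up' x y : x < N -> y < N -> qm H y = y -> x < y -> y < qm H x -> False.
    move=> lx ly e l1 l2; have /forallP/(_ (inord y)) := up (inord x).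
    by rewrite prop_nodeE -/(qm H x) !inordK // e eqxx l1 l2.
  have inside x y : x < N -> x < y -> y < qm H x ->
      [/\ qm H y <> y, x < qm H y & qm H y < qm H x].
    move=> lx l1 l2; have ly : y < N := ltn_trans l2 (lt _ lx).
    have n0 : qm H y <> y by move=> e; apply: (up' _ _ lx ly e l1 l2).
    have n1 : qm H y <> x by move=> e; move: l2; rewrite -e inv // ltnn.
    have n2 : qm H y <> qm H x by move=> e; move: l1; rewrite -(inv y) // e inv // ltnn.
    have n3 := nc' _ _ lx ly l1 l2.
    have n4 : ~ qm H y < x.
      by move=> l; apply: (nc' (qm H y) x); rewrite ?inv ?lt.
    by split=> //; move: n1 n2 n3 n4; clear; lia.
  split=> // [x lx|x lx|x y lx /andP[l1 l2]|x y /andP[l1 l2] e].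
  + have /andP[+ _] := bp (inord x).
    by rewrite -/(qm H x) -/(ql H x) inordK.
  + have /andP[_ /eqP] := bp (inord x).
    by rewrite -/(qm H x) -/(ql H x) inordK.
  + have [i0 i1 i2] := inside _ _ lx l1 l2; split=> //; first by rewrite i1 i2.
    have ly : y < N := ltn_trans l2 (lt _ lx).
    wlog op : y l1 l2 i0 i1 i2 ly / y < qm H y.
      move=> W; case: (ltngtP y (qm H y)) => [|l|e]; first exact: W.
        by rewrite -(lab y) //; apply: W; rewrite ?inv //; [apply/nesym|apply: lt].
      by case: i0.
    have /forallP/(_ (inord x)) := ns (inord y).
    by rewrite -/(qm H x) -/(qm H y) -/(ql H x) -/(ql H y) !inordK // l1 op i2.
  + have lx : x < N := ltn_trans l1 l2.
    have /forallP/(_ (inord x)) := pr (inord y).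
    rewrite prop_nodeE -/(qm H y) -/(ql H x) -/(ql H y) !inordK // e eqxx l1 /=.
    (* If the mate of [y] came before [x], the half arc at [x] would lie under a full arc. *)
    move/implyP; apply; case: (ltngtP x (qm H y)) => // [l|f].
      by case: (up' (qm H y) x (lt _ l2) lx e l); rewrite inv.
    by move: l1; rewrite -(inv y) // -f e f ltnn.
move=> ok.
have lt (a : 'I_N) := ltn_ord a.
rewrite /is_half; apply/and5P; split; [..|apply/andP; split]; apply/forallP => a;
  rewrite -?ql_ord -?qm_ord.
- apply/andP; split; apply/eqP/ord_inj; rewrite -?ql_ord -!qm_ord.
    exact: (okh_inv ok).
  exact: (okh_lab ok).
- apply/forallP => c; apply/negP => /and3P[]; rewrite -?qm_ord => l1 l2 l3.
  have [|_ /andP[_]] := @okh_nest _ _ _ ok _ c (lt a); first by rewrite l1.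
  by rewrite ltnNge (ltnW l3).
- apply/forallP => c; apply/implyP => /eqP e; apply/negP => /andP[]; rewrite -?qm_ord => l1 l2.
  have [|+ _ _] := @okh_nest _ _ _ ok _ c (lt a); first by rewrite l1.
  by rewrite qm_ord e.
- by rewrite (okh_bnd ok) // (okh_par ok) ?eqxx.
- apply/forallP => c; apply/implyP => /and3P[]; rewrite -?qm_ord -?ql_ord => l1 l2 l3.
  have [|_ _ ->//] := @okh_nest _ _ _ ok _ a (lt c).
  by rewrite l1 (ltn_trans l2 l3).
- apply/forallP => c; apply/implyP => /and3P[]; rewrite prop_nodeE -?ql_ord => /eqP e l1 _.
  by apply: (okh_prop ok) => //; rewrite l1 lt.
Qed.

Lemma qm_lhalf D x : x < N -> qm (lhalf D) x = if pm D x < N then pm D x else x.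
Proof.
move=> lx; rewrite /qm ffunE /=.
have -> : (inord x, false) = node_at n x by rewrite /node_at lx.
rewrite /pm; case: (mate D (node_at n x)) => i [] /=; rewrite /node_pos /=.
  by rewrite inordK // ifN //; have := ltn_ord i; lia.
by rewrite ltn_ord.
Qed.

Lemma ql_lhalf D x : x < N -> ql (lhalf D) x = pl D x.
Proof. by move=> lx; rewrite /ql ffunE /pl /node_at lx. Qed.

Lemma qm_rhalf D x : x < N -> qm (rhalf D) x =
  if N <= pm D (N.*2 - x.+1) then N.*2 - (pm D (N.*2 - x.+1)).+1 else x.
Proof.
move=> lx; have lx2 : x < N.*2 by lia.
rewrite qm_lhalf // pm_mirror //; have := pm_lt D (N.*2 - x.+1).
by case: ifP => l1 l2; case: ifP => l3 //; move: l1 l2 l3; clear; lia.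
Qed.

Lemma ql_rhalf D x : x < N -> ql (rhalf D) x = pl D (N.*2 - x.+1).
Proof. by move=> lx; rewrite ql_lhalf // pl_mirror //; lia. Qed.

Lemma okh_ext m h m' h' :
  (forall x, x < N -> m' x = m x) -> (forall x, x < N -> h' x = h x) ->
  okh N m h -> okh N m' h'.
Proof.
move=> em eh [lt inv lab bnd par nest pr].
split=> [x lx|x lx|x lx|x lx|x lx|x y lx|x y /andP[l1 l2]].
- by rewrite em // lt.
- by rewrite !em ?lt ?inv.
- by rewrite em // !eh ?lt ?lab.
- by rewrite em // eh ?bnd.
- by rewrite em // eh //; apply: par.
- rewrite em // => /andP[l1 l2]; have ly : y < N by apply: ltn_trans l2 (lt _ lx).
  by rewrite em // !eh //; apply: nest => //; rewrite l1.
- have lx := ltn_trans l1 l2.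
  by rewrite em // !eh //; apply: pr; rewrite l1.
Qed.

Lemma lhalf_half D : is_okada D -> is_half (lhalf D).
Proof.
move/okdP => ok; apply/okhP; apply: okh_ext (@qm_lhalf D) (@ql_lhalf D) _.
have d x : x < N -> x < N.*2 by clear; lia.
split=> [x lx|x lx|x lx|x lx|x lx|x y lx|x y /andP[l1 l2] e].
- by case: ifP.
- case l: (pm D x < N); last by rewrite l.
  by rewrite (okd_inv ok (d _ lx)) lx.
- by case: ifP => // l; rewrite (okd_lab ok (d _ lx)).
- have := okd_bnd ok (d _ lx); have := okd_bnd ok (okd_lt ok (d _ lx)).
  rewrite (okd_lab ok (d _ lx)) /height.
  by case: ifP => l; move: l; clear; lia.
- have lt := okd_lt ok (d _ lx); have p := okd_par ok (d _ lx).
  have p' := okd_par ok lt; rewrite (okd_inv ok (d _ lx)) (okd_lab ok (d _ lx)) in p'.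
  case: ifP => l; last by rewrite minnn; apply: p; move: l lx; clear; lia.
  case: (ltngtP x (pm D x)) => l1; first by rewrite p.
    by rewrite p'.
  by case: (okd_neq ok (d _ lx)).
- case: ifP => l; last by clear; lia.
  move=> /andP[l1 l2]; have [|/andP[i1 i2] i3] := @okd_nest _ _ _ ok _ y (d _ lx).
    by rewrite l1.
  have ly : y < N := ltn_trans l2 l.
  have -> : pm D y < N := ltn_trans i2 l.
  by split=> //; [apply: (okd_neq ok (d _ ly))|rewrite i1].
- have lx : x < N := ltn_trans l1 l2.
  have l : N <= pm D x.
    by rewrite leqNgt; apply/negP => l; move: e; rewrite l; apply: (okd_neq ok (d _ lx)).
  have [|_ //] := @okd_nest _ _ _ ok _ y (d _ lx).
  by rewrite l1 (leq_trans l2).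
Qed.

Lemma rhalf_half D : is_okada D -> is_half (rhalf D).
Proof. by move=> ok; apply/lhalf_half/mirror_okada. Qed.

Lemma plabP H (s : 'I_N.+1) :
  reflect (exists x, [/\ x < N, qm H x = x & ql H x = s]) (s \in plab H).
Proof.
apply: (iffP imsetP) => [[a]|[x [lx e1 e2]]].
  by rewrite inE prop_nodeE => /eqP e ->; exists a; rewrite ql_ord.
exists (inord x); last by apply: ord_inj; rewrite -e2.
by rewrite inE prop_nodeE inordK // e1.
Qed.

Lemma plab_lhalfP D (s : 'I_N.+1) : is_okada D ->
  reflect (exists x, [/\ x < N, N <= pm D x & pl D x = s]) (s \in plab (lhalf D)).
Proof.
move/okdP => ok; have d x : x < N -> x < N.*2 by clear; lia.
apply: (iffP (plabP _ _)) => -[x [lx]].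
  rewrite qm_lhalf // ql_lhalf // => e1 e2; exists x; rewrite lx; split=> //.
  by rewrite leqNgt; apply/negP => l; move: e1; rewrite l; apply: (okd_neq ok (d _ lx)).
move=> e1 e2; exists x; rewrite qm_lhalf // ql_lhalf // ifN ?lx -?leqNgt //.
Qed.

(** A propagating arc shows its label at both ends; the right end is the convenient one, since left
    multiplication rewires at left positions. *)
Lemma plab_rhalfP D (s : 'I_N.+1) : is_okada D ->
  reflect (exists y, [/\ N <= y < N.*2, pm D y < N & pl D y = s]) (s \in plab (lhalf D)).
Proof.
move=> okD; have /okdP ok := okD; have d x : x < N -> x < N.*2 by clear; lia.
apply: (iffP (plab_lhalfP _ okD)) => [[x [lx e1 e2]]|[y [/andP[ny ly] e1 e2]]].
  exists (pm D x); rewrite (okd_inv ok (d _ lx)) (okd_lab ok (d _ lx)) e1.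
  by rewrite (okd_lt ok (d _ lx)).
exists (pm D y).
by rewrite (okd_inv ok ly) (okd_lab ok ly).
Qed.

Lemma plab_rhalf D : is_okada D -> plab (rhalf D) = plab (lhalf D).
Proof.
move=> okD; have okM := mirror_okada okD; apply/setP => s.
apply/(plab_lhalfP _ okM)/(plab_rhalfP _ okD) => -[x].
  move=> [lx]; have lx2 : x < N.*2 by lia.
  rewrite pm_mirror // pl_mirror // => e1 e2; exists (N.*2 - x.+1).
  by have := pm_lt D (N.*2 - x.+1); split=> //; lia.
move=> [/andP[nx lx] e1 e2]; exists (N.*2 - x.+1).
have l : N.*2 - x.+1 < N.*2 by lia.
rewrite pm_mirror // pl_mirror //.
have -> : N.*2 - (N.*2 - x.+1).+1 = x by lia.
by split=> //; lia.
Qed.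

(** Any two propagating arcs are nested, so their labels differ. *)
Lemma right_label_inj D x y : is_okada D -> N <= x < N.*2 -> N <= y < N.*2 ->
  pm D x < N -> pm D y < N -> pl D x = pl D y -> x = y.
Proof.
move=> /okdP ok; wlog xy : x y / x < y.
  move=> W rx ry px py e; case: (ltngtP x y) => // l; first exact: W.
  by apply/esym/W.
move=> /andP[nx lx] /andP[ny ly] px py e.
have [|_] := @okd_nest _ _ _ ok (pm D y) x (okd_lt ok ly).
  by rewrite (okd_inv ok ly) xy (leq_trans py).
by rewrite (okd_lab ok ly) e ltnn.
Qed.

(** The halves give all labels and all full arcs; the right end of a propagating arc is then
    identified by its label. *)
Lemma halves_inj D E : is_okada D -> is_okada E ->
  lhalf D = lhalf E -> rhalf D = rhalf E -> D = E.
Proof.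
move=> okD okE el er; have /okdP ok := okD; have /okdP ok' := okE.
have d x : x < N -> x < N.*2 by clear; lia.
have eL x : x < N.*2 -> pl D x = pl E x.
  move=> lx; case: (ltnP x N) => l; first by rewrite -!ql_lhalf // el.
  have l' : N.*2 - x.+1 < N by lia.
  have e : x = N.*2 - (N.*2 - x.+1).+1 by lia.
  by rewrite e -!ql_rhalf // er.
have low x : x < N -> (if pm D x < N then pm D x else x) = (if pm E x < N then pm E x else x).
  by move=> lx; rewrite -!qm_lhalf // el.
have high x : N <= x < N.*2 -> (if N <= pm D x then pm D x else x) = (if N <= pm E x then pm E x else x).
  move=> /andP[nx lx]; have lx' : N.*2 - x.+1 < N by lia.
  have := qm_rhalf D lx'; rewrite er qm_rhalf //.
  have -> : N.*2 - (N.*2 - x.+1).+1 = x by lia.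
  have := pm_lt D x; have := pm_lt E x.
  by do 2 case: ifP; lia.
have both x : x < N.*2 -> (pm D x < N) = (pm E x < N).
  move=> lx; have n1 := okd_neq ok lx; have n2 := okd_neq ok' lx.
  case: (ltnP x N) => l; first by have := low _ l; do 2 case: ifP => //; lia.
  have := high x; rewrite l lx => /(_ isT).
  by case: (leqP N (pm D x)) => a; case: (leqP N (pm E x)) => b // e; exfalso; first [exact: n1|exact/n2/esym].
apply: diag_eqP => // x lx; case: (ltnP x N) => l.
  have := low _ l; rewrite -both //; case: ltnP => // pD _.
  have lE := okd_lt ok' lx.
  apply: (right_label_inj okD).
  - by rewrite pD (okd_lt ok).
  - by rewrite lE andbT leqNgt -both // -leqNgt.
  - by rewrite (okd_inv ok).
  - by rewrite both // (okd_inv ok').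
  - by rewrite (okd_lab ok) // eL // (eL _ lE) (okd_lab ok').
have := high x; rewrite l lx => /(_ isT); have := both x lx.
case: (leqP N (pm D x)) => pD; case: (leqP N (pm E x)) => pE // _ _.
have l1 := okd_lt ok lx; have l2 := okd_lt ok' lx.
have n1 : N <= pm D (pm E x) by rewrite leqNgt both // (okd_inv ok') // -leqNgt.
have e : pm D (pm E x) = x.
  apply: (right_label_inj okD); rewrite ?n1 ?l ?lx ?(okd_lt ok) ?(okd_inv ok) //.
  by rewrite (okd_lab ok) // eL // (okd_lab ok') // eL.
by rewrite -[in LHS]e (okd_inv ok).
Qed.

End Halves.

Section JoinNat.
Variables (N : nat) (mL hL mR hR : nat -> nat).
Hypotheses (okL : okh N mL hL) (okR : okh N mR hR).

(** [find] answers [N] when no half arc carries [s]; equality of the label sets excludes this for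
    the labels looked up. *)
Definition prop_at (m h : nat -> nat) (s : nat) : nat :=
  find (fun y => (m y == y) && (h y == s)) (iota 0 N).

Lemma prop_atP m h x : x < N -> m x = x ->
  [/\ prop_at m h (h x) < N, m (prop_at m h (h x)) = prop_at m h (h x) &
      h (prop_at m h (h x)) = h x].
Proof.
move=> lx e; have hs : has (fun y => (m y == y) && (h y == h x)) (iota 0 N).
  by apply/hasP; exists x; rewrite ?mem_iota ?e ?eqxx.
have := nth_find 0 hs; rewrite has_find size_iota in hs; rewrite nth_iota // add0n.
by move=> /andP[/eqP e1 /eqP e2].
Qed.

Lemma okh_prop_lt m h x y : okh N m h -> x < N -> y < N -> m x = x -> m y = y ->
  (h x < h y) = (x < y).
Proof.
move=> ok lx ly ex ey; case: (ltngtP x y) => [l|l|->]; last by rewrite ltnn.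
  by rewrite (okh_prop ok) // l ly.
by apply/negbTE; rewrite -leqNgt ltnW // (okh_prop ok) // l lx.
Qed.

Hypothesis LR : forall x, x < N -> mL x = x -> exists y, [/\ y < N, mR y = y & hR y = hL x].
Hypothesis RL : forall x, x < N -> mR x = x -> exists y, [/\ y < N, mL y = y & hL y = hR x].

Let b x := prop_at mR hR (hL x).
Let c y := prop_at mL hL (hR y).

Let bP x : x < N -> mL x = x -> [/\ b x < N, mR (b x) = b x & hR (b x) = hL x].
Proof. by move=> lx e; rewrite /b; have [y [ly ey <-]] := LR lx e; apply: prop_atP. Qed.

Let cP y : y < N -> mR y = y -> [/\ c y < N, mL (c y) = c y & hL (c y) = hR y].
Proof. by move=> lx e; rewrite /c; have [y' [ly ey <-]] := RL lx e; apply: prop_atP. Qed.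

Let uniqL x y : x < N -> y < N -> mL x = x -> mL y = y -> hL x = hL y -> x = y.
Proof.
move=> lx ly ex ey e; have := okh_prop_lt okL lx ly ex ey.
have := okh_prop_lt okL ly lx ey ex.
by rewrite e ltnn; lia.
Qed.

Let uniqR x y : x < N -> y < N -> mR x = x -> mR y = y -> hR x = hR y -> x = y.
Proof.
move=> lx ly ex ey e; have := okh_prop_lt okR lx ly ex ey.
have := okh_prop_lt okR ly lx ey ex.
by rewrite e ltnn; lia.
Qed.

Let cb x : x < N -> mL x = x -> c (b x) = x.
Proof.
move=> lx e; have [b1 b2 b3] := bP lx e; have [c1 c2 c3] := cP b1 b2.
by apply: uniqL => //; rewrite c3.
Qed.

Let bc x : x < N -> mR x = x -> b (c x) = x.
Proof.
move=> lx e; have [b1 b2 b3] := cP lx e; have [c1 c2 c3] := bP b1 b2.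
by apply: uniqR => //; rewrite c3.
Qed.

Definition joinm x :=
  if x < N then if mL x == x then N.*2 - (b x).+1 else mL x
  else let y := N.*2 - x.+1 in if mR y == y then c y else N.*2 - (mR y).+1.

Definition joinl x := if x < N then hL x else hR (N.*2 - x.+1).

Let rev x := N.*2 - x.+1.
Let revK x : x < N.*2 -> rev (rev x) = x. Proof. by rewrite /rev; lia. Qed.

Variant join_spec (x : nat) : nat -> nat -> Type :=
| JoinLP of x < N & mL x = x & b x < N & mR (b x) = b x & hR (b x) = hL x :
    join_spec x (rev (b x)) (hL x)
| JoinL of x < N & mL x <> x & mL x < N : join_spec x (mL x) (hL x)
| JoinRP y of y < N & x = rev y & mR y = y & c y < N & mL (c y) = c y &
    hL (c y) = hR y : join_spec x (c y) (hR y)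
| JoinR y of y < N & x = rev y & mR y <> y & mR y < N : join_spec x (rev (mR y)) (hR y).

Lemma join_natP x : x < N.*2 -> join_spec x (joinm x) (joinl x).
Proof.
move=> lx; rewrite /joinm /joinl; case: ltnP => l.
  case: eqP => e; last by apply: JoinL => //; apply: (okh_lt okL).
  by have [b1 b2 b3] := bP l e; apply: JoinLP.
have ly : rev x < N by rewrite /rev; move: lx l; clear; lia.
rewrite -/(rev x); case: eqP => e; last first.
  apply: (@JoinR x (rev x)) => //; first by rewrite revK.
  exact: (okh_lt okR).
have [c1 c2 c3] := cP ly e.
by apply: (@JoinRP x (rev x)) => //; rewrite revK.
Qed.

Let joinmL x : x < N -> joinm x = if mL x == x then rev (b x) else mL x.
Proof. by rewrite /joinm => ->. Qed.

Let joinmR y : y < N -> joinm (rev y) = if mR y == y then c y else rev (mR y).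
Proof.
move=> ly; rewrite /joinm ifN; last by rewrite /rev; move: ly; clear; lia.
by rewrite -!/(rev _) revK //; move: ly; clear; lia.
Qed.

Let joinlL x : x < N -> joinl x = hL x.
Proof. by rewrite /joinl => ->. Qed.

Let joinlR y : y < N -> joinl (rev y) = hR y.
Proof.
move=> ly; rewrite /joinl ifN; last by rewrite /rev; move: ly; clear; lia.
by rewrite -/(rev _) revK //; move: ly; clear; lia.
Qed.

Let rev_lt y z : y < N -> z < N -> (rev y < rev z) = (z < y).
Proof. by rewrite /rev; lia. Qed.

Let rev_ge y : y < N -> N <= rev y < N.*2.
Proof. by rewrite /rev; lia. Qed.

Let halfpar m h x : okh N m h -> x < m x -> x < N -> odd (m x) = ~~ odd x.
Proof.
move=> ok l lx; suff : odd x.+1 = odd (m x) by move <-.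
apply: (@closed_even m) => // [y ry|y z ry rz].
  have [n0 /andP[n1 n2] _] := okh_nest ok lx ry.
  have ly : y < N by have := okh_lt ok lx; move: ry; clear; lia.
  by split=> //; split; [exact: (okh_inv ok)|rewrite n1].
have ly : y < N by have := okh_lt ok lx; move: ry; clear; lia.
by have [_] := okh_nest ok ly rz.
Qed.

(** Labels of half arcs increase along both sides, so pairing equal labels nests the propagating
    arcs. A full arc under a propagating one comes after its half arc on one side, where [okh_prop]
    compares the labels. *)
Lemma join_nest x y : x < N.*2 -> x < y < joinm x ->
  x < joinm y < joinm x /\ joinl x < joinl y.
Proof.
move=> lx; case: (join_natP lx) => [l e b1 b2 b3|l e l'|w lw ex e c1 c2 c3|w lw ex e lw'] /andP[r1 r2].
- have ry : y < N.*2 by have := rev_ge b1; move: r2; clear; lia.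
  have rb := rev_ge b1.
  case: (join_natP ry) => [k f d1 d2 d3|k f k'|z kz ez f d1 d2 d3|z kz ez f kz'].
  + have hlt : hL x < hL y by rewrite (okh_prop_lt okL).
    have : b x < b y by rewrite -(okh_prop_lt okR) // b3 d3.
    by rewrite -(rev_lt d1 b1) => ->; have := rev_ge d1; move: l hlt; clear; lia.
  + have hlt : hL x < hL y by apply: (okh_prop okL); rewrite ?r1.
    have : x < mL y.
      case: (ltngtP x (mL y)) => // [g|g]; last first.
        by have yx : y = x; [rewrite -(okh_inv okL k) -g|move: r1; rewrite yx ltnn].
      have [|n0 _ _] := @okh_nest _ _ _ okL (mL y) x k'; last by case: n0.
      by rewrite g (okh_inv okL).
    by move=> ->; move: k' rb hlt; clear; lia.
  + have bz : b x < z by rewrite -(rev_lt kz b1) -ez.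
    have hlt : hL x < hR z by rewrite -b3 (okh_prop_lt okR).
    have : x < c z by rewrite -(okh_prop_lt okL) // d3.
    by move: d1 rb hlt; clear; lia.
  + have bz : b x < z by rewrite -(rev_lt kz b1) -ez.
    have hlt : hL x < hR z by rewrite -b3; apply: (okh_prop okR); rewrite ?bz.
    have : b x < mR z.
      case: (ltngtP (b x) (mR z)) => // [g|g]; last first.
        by have zx : z = b x; [rewrite -(okh_inv okR kz) -g|move: bz; rewrite zx ltnn].
      have [|n0 _ _] := @okh_nest _ _ _ okR (mR z) (b x) kz'; last by case: n0.
      by rewrite g (okh_inv okR).
    by rewrite -(rev_lt kz' b1) => ->; have := rev_ge kz'; move: l hlt; clear; lia.
- have ly : y < N by move: r2 l'; clear; lia.
  have [|n0 n1 n2] := @okh_nest _ _ _ okL x y l; first by rewrite r1.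
  by rewrite joinmL // joinlL // ifN //; apply/eqP.
- by have := rev_ge lw; move: c1 r1 r2 ex; clear; lia.
have rw' := rev_ge lw'; have rw := rev_ge lw.
have ry : y < N.*2 by move: r2 rw'; clear; lia.
pose z := rev y; have lz : z < N by rewrite /z /rev; move: r1 rw ex ry; clear; lia.
have ez : y = rev z by rewrite /z revK.
rewrite ez in r1 r2 *; rewrite ex in r1 *.
rewrite !rev_lt // in r1 r2.
have [|n0 /andP[n1 n2] n3] := @okh_nest _ _ _ okR (mR w) z lw'.
  by rewrite r2 (okh_inv okR).
rewrite (okh_inv okR lw) in n2; rewrite (okh_lab okR lw) in n3.
have lz' := okh_lt okR lz.
by rewrite joinmR // joinlR // ifN ?rev_lt ?n1 ?n2 //; apply/eqP.
Qed.

Lemma join_okd : okd N joinm joinl.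
Proof.
split; last exact: join_nest.
- move=> x lx; case: (join_natP lx) => [l e b1 b2 b3|l e l'|w lw ex e c1 c2 c3|w lw ex e lw'].
  + by have := rev_ge b1; lia.
  + by move: l'; clear; lia.
  + by move: c1; clear; lia.
  + by have := rev_ge lw'; lia.
- move=> x lx; case: (join_natP lx) => [l e b1 b2 b3|l e l'|w lw ex e c1 c2 c3|w lw ex e lw'] //.
  + by have := rev_ge b1; move: l; clear; lia.
  + by have := rev_ge lw; move: c1 ex; clear; lia.
  + by rewrite ex /rev; move: lw lw' e; clear; lia.
- move=> x lx; case: (join_natP lx) => [l e b1 b2 b3|l e l'|w lw ex e c1 c2 c3|w lw ex e lw'].
  + by rewrite joinmR // b2 eqxx cb.
  + rewrite joinmL // (okh_inv okL) // ifN //; apply/eqP/nesym; exact: e.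
  + by rewrite joinmL // c2 eqxx bc.
  + rewrite joinmR // (okh_inv okR) // ifN ?ex //; apply/eqP/nesym; exact: e.
- move=> x lx; case: (join_natP lx) => [l e b1 b2 b3|l e l'|w lw ex e c1 c2 c3|w lw ex e lw'].
  + by rewrite joinlR.
  + by rewrite joinlL // (okh_lab okL).
  + by rewrite joinlL.
  + by rewrite joinlR // (okh_lab okR).
- move=> x lx; rewrite /height.
  case: (join_natP lx) => [l e b1 b2 b3|l e l'|w lw ex e c1 c2 c3|w lw ex e lw'].
  + by have := okh_bnd okL l; move: l; clear; lia.
  + by have := okh_bnd okL l; move: l; clear; lia.
  + by have := okh_bnd okR lw; rewrite ex /rev; move: lw; clear; lia.
  + by have := okh_bnd okR lw; rewrite ex /rev; move: lw; clear; lia.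
- move=> x lx.
  case: (join_natP lx) => [l e b1 b2 b3|l e l'|w lw ex e c1 c2 c3|w lw ex e lw'] lt.
  + by rewrite (okh_par okL l) e minnn.
  + by rewrite (okh_par okL l) (minn_idPl (ltnW lt)).
  + by have := rev_ge lw; move: lt c1 ex; clear; lia.
  + rewrite ex rev_lt // in lt.
    have le : minn w (mR w) = mR w by move: lt; clear; lia.
    rewrite (okh_par okR lw) le ex /rev.
    have := @halfpar mR hR (mR w) okR; rewrite (okh_inv okR) // => /(_ lt lw') o.
    by rewrite oddB ?odd_double /= ?o ?negbK //; move: lw; clear; lia.
Qed.

End JoinNat.

Section Join.
Variable n : nat.
Local Notation N := n.+1.
Implicit Types (D : diag N) (H L R : half N).

Lemma join_exists L R : is_half L -> is_half R -> plab L = plab R ->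
  exists D, [/\ is_okada D, lhalf D = L & rhalf D = R].
Proof.
move=> /okhP okL /okhP okR e.
have cor (H H' : half N) : plab H = plab H' -> forall x, x < N -> qm H x = x ->
    exists y, [/\ y < N, qm H' y = y & ql H' y = ql H x].
  move=> eh x lx ex; have : hlab H (inord x) \in plab H by apply/plabP; exists x.
  by rewrite eh => /plabP[y [ly ey el]]; exists y.
have LR := cor _ _ e; have RL := cor _ _ (esym e).
have okJ := join_okd okL okR LR RL.
pose D := mkd n (joinm N (qm L) (ql L) (qm R) (ql R)) (joinl N (ql L) (ql R)).
have okD : is_okada D by apply: mkd_okada.
have d x : x < N -> x < N.*2 by clear; lia.
exists D; split=> //; apply: half_eqP => x lx.
- rewrite qm_lhalf // (pm_mkd okJ (d _ lx)) /joinm lx.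
  case: eqP => e1; last by rewrite (okh_lt okL lx).
  have [y [ly ey <-]] := LR _ lx e1.
  have [b1 _ _] := prop_atP (ql R) ly ey.
  by rewrite ifN //; move: b1; clear; lia.
- by rewrite ql_lhalf // (pl_mkd okJ (d _ lx)) /joinl lx.
- have lx' : N.*2 - x.+1 < N.*2 by move: lx; clear; lia.
  have xx : N.*2 - (N.*2 - x.+1).+1 = x by move: lx; clear; lia.
  have nx : N.*2 - x.+1 < N = false by move: lx; clear; lia.
  rewrite qm_rhalf // (pm_mkd okJ lx') /joinm nx /= xx.
  case: eqP => e1.
    have [y [ly ey <-]] := RL _ lx e1.
    have [b1 _ _] := prop_atP (ql L) ly ey.
    by rewrite ifN ?e1 //; move: b1; clear; lia.
  have := okh_lt okR lx => l1; rewrite ifT; last by move: l1; clear; lia.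
  by move: l1; clear; lia.
- have lx' : N.*2 - x.+1 < N.*2 by move: lx; clear; lia.
  have xx : N.*2 - (N.*2 - x.+1).+1 = x by move: lx; clear; lia.
  have nx : N.*2 - x.+1 < N = false by move: lx; clear; lia.
  by rewrite ql_rhalf // (pl_mkd okJ lx') /joinl nx xx.
Qed.

Lemma join_halvesP L R : is_half L -> is_half R -> plab L = plab R ->
  [/\ is_okada (join L R), lhalf (join L R) = L & rhalf (join L R) = R].
Proof.
move=> hL hR e; rewrite /join; case: pickP => [D /and3P[okD /eqP e1 /eqP e2] //|no].
have [D [okD e1 e2]] := join_exists hL hR e.
by have := no D; rewrite okD e1 e2 !eqxx.
Qed.

Lemma join_halves D : is_okada D -> join (lhalf D) (rhalf D) = D.
Proof.
move=> okD.
have [okJ e1 e2] := join_halvesP (lhalf_half okD) (rhalf_half okD) (esym (plab_rhalf okD)).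
exact: halves_inj.
Qed.

(** A mate in the other half is seen only as a half arc, and rewiring passes it on without regard to
    which node it is. *)
Lemma lhalf_rwd D E a : is_okada D -> is_okada E -> a.+1 < N ->
  lhalf D = lhalf E -> lhalf (rwd D a) = lhalf (rwd E a).
Proof.
move=> okD okE la e.
have d x : x < N -> x < N.*2 by clear; lia.
have eL x : x < N -> pl D x = pl E x by move=> lx; rewrite -!ql_lhalf // e.
have low x : x < N -> (if pm D x < N then pm D x else x) = (if pm E x < N then pm E x else x).
  by move=> lx; rewrite -!qm_lhalf // e.
have /okdP ok := okD; have /okdP ok' := okE.
have eM x : x < N -> pm D x = pm E x \/ (N <= pm D x /\ N <= pm E x).
  move=> lx; have n1 := okd_neq ok (d _ lx); have n2 := okd_neq ok' (d _ lx).
  have := low _ lx.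
  case: (leqP N (pm D x)) => k1; case: (leqP N (pm E x)) => k2 g; first by right.
  - by case: n2.
  - by case: n1.
  - by left.
have la0 : a < N := ltnW la.
have sw x y : x < N -> y < N -> (x == pm D y) = (x == pm E y).
  by move=> lx ly; case: (eM _ ly) => [->//|[k1 k2]]; move: lx k1 k2; clear; lia.
apply: half_eqP => x lx.
  rewrite !qm_lhalf // !pm_rwd ?d // /rwm !sw //.
  case: eqP => // _; case: eqP => // _.
  have fin y : y < N -> (if pm D y < N then pm D y else x) = (if pm E y < N then pm E y else x).
    by move=> ly; case: (eM _ ly) => [->//|[k1 k2]]; rewrite !ifN // -leqNgt.
  by case: (x == pm E a); case: (x == pm E a.+1); apply: fin => //; apply: ltnW.
rewrite !ql_lhalf // !pl_rwd ?d // /rwl !sw //.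
by rewrite !eL.
Qed.

(** A right node is touched only when its arc meets [a] or [a.+1], and then it receives the smaller
    of the two labels. Propagating labels can therefore only drop or disappear. *)
Lemma right_rwd D a y : is_okada D -> a.+1 < N -> N <= y < N.*2 ->
  pm (rwd D a) y < N -> pm D y < N /\ pl (rwd D a) y <= pl D y.
Proof.
move=> okD la /andP[ny ly]; have /okdP ok := okD.
have l0 : a < N.*2 by move: la; clear; lia.
have l1 : a.+1 < N.*2 by move: la; clear; lia.
rewrite pm_rwd // pl_rwd // /rwm /rwl.
have -> : y == a = false by move: ny la; clear; lia.
have -> : y == a.+1 = false by move: ny la; clear; lia.
rewrite /=; case: eqP => [->|n1] /=.
  by rewrite (okd_inv ok l0) (okd_lab ok l0) geq_minl; move: la; clear; lia.
case: eqP => [->|n2] //=.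
by rewrite (okd_inv ok l1) (okd_lab ok l1) geq_minr; move: la; clear; lia.
Qed.

(** Only the right ends of the arcs through [a] and [a.+1] are at stake. If such an end lost its
    label, no right end would carry this label any more, since the others keep theirs and labels of
    right ends are distinct. *)
Lemma rhalf_rwd D a : is_okada D -> a.+1 < N ->
  plab (lhalf (rwd D a)) = plab (lhalf D) -> rhalf (rwd D a) = rhalf D.
Proof.
move=> okD la e; have /okdP ok := okD; have okR := rwd_okada okD la.
have l0 : a < N.*2 by move: la; clear; lia.
have l1 : a.+1 < N.*2 by move: la; clear; lia.
have e0 := okd_inv ok l0; have e1 := okd_inv ok l1.
have h0 := okd_lab ok l0; have h1 := okd_lab ok l1.
have na : pm D a <> pm D a.+1.
  by move=> f; move: e0 e1; rewrite f => ->; clear; lia.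
(* A right end of an arc through [a] or [a.+1] keeps its label, for this label
   can only be found there in the new diagram. *)
have key u v : (u = a /\ v = a.+1) \/ (u = a.+1 /\ v = a) -> N <= pm D u ->
    pm D v < N /\ pl D u <= pl D v.
  move=> uv nu.
  have lu : u < N.*2 by case: uv => -[-> _].
  have lv : v < N.*2 by case: uv => -[_ ->].
  have uN : u < N by case: uv => -[-> _] //; apply: ltnW.
  have nuv : pm D u <> pm D v by case: uv => -[-> ->] //; apply/nesym.
  have : lab D (node_at n u) \in plab (lhalf (rwd D a)).
    by rewrite e; apply/(plab_lhalfP _ okD); exists u.
  move=> /(plab_rhalfP _ okR)[y [ry py hy]].
  have [qy gy] := right_rwd okD la ry py.
  have /andP[ny ly] := ry.
  have lpu := okd_lt ok lu.
  have rwE x : N <= x < N.*2 -> (pm (rwd D a) x = if x == pm D u then pm D v else if x == pm D v then pm D u else pm D x)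
     /\ (pl (rwd D a) x = if (x == pm D u) || (x == pm D v) then minn (pl D u) (pl D v) else pl D x).
    move=> /andP[nx lx]; rewrite pm_rwd // pl_rwd // /rwm /rwl.
    have -> : x == a = false by move: nx la; clear; lia.
    have -> : x == a.+1 = false by move: nx la; clear; lia.
    case: uv => -[-> ->] //=; split.
      by case: eqP => [->|]; case: eqP => // f; rewrite ?f //; case: na.
    by rewrite orbC minnC.
  have [my hy'] := rwE y ry.
  rewrite -/(pl D u) in hy.
  case: (eqVneq y (pm D u)) => [yu|yu].
    rewrite my yu eqxx in py; rewrite hy' yu eqxx /= in hy.
    by split=> //; move: hy; clear; lia.
  case: (eqVneq y (pm D v)) => [yv|yv].
    have pu : pm D u < N by move: py; rewrite my (negbTE yu) yv eqxx.
    by move: nu; rewrite leqNgt pu.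
  rewrite hy' (negbTE yu) (negbTE yv) /= in hy.
  case/negP: yu; apply/eqP; apply: (right_label_inj okD); rewrite ?nu ?lpu //.
    by rewrite (okd_inv ok).
  by rewrite (okd_lab ok).
have fin x : N <= x < N.*2 -> pl (rwd D a) x = pl D x /\
   (pm (rwd D a) x = pm D x \/ (pm (rwd D a) x < N /\ pm D x < N)).
  move=> /andP[nx lx]; rewrite pm_rwd // pl_rwd // /rwm /rwl.
  have -> : x == a = false by move: nx la; clear; lia.
  have -> : x == a.+1 = false by move: nx la; clear; lia.
  rewrite /=; case: eqP => [xa|n1] /=.
    rewrite xa in nx *; have [] := key a a.+1 _ nx; first by left.
    by move=> k1 k2; rewrite h0 e0 (minn_idPl k2); split=> //; right; split => //; apply: ltnW.
  case: eqP => [xa|n2] /=; last by split=> //; left.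
  rewrite xa in nx *; have [] := key a.+1 a _ nx; first by right.
  by move=> k1 k2; rewrite h1 e1 (minn_idPr k2); split=> //; right.
apply: half_eqP => x lx.
  have r : N <= N.*2 - x.+1 < N.*2 by move: lx; clear; lia.
  rewrite !qm_rhalf //; have [_ [->//|[k1 k2]]] := fin _ r.
  by rewrite !ifN // -ltnNge.
have r : N <= N.*2 - x.+1 < N.*2 by move: lx; clear; lia.
by rewrite !ql_rhalf //; have [] := fin _ r.
Qed.

End Join.

(** * Fibonacci sets and dominance *)

Lemma count_le_nth (e : seq nat) l : sorted ltn e -> l < size e ->
  count (leq^~ (nth 0 e l)) e = l.+1.
Proof.
elim: e l => // x e IH l /=; rewrite (path_sortedE ltn_trans) => /andP[/allP ge se].
case: l => [|l] ls /=.
  rewrite leqnn; congr _.+1; apply/eqP; rewrite -leqn0 leqNgt -has_count.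
  by apply/hasPn => y /ge; rewrite ltnNge.
by rewrite IH // ltnW // ge // mem_nth.
Qed.

Lemma le_nth_count (e : seq nat) t i : sorted ltn e -> i < size e ->
  (t <= nth 0 e (size e - i.+1)) = (i < count (leq t) e).
Proof.
elim: e => // x e IH /=; rewrite (path_sortedE ltn_trans) => /andP[/allP ge se] ls.
have all_ge : t <= x -> count (leq t) e = size e.
  move=> tx; apply/eqP; rewrite -all_count; apply/allP => y /ge l.
  exact: leq_trans tx (ltnW l).
rewrite subSS; case: (ltngtP i (size e)) => l; last first.
- rewrite l subnn /=; case: (leqP t x) => tx; first by rewrite all_ge // add1n ltnSn.
  by rewrite add0n ltnNge count_size.
- by move: ls l; clear; lia.
have -> : size e - i = (size e - i.+1).+1 by move: l; clear; lia.
rewrite /= IH //; case: (leqP t x) => tx //.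
by rewrite all_ge // l add1n ltnW.
Qed.

Section Elts.
Variable N : nat.
Implicit Type S : {set 'I_N.+1}.

Definition count_ge S t : nat := #|[set s in S | t <= s]|.

Lemma elts_sorted S : sorted ltn (elts S).
Proof.
rewrite ltn_sorted_uniq_leq sort_uniq map_inj_uniq ?enum_uniq //=; last exact: val_inj.
exact: (sort_sorted leq_total).
Qed.

Lemma size_elts S : size (elts S) = #|S|.
Proof. by rewrite size_sort size_map -cardE. Qed.

Lemma count_elts S (p : pred nat) : count p (elts S) = #|[set s in S | p (val s)]|.
Proof.
rewrite count_sort count_map -size_filter cardE; congr size.
rewrite /enum_mem -filter_predI; apply: eq_filter => s.
by rewrite !inE /= andbC.
Qed.

Lemma is_yfs_parity S : ord0 \notin S -> odd #|S| = odd N ->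
  (forall s : 'I_N.+1, s \in S -> odd s = odd #|[set t in S | t <= s]|) -> is_yfs S.
Proof.
move=> S0 oS par; apply/and3P; split=> //; first exact/eqP.
apply/forallP => l; apply/eqP; have ls : l < size (elts S) by rewrite size_elts.
have := mem_nth 0 ls; set v := nth 0 (elts S) l => vS.
have : v \in map val (enum S) by rewrite -(mem_sort leq).
move=> /mapP[s]; rewrite mem_enum => sS ev.
rewrite ev [LHS]par // -(count_le_nth (elts_sorted S) ls) count_elts -/v ev.
by [].
Qed.

(** Comparing entries from the top amounts to comparing, for every threshold, how many elements
    reach it; the threshold 0 compares the sizes. Order axioms and the effect of a product become
    counting arguments. *)
Lemma dominanceP (S T : yfs N) :
  reflect (forall t, count_ge (val S) t <= count_ge (val T) t) (dominance S T).
Proof.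
rewrite /dominance; have sS := elts_sorted (val S); have sT := elts_sorted (val T).
have cE (U : yfs N) t : count_ge (val U) t = count (leq t) (elts (val U)).
  by rewrite count_elts.
rewrite -!size_elts; apply: (iffP andP) => [[kl /forallP H] t|H].
  rewrite !cE; case e: (count (leq t) (elts (val S))) => [//|i].
  have li : i < size (elts (val S)) by rewrite -e count_size.
  rewrite -le_nth_count ?(leq_trans li) //.
  apply: leq_trans; last first.
    exact: (H (Ordinal li)).
  by rewrite /= le_nth_count // e.
have kl : size (elts (val S)) <= size (elts (val T)).
  by have := H 0; rewrite !cE -!size_filter !(eq_filter (a2 := predT)) // !filter_predT.
split=> //; apply/forallP => i; have li := ltn_ord i.
rewrite le_nth_count ?(leq_trans li kl) // -cE; apply: leq_trans (H _).
by rewrite cE -le_nth_count.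
Qed.

Lemma dominance_refl : reflexive (@dominance N).
Proof. by move=> S; apply/dominanceP. Qed.

Lemma dominance_trans : transitive (@dominance N).
Proof.
move=> T S U /dominanceP h1 /dominanceP h2; apply/dominanceP => t.
exact: leq_trans (h1 t) (h2 t).
Qed.

Lemma count_geS S (s : 'I_N.+1) : count_ge S s = (s \in S) + count_ge S s.+1.
Proof.
rewrite /count_ge (cardsD1 s) inE leqnn andbT; congr addn; apply: eq_card => t.
by rewrite !inE ltn_neqAle (inj_eq val_inj) [t == s]eq_sym andbCA.
Qed.

Lemma dominance_anti : antisymmetric (@dominance N).
Proof.
move=> S T /andP[/dominanceP h1 /dominanceP h2]; apply/val_inj/setP => s.
have e t : count_ge (val S) t = count_ge (val T) t.
  by apply/eqP; rewrite eqn_leq h1 h2.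
have := e s; rewrite !count_geS e => /addIn.
by do 2 case: (s \in _).
Qed.

End Elts.

(** * Propagating labels: Fibonacci sets, and their descent under multiplication *)

Section Yfs.
Variable n : nat.
Local Notation N := n.+1.
Variable D : diag N.
Hypothesis okD : is_okada D.

Let ok : okd N (pm D) (pl D). Proof. exact/okdP. Qed.
Let d x : x < N -> x < N.*2. Proof. by clear; lia. Qed.

(** A propagating last node counts for one. A last node that closes an arc is removed with
    everything under that arc: an even number of nodes, none of them propagating. *)
Lemma prop_count_parity x : x <= N ->
  (forall y, y < x -> pm D y < x \/ N <= pm D y) ->
  odd (\sum_(0 <= y < x) (N <= pm D y)) = odd x.
Proof.
elim/ltn_ind: x => -[|x] IH lx cl; first by rewrite big_geq.
case: (leqP N (pm D x)) => px.
  rewrite big_nat_recr //= px addn1 /= IH //; first exact: ltnW.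
  move=> y yx; case: (cl y (ltnW yx)) => [|]; last by right.
  rewrite ltnS leq_eqVlt => /orP[/eqP e|]; last by left.
  by move: px; rewrite -e (okd_inv ok) ?d //; move: yx lx; clear; lia.
have zx : pm D x < x.
  have := okd_neq ok (d lx); case: (cl x (leqnn _)); move: px; clear; lia.
set z := pm D x in px zx.
have lz : z < N by [].
have mz : pm D z = x by rewrite (okd_inv ok (d lx)).
have inz y : z < y < x -> z < pm D y < x.
  by move=> ry; have := @okd_nest _ _ _ ok z y (d lz); rewrite mz => /(_ ry)[].
rewrite (@big_cat_nat _ _ _ z) //=; last exact: leqW (ltnW zx).
rewrite [X in _ + X]big1_seq ?addn0 => [|y]; last first.
  rewrite mem_index_iota => /andP[_ ry].
  case: (eqVneq y z) => [->|yz]; first by rewrite mz leqNgt lx.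
  case: (eqVneq y x) => [->|yx]; first by rewrite leqNgt px.
  have := inz y; move: ry yz yx lx; clear; lia.
rewrite IH //; [|by move: zx; clear; lia|exact: ltnW|].
  suff : odd z = odd x.+1 by [].
  have := okd_posparity ok (d lx); rewrite -/z => -> /=; by [].
move=> y yz; case: (leqP N (pm D y)) => b; [by right|left; move: b].
have ly : y < N by move: yz lz; clear; lia.
case: (ltngtP (pm D y) z) => // h1 b.
  have [|/andP[h2 h3] _] := @okd_nest _ _ _ ok y z (d ly); first by rewrite yz.
  rewrite mz in h2 h3; by case: (cl y); move: yz zx h1 h2 h3 b; clear; lia.
by move: (okd_inv ok (d ly)); rewrite h1 mz; move: yz zx; clear; lia.
Qed.

Lemma card_prefix (p : pred nat) k : k <= N ->
  #|[set a : 'I_N | p a && (a < k)]| = \sum_(0 <= y < k) p y.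
Proof.
move=> lk; rewrite -sum1dep_card big_mkcond /=.
rewrite -(big_mkord xpredT (fun a => if p a && (a < k) then 1 else 0)).
rewrite (@big_cat_nat _ _ _ k) //= [X in _ + X]big1_seq ?addn0.
  by apply: eq_big_nat => y /andP[_ ->]; rewrite andbT; case: (p y).
by move=> y; rewrite mem_index_iota => /andP[_ /andP[ky _]]; rewrite ltnNge ky andbF.
Qed.

Let prop (a : 'I_N) := N <= pm D a.

Let plabE : plab (lhalf D) = [set lab D (a, false) | a : 'I_N in [set a | prop a]].
Proof.
apply/setP => s; apply/(plab_lhalfP _ okD)/imsetP => [[x [lx e1 e2]]|[a]].
  exists (Ordinal lx); rewrite ?inE //; apply: ord_inj; rewrite -e2 /pl /node_at lx.
  by congr (nat_of_ord (lab D (_, _))); apply: ord_inj; rewrite inordK.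
rewrite inE => pa ->; exists a; split=> //.
by rewrite /pl /node_at ltn_ord inord_val.
Qed.

Let labE (a : 'I_N) : lab D (a, false) = pl D a :> nat.
Proof. by rewrite /pl /node_at ltn_ord inord_val. Qed.

Let prop_lt (a b : 'I_N) : prop a -> (a < b) -> pl D a < pl D b.
Proof.
move=> pa ab; have [|_ //] := @okd_nest _ _ _ ok a b (d (ltn_ord a)).
by rewrite ab (leq_trans (ltn_ord b)).
Qed.

Let prop_inj : {in [set a | prop a] &, injective (fun a => lab D (a, false))}.
Proof.
move=> a b; rewrite !inE => pa pb /(congr1 (@nat_of_ord _)); rewrite !labE => e.
apply: ord_inj; case: (ltngtP a b) => // l; [have := prop_lt pa l|have := prop_lt pb l];
  by rewrite e ltnn.
Qed.

(** Labels increase along the propagating nodes, so the rank of the label at [x] is the number of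
    propagating nodes up to [x]. It has the parity of [x.+1], as has the label, because [x] opens
    its arc. *)
Lemma plab_yfs : is_yfs (plab (lhalf D)).
Proof.
apply: is_yfs_parity.
- apply/(plab_lhalfP _ okD) => -[x [lx _ e]].
  by have := okd_bnd ok (d lx); rewrite e.
- rewrite plabE card_in_imset //.
  have -> : [set a | prop a] = [set a : 'I_N | prop a && (a < N)].
    by apply/setP => a; rewrite !inE ltn_ord andbT.
  rewrite (card_prefix (fun y => N <= pm D y)) // prop_count_parity // => y yN.
  by case: (leqP N (pm D y)); [right|left].
move=> s /(plab_lhalfP _ okD)[x [lx px es]].
have -> : [set t in plab (lhalf D) | t <= s] =
    [set lab D (a, false) | a : 'I_N in [set a : 'I_N | prop a && (a < x.+1)]].
  apply/setP => t; rewrite inE plabE; apply/andP/imsetP.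
    move=> [/imsetP[a]]; rewrite inE => pa -> ts; exists a => //; rewrite inE pa.
    rewrite ltnS leqNgt; apply/negP => xa; have := @prop_lt (Ordinal lx) a px xa.
    by move: ts; rewrite labE -es /=; clear; lia.
  move=> [a]; rewrite inE => /andP[pa ax] ->; split; first by apply: imset_f; rewrite inE.
  rewrite labE -es; move: ax; rewrite ltnS leq_eqVlt => /orP[/eqP -> //|ax].
  exact: ltnW (@prop_lt a (Ordinal lx) pa ax).
rewrite card_in_imset; last first.
  by move=> a b; rewrite !inE => /andP[pa _] /andP[pb _]; apply: prop_inj; rewrite inE.
rewrite (card_prefix (fun y => N <= pm D y)) //.
rewrite prop_count_parity //; last first.
  move=> y; rewrite ltnS leq_eqVlt => /orP[/eqP ->|yx]; first by right.
  case: (leqP N (pm D y)) => py; [by right|left].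
  have ly := ltn_trans yx lx.
  rewrite ltnS leqNgt; apply/negP => l.
  have [|/andP[_ h] _] := @okd_nest _ _ _ ok y x (d ly); first by rewrite yx.
  by move: h px py; clear; lia.
by rewrite -es (okd_par ok (d lx)) //; move: lx px; clear; lia.
Qed.

Lemma count_ge_rwd a t : a.+1 < N ->
  count_ge (plab (lhalf (rwd D a))) t <= count_ge (plab (lhalf D)) t.
Proof.
move=> la; have okR := rwd_okada okD la.
(* [g] sends an old label to the new label of the same right node. Old labels being at least as
   large by [right_rwd], it maps those that are at least [t] onto a set containing the new ones;
   [ord0] is a default. *)
pose g (s : 'I_N.+1) : 'I_N.+1 :=
  if [pick b : 'I_N | (pm D (N + b) < N) && (pl D (N + b) == s)] is Some b
  then lab (rwd D a) (node_at n (N + b)) else ord0.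
rewrite /count_ge; apply: leq_trans (leq_imset_card g _).
apply: subset_leq_card; apply/subsetP => s; rewrite inE => /andP[+ ts].
move=> /(plab_rhalfP _ okR)[y [ry py hy]].
have [qy ly] := right_rwd okD la ry py.
have /andP[ny yN] := ry.
apply/imsetP; exists (lab D (node_at n y)).
  rewrite inE; apply/andP; split; first by apply/(plab_rhalfP _ okD); exists y.
  by apply: leq_trans ts _; rewrite -hy.
have rb (b : 'I_N) : N <= N + b < N.*2 by have := ltn_ord b; clear; lia.
rewrite /g; case: pickP => [b /andP[pb /eqP eb]|no].
  have <- : y = N + b by apply: (right_label_inj okD) => //; rewrite eb.
  by apply: ord_inj; rewrite -hy.
have lb : y - N < N by move: ry; clear; lia.
have := no (Ordinal lb); rewrite /= subnKC // qy /=.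
by rewrite /pl eqxx.
Qed.

End Yfs.

Import GRing.Theory.
Local Open Scope ring_scope.

(** * Spanning set of the Okada algebra *)

Lemma blk_cat i s t : blk i (s + t) = blk i s ++ blk (i - s) t.
Proof.
rewrite /blk iotaD map_cat; congr cat.
by rewrite add0n -[s in LHS]addn0 iotaDl -map_comp; apply: eq_map => x /=; rewrite subnDA.
Qed.

Lemma eq_code_word c c' j : (forall i, (i < j)%N -> c i = c' i) ->
  code_word c j = code_word c' j.
Proof.
move=> e; rewrite /code_word; congr flatten; apply/eq_in_map => i.
by rewrite mem_iota => /e ->.
Qed.

Section Span.
Variables (K : fieldType) (A : algType K) (N : nat) (E : nat -> A) (x y : nat -> K).
Hypothesis E_sq : forall k, (0 < k < N)%N -> E k * E k = x k *: E k.
Hypothesis E_comm : forall i j, (0 < i)%N -> (i.+1 < j < N)%N -> E i * E j = E j * E i.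
Hypothesis E_braid : forall k, (0 < k)%N -> (k.+1 < N)%N ->
  E k.+1 * E k * E k.+1 = y k *: E k.+1.

Definition wprod (w : seq nat) : A := \prod_(k <- w) E k.

Lemma wprod_cat w1 w2 : wprod (w1 ++ w2) = wprod w1 * wprod w2.
Proof. by rewrite /wprod big_cat. Qed.

Lemma wprod1 k : wprod [:: k] = E k.
Proof. by rewrite /wprod big_seq1. Qed.

(** The span of the products of [code_word c j] with [c i <= i], written block by block: the
    coefficient of the last block is itself in the smaller span. In the sum, [j] is the successor of
    [j'], so the block has at most [j'] letters. *)
Fixpoint span_words (j : nat) (u : A) : Prop :=
  if j is j'.+1 then
    exists2 f : nat -> A, (forall t, span_words j' (f t)) &
      u = \sum_(0 <= t < j) f t * wprod (blk j' t)
  else exists a : K, u = a%:A.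

Lemma span_words_lin j a u v :
  span_words j u -> span_words j v -> span_words j (a *: u + v).
Proof.
elim: j u v => [|j IH] u v /=.
  move=> [b ->] [c ->]; exists (a * b + c).
  by rewrite scalerDl scalerA.
move=> [f sf ->] [g sg ->]; exists (fun t => a *: f t + g t) => [t|].
  exact: IH.
rewrite scaler_sumr -big_split; apply: eq_bigr => t _.
by rewrite mulrDl scalerAl.
Qed.

Lemma span_words0 j : span_words j 0.
Proof.
elim: j => [|j IH]; first by exists 0; rewrite scale0r.
by exists (fun=> 0) => //; rewrite big1 // => t _; rewrite mul0r.
Qed.

Lemma span_wordsZ j a u : span_words j u -> span_words j (a *: u).
Proof. by move=> su; rewrite -[_ *: _]addr0; apply/span_words_lin/span_words0. Qed.

Lemma span_words_sum j (r : seq nat) (f : nat -> A) :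
  (forall t, t \in r -> span_words j (f t)) -> span_words j (\sum_(t <- r) f t).
Proof.
elim: r => [|t r IH] sf; first by rewrite big_nil; apply: span_words0.
rewrite big_cons -[f t]scale1r; apply: span_words_lin.
  by apply: sf; rewrite mem_head.
by apply: IH => s sr; apply: sf; rewrite in_cons sr orbT.
Qed.

Lemma span_words_blk j t u : (t <= j)%N -> span_words j u ->
  span_words j.+1 (u * wprod (blk j t)).
Proof.
move=> tj su; exists (fun s => if s == t then u else 0) => [s|].
  by case: ifP => // _; apply: span_words0.
rewrite (bigD1_seq t) ?mem_index_iota ?iota_uniq //= eqxx big1 ?addr0 // => s.
by move=> /negbTE ->; rewrite mul0r.
Qed.

Lemma wprod_comm w k : (0 < k < N)%N ->
  (forall i, i \in w -> (0 < i < N)%N /\ ((k.+1 < i) || (i.+1 < k))%N) ->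
  wprod w * E k = E k * wprod w.
Proof.
move=> rk; elim: w => [|i w IH] ew; first by rewrite /wprod big_nil mulr1 mul1r.
rewrite /wprod big_cons -/(wprod w) -mulrA IH => [|j jw]; last first.
  by apply: ew; rewrite in_cons jw orbT.
have [ri /orP[ki|ik]] := ew i (mem_head _ _); rewrite !mulrA; congr (_ * _).
  by apply/esym/E_comm; move: rk ri ki; clear; lia.
by apply: E_comm; move: rk ri ik; clear; lia.
Qed.

Lemma mem_blk i t k : (t <= i)%N -> k \in blk i t -> (i - t < k <= i)%N.
Proof. by move=> ti /mapP[s]; rewrite mem_iota => rs ->; lia. Qed.

Lemma span_words_mul j k u : (j <= N)%N -> (0 < k < j)%N ->
  span_words j u -> span_words j (u * E k).
Proof.
elim: j k u => [|j IH] k u jN rk; first by lia.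
move=> [f sf' ->]; have {sf'}sf t : span_words j (f t) := sf' t.
rewrite mulr_suml; apply: span_words_sum => t.
rewrite mem_index_iota => /andP[_ tj]; rewrite -mulrA.
have IHw w v : (forall i, i \in w -> (0 < i < j)%N) -> span_words j v ->
    span_words j (v * wprod w).
  elim: w v => [|i w IHw] v gw sv; first by rewrite /wprod big_nil mulr1.
  rewrite /wprod big_cons mulrA; apply: IHw => [l lw|].
    by apply: gw; rewrite in_cons lw orbT.
  apply: IH => //; first exact: ltnW.
  by apply: gw; rewrite mem_head.
have c1 m : wprod [:: m] = E m := wprod1 m.
case: (ltngtP k (j - t)) => kt.
(* The letter is at distance at least two from the whole block and passes to its left. *)
- rewrite wprod_comm; [|by move: rk jN; clear; lia|].
    rewrite mulrA; apply: span_words_blk => //; apply: IH => //; first exact: ltnW.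
    by move: rk kt; clear; lia.
  by move=> i /mem_blk; move: tj kt rk jN; clear; lia.
- case: (eqVneq k (j - t).+1) => k1.
    have e : t = (t.-1 + 1)%N by move: kt rk tj; clear; lia.
    have e' : (j - t.-1)%N = k by move: kt rk tj k1; clear; lia.
    have -> : wprod (blk j t) * E k = x k *: wprod (blk j t).
      rewrite e blk_cat wprod_cat e' /blk /= subn0 c1 -mulrA E_sq; last first.
        by move: rk jN; clear; lia.
      by rewrite scalerAr.
    rewrite -scalerAr; apply: span_wordsZ; exact: span_words_blk.
  (* After [s] letters the block reads [k], [k - 1], then [w]. The new [k] crosses [w] and the braid
     relation leaves a single [k]; the letters of [w] lie below [k - 1], so [w] moves to the front,
     where the induction hypothesis absorbs it. *)
  pose s := (j - k)%N.
  have e : t = (s + (1 + (1 + (t - s.+2))))%N.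
    by rewrite /s; move: kt rk tj k1; clear; lia.
  have k0 : (j - s)%N = k by rewrite /s; move: rk; clear; lia.
  set r := (t - s.+2)%N in e.
  pose w := blk k.-2 r.
  have k3 : (k - 1 - 1)%N = k.-2 by clear; lia.
  have k2 : (1 < k)%N by move: kt rk tj k1; clear; lia.
  have rk2 : (r <= k.-2)%N by rewrite /r /s; move: kt rk tj k1; clear; lia.
  have mw i : i \in w -> (0 < i)%N /\ (i.+1 < k)%N.
    by move=> /(mem_blk rk2); move: k2; clear; lia.
  have ek : E k * E (k - 1)%N * E k = y k.-1 *: E k.
    have := @E_braid k.-1; rewrite subn1 prednK; last by move: rk; clear; lia.
    by apply; move: k2 rk jN; clear; lia.
  have -> : wprod (blk j t) * E k = y k.-1 *: (wprod w * wprod (blk j s.+1)).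
    have -> : wprod (blk j t) = wprod (blk j s) * E k * E (k - 1)%N * wprod w.
      by rewrite e !blk_cat k0 k3 !wprod_cat /blk /= !subn0 !c1 !mulrA.
    rewrite -!mulrA wprod_comm; [|by move: rk jN; clear; lia|]; last first.
      by move=> i /mw; move: rk jN; clear; lia.
    rewrite [E (k - 1)%N * _]mulrA [E k * _]mulrA [E k * (_ * _)]mulrA ek.
    rewrite -scalerAl -scalerAr; congr (_ *: _).
    rewrite blk_rec -cats1 wprod_cat k0 c1 mulrA.
    have cw v : (forall i, i \in v -> (k <= i < N)%N) -> wprod v * wprod w = wprod w * wprod v.
      elim: v => [|i v IHv] gv; first by rewrite /wprod big_nil mul1r mulr1.
      rewrite /wprod big_cons -!/(wprod _) -mulrA IHv => [|l lv]; last first.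
        by apply: gv; rewrite in_cons lv orbT.
      rewrite !mulrA; congr (_ * _); apply/esym/wprod_comm.
        by have := gv i (mem_head _ _); move: rk; clear; lia.
      move=> l /mw; have := gv i (mem_head _ _); move: rk jN; clear; lia.
    have cw' := cw (blk j s ++ [:: k]); rewrite wprod_cat c1 in cw'.
    rewrite mulrA cw' ?mulrA // => i; rewrite mem_cat inE => /orP[|/eqP ->].
      move/mem_blk; rewrite k0; have sj : (s <= j)%N by apply: leq_subr.
      by move=> /(_ sj); move: jN; clear; lia.
    by move: rk jN; clear; lia.
  rewrite -scalerAr mulrA; apply: span_wordsZ; apply: span_words_blk.
    by rewrite /s; move: rk; clear; lia.
  by apply: IHw (sf t) => i /mw; move: rk; clear; lia.
- have -> : wprod (blk j t) * E k = wprod (blk j t.+1).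
    by rewrite blk_rec -cats1 wprod_cat wprod1 kt.
  by apply: span_words_blk => //; move: rk kt; clear; lia.
Qed.

Lemma span_words1 j : span_words j 1.
Proof.
elim: j => [|j IH]; first by exists 1; rewrite scale1r.
by have := @span_words_blk j 0 1 isT IH; rewrite /blk /= /wprod big_nil mulr1.
Qed.

Lemma span_words_ind (Q : A -> Prop) j u z :
  Q 0 -> (forall a v w, Q v -> Q w -> Q (a *: v + w)) ->
  (forall c, (forall i, (c i <= i)%N) -> Q (wprod (code_word c j) * z)) ->
  span_words j u -> Q (u * z).
Proof.
move=> Q0 QL; elim: j u z => [|j IH] u z Qc.
  move=> [a ->]; rewrite -scalerAl mul1r -[_ *: _]addr0; apply: QL => //.
  by have := Qc (fun=> 0) (fun=> isT); rewrite /wprod big_nil mul1r.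
move=> [f sf ->]; rewrite mulr_suml.
have Qsum (r : seq nat) (g : nat -> A) : (forall t, t \in r -> Q (g t)) ->
    Q (\sum_(t <- r) g t).
  elim: r => [|t r IHr] Qg; first by rewrite big_nil.
  rewrite big_cons -[g t]scale1r; apply: QL; first by apply: Qg; rewrite mem_head.
  by apply: IHr => s sr; apply: Qg; rewrite in_cons sr orbT.
apply: Qsum => t; rewrite mem_index_iota => /andP[_ tj]; rewrite -mulrA.
apply: IH (sf t) => c cP.
pose c' i := if i == j then t else c i.
have := Qc c'; rewrite code_word_rec wprod_cat -mulrA /c' eqxx.
rewrite (@eq_code_word _ c); first by apply=> i; case: eqP => [->|].
by move=> i ij; rewrite ifN //; move: ij; clear; lia.
Qed.

End Span.

Section OkadaSpan.
Variables (K : fieldType) (n : nat).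
Local Notation N := n.+1.
Variables (X : n.-tuple K) (Y : n.-1.-tuple K).
Local Notation A := (@okada_algebra K N X Y).
Local Notation E := (@okada_gen K N X Y).
Local Notation cl := (\pi_A)%qT.

Definition xval (k : nat) : K := nth 0 X k.-1.
Definition yval (k : nat) : K := nth 0 Y k.-1.

Lemma okada_mulE (s t : oexpr K N) : cl s * cl t = cl (OMul s t) :> A.
Proof. exact: omulE. Qed.

Lemma okada_addE (s t : oexpr K N) : cl s + cl t = cl (OAdd s t) :> A.
Proof. exact: oaddE. Qed.

Lemma okada_scalE (a : K) : cl (OScal N a) = a%:A :> A.
Proof.
by rewrite /GRing.scale /= /oscale -[RHS]/(cl (OScal N a) * 1) mulr1.
Qed.

Lemma okada_scaleE a (s : oexpr K N) : a *: cl s = cl (OMul (OScal N a) s) :> A.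
Proof. by rewrite -okada_mulE okada_scalE -scalerAl mul1r. Qed.

Lemma okada_genE (i : 'I_n) : E i.+1 = cl (OGen K (i : 'I_N.-1)).
Proof. by rewrite /okada_gen /= valK. Qed.

Lemma okada_gen_sq k : (0 < k < N)%N -> E k * E k = xval k *: E k.
Proof.
move=> rk; have l : (k.-1 < n)%N by lia.
have -> : k = (Ordinal l).+1 by rewrite /=; lia.
rewrite okada_genE okada_mulE okada_scaleE /xval /= -(tnth_nth 0 X (Ordinal l)).
exact/okada_eqP/oc_sq.
Qed.

Lemma okada_gen_comm i j : (0 < i)%N -> (i.+1 < j < N)%N -> E i * E j = E j * E i.
Proof.
move=> i0 rj; have li : (i.-1 < n)%N by lia.
have lj : (j.-1 < n)%N by lia.
have -> : i = (Ordinal li).+1 by rewrite /=; lia.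
have -> : j = (Ordinal lj).+1 by rewrite /=; lia.
rewrite !okada_genE !okada_mulE; apply/okada_eqP/oc_comm.
by rewrite /=; lia.
Qed.

Lemma okada_gen_braid k : (0 < k)%N -> (k.+1 < N)%N -> E k.+1 * E k * E k.+1 = yval k *: E k.+1.
Proof.
move=> k0 kN; have li : (k.-1 < n)%N by lia.
have lj : (k < n)%N by lia.
have ly : (k.-1 < n.-1)%N by lia.
have e : k = (Ordinal li).+1 by rewrite /=; lia.
have -> : E k.+1 = cl (OGen K (Ordinal lj : 'I_N.-1)) by rewrite -okada_genE.
have -> : E k = cl (OGen K (Ordinal li : 'I_N.-1)) by rewrite {1}e okada_genE.
rewrite !okada_mulE okada_scaleE /yval -(tnth_nth 0 Y (Ordinal ly)).
by apply/okada_eqP/oc_braid => //=; lia.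
Qed.

Lemma wprod_basis (s : 'S_N) : @okada_basis K N X Y s = wprod E (code_word (code_of s) N).
Proof. by rewrite /okada_basis perm_wordE. Qed.

Lemma okada_basis_ind (Q : A -> Prop) :
  Q 0 -> (forall a v w, Q v -> Q w -> Q (a *: v + w)) ->
  (forall s : 'S_N, Q (@okada_basis K N X Y s)) -> forall u, Q u.
Proof.
move=> Q0 QL Qs u; rewrite -[u]mulr1.
have st : span_words E N u.
  rewrite -[u]mul1r; elim/quotW: u => e.
  (* Any [v] in the span replaces 1, which makes the product case immediate: multiply by [s], then
     by [t]. *)
  have : span_words E N (1 : A) by apply: span_words1.
  elim: e (1 : A) => [a|i|s IHs t IHt|s IHs t IHt] v sv.
  - by rewrite okada_scalE -scalerAr mulr1; apply: span_wordsZ.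
  - rewrite -okada_genE; apply: (span_words_mul okada_gen_sq okada_gen_comm okada_gen_braid) => //.
    by have := ltn_ord i; rewrite /=; lia.
  - rewrite -okada_addE mulrDr -[v * cl s]scale1r.
    by apply: span_words_lin; [apply: IHs|apply: IHt].
  - by rewrite -okada_mulE mulrA; apply/IHt/IHs.
apply: span_words_ind st => // c cP.
have [s es] := @code_of_surj N c cP.
by rewrite mulr1 -(eq_code_word es) -wprod_basis.
Qed.

End OkadaSpan.

(** * The diagram module *)

Section Ext.
Variables (n a : nat) (m m' h h' : nat -> nat).
Hypothesis la : (a.+1 < n)%N.
Hypothesis em : forall x, (x < n)%N -> m x = m' x.
Hypothesis eh : forall x, (x < n)%N -> h x = h' x.

Lemma rwm_ext x : (x < n)%N -> rwm a m x = rwm a m' x.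
Proof. by move=> lx; rewrite /rwm !em // ltnW. Qed.

Lemma rwl_ext l x : (x < n)%N -> rwl l a m h x = rwl l a m' h' x.
Proof. by move=> lx; rewrite /rwl !em ?eh // ltnW. Qed.

End Ext.

Section RwdRelations.
Variable n : nat.
Local Notation N := n.+1.
Variable D : diag N.
Hypothesis okD : is_okada D.

Lemma pl_rwd0 a : (a.+1 < N)%N -> pl (rwd D a) a = a.+1.
Proof. by move=> la; rewrite pl_rwd ?/rwl ?eqxx //; move: la; clear; lia. Qed.

Lemma pl_rwd1 a : (a.+1 < N)%N -> pl (rwd D a) a.+1 = a.+1.
Proof. by move=> la; rewrite pl_rwd ?/rwl ?eqxx ?orbT //; move: la; clear; lia. Qed.

Lemma pm_rwd0 a : (a.+1 < N)%N -> pm (rwd D a) a = a.+1.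
Proof. by move=> la; rewrite pm_rwd ?/rwm ?eqxx //; move: la; clear; lia. Qed.

Lemma rwd_idem a : (a.+1 < N)%N -> rwd (rwd D a) a = rwd D a.
Proof.
move=> la; have okR := rwd_okada okD la.
have l0 : (a < N.*2)%N by move: la; clear; lia.
have l1 : (a.+1 < N.*2)%N by move: la; clear; lia.
apply: diag_eqP => k lk.
  rewrite !pm_rwd // -[RHS]rwm_idem; apply: rwm_ext l1 _ _ lk.
  by move=> x lx; rewrite pm_rwd.
rewrite !pl_rwd // -[RHS](rwl_idem a.+1 a (pm D)); apply: rwl_ext l1 _ _ _ _ lk => x lx.
  by rewrite pm_rwd.
by rewrite pl_rwd.
Qed.

Lemma rwd_comm a b : (a.+1 < b)%N -> (b.+1 < N)%N ->
  rwd (rwd D a) b = rwd (rwd D b) a.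
Proof.
move=> ab bN; have la : (a.+1 < N)%N by move: ab bN; clear; lia.
have okA := rwd_okada okD la; have okB := rwd_okada okD bN.
have l0 : (a < N.*2)%N by move: la; clear; lia.
have l1 : (a.+1 < N.*2)%N by move: la; clear; lia.
have l2 : (b < N.*2)%N by move: bN; clear; lia.
have l3 : (b.+1 < N.*2)%N by move: bN; clear; lia.
have /okdP ok := okD.
have eA k : (k < N.*2)%N -> pm (rwd D a) k = rwm a (pm D) k by apply: pm_rwd.
have eB k : (k < N.*2)%N -> pm (rwd D b) k = rwm b (pm D) k by apply: pm_rwd.
have fA k : (k < N.*2)%N -> pl (rwd D a) k = rwl a.+1 a (pm D) (pl D) k by apply: pl_rwd.
have fB k : (k < N.*2)%N -> pl (rwd D b) k = rwl b.+1 b (pm D) (pl D) k by apply: pl_rwd.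
apply: diag_eqP => k lk.
  rewrite (pm_rwd okA bN lk) (pm_rwd okB la lk) (rwm_ext l3 eA lk) (rwm_ext l1 eB lk).
  exact: (rwm_comm ab l3 (okd_lt ok) (okd_inv ok) (okd_neq ok) lk).
rewrite (pl_rwd okA bN lk) (pl_rwd okB la lk) (rwl_ext l3 eA fA _ lk) (rwl_ext l1 eB fB _ lk).
exact: (rwl_comm ab l3 (okd_lt ok) (okd_inv ok) (okd_lab ok) (okd_neq ok) _ _ lk).
Qed.

Lemma rwd_braid a : (a.+2 < N)%N ->
  rwd (rwd (rwd D a.+1) a) a.+1 = rwd D a.+1.
Proof.
move=> la; have la' : (a.+1 < N)%N by apply: ltnW.
have okB := rwd_okada okD la; have okA := rwd_okada okB la'.
have l0 : (a < N.*2)%N by move: la; clear; lia.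
have l1 : (a.+1 < N.*2)%N by move: la; clear; lia.
have l2 : (a.+2 < N.*2)%N by move: la; clear; lia.
have /okdP ok := okB.
have eA k : (k < N.*2)%N -> pm (rwd (rwd D a.+1) a) k = rwm a (pm (rwd D a.+1)) k.
  by apply: pm_rwd.
have fA k : (k < N.*2)%N ->
    pl (rwd (rwd D a.+1) a) k = rwl a.+1 a (pm (rwd D a.+1)) (pl (rwd D a.+1)) k.
  by apply: pl_rwd.
apply: diag_eqP => k lk.
  rewrite pm_rwd // (rwm_ext l2 eA lk).
  exact: (rwm_braid ok la (pm_rwd0 la) (pl_rwd0 la) lk).
rewrite pl_rwd // (rwl_ext l2 eA fA _ lk).
exact: (rwl_braid ok la (pm_rwd0 la) (pl_rwd0 la) lk).
Qed.

End RwdRelations.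

Section Module.
Variables (K : fieldType) (n : nat).
Local Notation N := n.+1.
Variables (X : n.-tuple K) (Y : n.-1.-tuple K).
Local Notation A := (@okada_algebra K N X Y).
Local Notation E := (@okada_gen K N X Y).
Local Notation cl := (\pi_A)%qT.
Local Notation repr := generic_quotient.repr.

Definition dmod : lmodType K := {ffun diag N -> K^o}.

Definition delta (D : diag N) : dmod := [ffun C => (C == D)%:R].

Definition gcoef (a : nat) (D : diag N) : K :=
  coef (nth 0 X) (nth 0 Y) a (maxn (pl D a) (pl D a.+1)).

(** [diag N] also contains data that are no Okada diagrams; letting the generators kill them keeps
    the relations true on the whole space. *)
Definition gact (a : nat) (D : diag N) : dmod :=
  if is_okada D then gcoef a D *: delta (rwd D a) else 0.

Definition dext (g : diag N -> dmod) (v : dmod) : dmod := \sum_D (v D : K) *: g D.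

Lemma dext_lin g a u v : dext g (a *: u + v) = a *: dext g u + dext g v.
Proof.
rewrite scaler_sumr -big_split; apply: eq_bigr => D _.
by rewrite !ffunE scalerDl scalerA.
Qed.

Lemma dext_delta g D : dext g (delta D) = g D.
Proof.
rewrite /dext (bigD1 D) //= !ffunE eqxx scale1r big1 ?addr0 // => C /negbTE e.
by rewrite ffunE e scale0r.
Qed.

Lemma dmodE (v : dmod) : v = \sum_D (v D : K) *: delta D.
Proof.
apply/ffunP => C; rewrite sum_ffunE (bigD1 C) //= !ffunE eqxx big1 ?addr0.
  by rewrite /GRing.scale /= mulr1.
move=> D /negbTE e; rewrite !ffunE eq_sym e.
by rewrite /GRing.scale /= mulr0.
Qed.

Fixpoint act (s : oexpr K N) (v : dmod) : dmod :=
  match s with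
  | OScal a => a *: v
  | OGen i => dext (gact i) v
  | OAdd s t => act s v + act t v
  | OMul s t => act s (act t v)
  end.

Lemma act_lin s a u v : act s (a *: u + v) = a *: act s u + act s v.
Proof.
elim: s u v => [b|i|s IHs t IHt|s IHs t IHt] u v /=.
- by rewrite scalerDr !scalerA mulrC.
- exact: dext_lin.
- by rewrite IHs IHt scalerDr addrACA.
- by rewrite IHt IHs.
Qed.

Lemma act0 s : act s 0 = 0.
Proof.
by have := act_lin s (-1) 0 0; rewrite scaler0 addr0 scaleN1r addNr.
Qed.

Lemma actZ s a v : act s (a *: v) = a *: act s v.
Proof. by have := act_lin s a v 0; rewrite act0 !addr0. Qed.

Lemma actD s u v : act s (u + v) = act s u + act s v.
Proof. by have := act_lin s 1 u v; rewrite !scale1r. Qed.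

Lemma act_sum s v : act s v = \sum_D (v D : K) *: act s (delta D).
Proof.
rewrite {1}(dmodE v); elim/big_rec2: _ => [|D u w _ <-]; first exact: act0.
exact: act_lin.
Qed.

Lemma act_ext s t : (forall D, act s (delta D) = act t (delta D)) -> act s =1 act t.
Proof. by move=> e v; rewrite act_sum [RHS]act_sum; apply: eq_bigr => D _; rewrite e. Qed.

Lemma dext0 g : dext g 0 = 0.
Proof. by apply: big1 => D _; rewrite ffunE scale0r. Qed.

Lemma dextZ g a v : dext g (a *: v) = a *: dext g v.
Proof. by have := dext_lin g a v 0; rewrite dext0 !addr0. Qed.

Lemma gact_ok a D : is_okada D -> gact a D = gcoef a D *: delta (rwd D a).
Proof. by rewrite /gact => ->. Qed.

Lemma gact_not_ok a D : ~~ is_okada D -> gact a D = 0.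
Proof. by rewrite /gact => /negbTE ->. Qed.

Lemma gact2 a b D : is_okada D -> (b.+1 < N)%N ->
  dext (gact a) (gact b D) =
  (gcoef b D * gcoef a (rwd D b)) *: delta (rwd (rwd D b) a).
Proof.
move=> okD lb; rewrite (gact_ok b okD) dextZ dext_delta.
by rewrite (gact_ok a (rwd_okada okD lb)) scalerA.
Qed.

Lemma act_cong s t : @okada_cong K N X Y s t -> act s =1 act t.
Proof.
elim=> {s t}.
- by [].
- by move=> s t _ e v; rewrite e.
- by move=> t s u _ e1 _ e2 v; rewrite e1 e2.
- by move=> s s' t t' _ e1 _ e2 v /=; rewrite e1 e2.
- by move=> s s' t t' _ e1 _ e2 v /=; rewrite e1 e2.
- by move=> s t u v /=; rewrite addrA.
- by move=> s t v /=; rewrite addrC.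
- by move=> s v /=; rewrite scale0r add0r.
- by move=> s v /=; rewrite scaleN1r addNr scale0r.
- by move=> s t u v.
- by move=> s v /=; rewrite scale1r.
- by move=> s t u v.
- by move=> s t u v /=; rewrite actD.
- by move=> a b v /=; rewrite scalerDl.
- by move=> a b v /=; rewrite scalerA.
- by move=> a s v /=; rewrite actZ.
- move=> i; apply: act_ext => D /=; rewrite dext_delta.
  have li : (i.+1 < N)%N by rewrite ltnS.
  have [okD|nD] := boolP (is_okada D); last by rewrite (gact_not_ok i nD) dext0 scaler0.
  rewrite (gact2 i okD li) (gact_ok i okD) (rwd_idem okD li) scalerA mulrC.
  congr (_ * _ *: _); rewrite /gcoef pl_rwd0 // pl_rwd1 // maxnn coef_sq.
  by rewrite (tnth_nth 0).
- move=> i j; wlog ij : i j / (i.+1 < j)%N.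
    move=> H /orP[l|l]; first by apply: H; rewrite // l.
    by apply/fsym/H => //; rewrite l.
  move=> _; apply: act_ext => D /=; rewrite !dext_delta.
  have li : (i.+1 < N)%N by rewrite ltnS.
  have lj : (j.+1 < N)%N by rewrite ltnS.
  have [okD|nD] := boolP (is_okada D); last first.
    by rewrite (gact_not_ok i nD) (gact_not_ok j nD) !dext0.
  rewrite (gact2 i okD lj) (gact2 j okD li) (rwd_comm okD ij lj); congr (_ *: _).
  have l0 : (i < N.*2)%N by move: li; clear; lia.
  have l1 : (i.+1 < N.*2)%N by move: li; clear; lia.
  have l2 : (j < N.*2)%N by move: lj; clear; lia.
  have l3 : (j.+1 < N.*2)%N by move: lj; clear; lia.
  have /= e := coef_comm (nth 0 X) (nth 0 Y) (okdP _ okD) ij lj.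
  rewrite /gcoef (pl_rwd okD li l2) (pl_rwd okD li l3).
  by rewrite (pl_rwd okD lj l0) (pl_rwd okD lj l1) e.
- move=> i j k ej ek; apply: act_ext => D /=; rewrite dext_delta.
  have li : (i.+1 < N)%N by rewrite ltnS.
  have lj : (i.+2 < N)%N by rewrite -ej ltnS.
  have [okD|nD] := boolP (is_okada D); last first.
    by rewrite (gact_not_ok j nD) !dext0 scaler0.
  have okB := rwd_okada okD lj; have okA := rwd_okada okB li.
  rewrite ej (gact2 i okD lj) dextZ dext_delta (gact_ok _ okA) (gact_ok _ okD).
  rewrite (rwd_braid okD lj) !scalerA; congr (_ *: _).
  have l0 : (i < N.*2)%N by move: li; clear; lia.
  have bi : (pl (rwd D i.+1) i <= i.+1)%N.
    by have := okd_bnd (okdP _ okB) l0; rewrite /height; clear; lia.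
  (* After the first rewiring the label at [i.+1] is [i.+2], so the middle generator acts with
     coefficient 1. The last one meets labels of maximum [i.+1] and contributes the factor of the
     braid relation. *)
  have e1 : gcoef i (rwd D i.+1) = 1.
    rewrite /gcoef pl_rwd0 //.
    have -> : maxn (pl (rwd D i.+1) i) i.+2 = i.+2 by move: bi; clear; lia.
    exact: coef_red.
  have l2 : (i.+2 < N.*2)%N by move: lj; clear; lia.
  have hi : pl (rwd (rwd D i.+1) i) i.+1 = i.+1 by apply: pl_rwd1.
  have h2 : (pl (rwd (rwd D i.+1) i) i.+2 <= i.+1)%N.
    rewrite pl_rwd // /rwl pm_rwd0 // eqxx orbT ifN; last by clear; lia.
    by rewrite geq_min bi.
  have e3 : gcoef i.+1 (rwd (rwd D i.+1) i) = tnth Y k.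
    by rewrite /gcoef hi (maxn_idPl h2) coef_braid (tnth_nth 0) -ek.
  by rewrite e1 e3 mulr1 mulrC.
Qed.

Definition qact (u : A) : dmod -> dmod := act (repr u).

Lemma qactE s v : qact (cl s) v = act s v.
Proof. by apply: act_cong; apply: okada_repr. Qed.

Lemma qactM u w v : qact (u * w) v = qact u (qact w v).
Proof.
elim/quotW: u => s; elim/quotW: w => t.
by rewrite okada_mulE !qactE.
Qed.

Lemma qact_linl a u w v : qact (a *: u + w) v = a *: qact u v + qact w v.
Proof.
elim/quotW: u => s; elim/quotW: w => t.
by rewrite okada_scaleE okada_addE !qactE.
Qed.

Lemma qact_gen k v : (0 < k < N)%N -> qact (E k) v = dext (gact k.-1) v.
Proof.
move=> rk; have l : (k.-1 < n)%N by lia.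
have {1}-> : k = (Ordinal l).+1 by rewrite /=; lia.
by rewrite okada_genE qactE.
Qed.

Fixpoint wcoef (w : seq nat) (D : diag N) : K :=
  if w is k :: w' then wcoef w' D * gcoef k.-1 (wd w' D) else 1.

Lemma qact_word w D : gens n w -> is_okada D ->
  qact (wprod E w) (delta D) = wcoef w D *: delta (wd w D).
Proof.
move=> + okD; elim: w => [|k w IH] /= => [_|/andP[rk gw]].
  rewrite /wprod big_nil scale1r -[1]scale1r -[X in X *: 1]/(1 : K) -okada_scalE.
  by rewrite qactE /= scale1r.
rewrite /wprod big_cons -/(wprod E w) qactM IH // qact_gen // dextZ dext_delta.
by rewrite gact_ok ?wd_okada // scalerA.
Qed.

(** By [dweight_word] no letter can drop the weight by more than two, so each must; its larger label
    is then the one covered by [coef_red]. *)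
Lemma wcoef_reduced w D : gens n w -> is_okada D ->
  (dweight (wd w D) + (size w).*2 = dweight D)%N -> wcoef w D = 1.
Proof.
move=> + okD; elim: w => [|k w IH] //= /andP[rk gw] e.
have la : (k.-1.+1 < N)%N by lia.
have okW := wd_okada gw okD.
have e1 := dweight_rwd okW la; have e2 := maxn_lab okW la.
have e3 := dweight_word gw okD.
have -> : gcoef k.-1 (wd w D) = 1.
  rewrite /gcoef; have -> : maxn (pl (wd w D) k.-1) (pl (wd w D) k.-1.+1) = k.-1.+2.
    by move: e e1 e2 e3; clear; lia.
  exact: coef_red.
by rewrite mulr1 IH //; move: e e1 e2 e3; clear; lia.
Qed.

Definition phi (u : A) : dmod := qact u (delta (did N)).

Lemma phi_lin a u v : phi (a *: u + v) = a *: phi u + phi v.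
Proof. exact: qact_linl. Qed.

Lemma phi0 : phi 0 = 0.
Proof. by have := phi_lin (-1) 0 0; rewrite scaler0 addr0 scaleN1r addNr. Qed.

Lemma phi_sum (I : finType) (P : pred I) (c : I -> K) (u : I -> A) :
  phi (\sum_(i | P i) c i *: u i) = \sum_(i | P i) c i *: phi (u i).
Proof.
elim/big_rec2: _ => [|i v w _ <-]; first exact: phi0.
exact: phi_lin.
Qed.

Lemma perm_diagE (s : 'S_N) : perm_diag s = wd (code_word (code_of s) N) (did N).
Proof.
rewrite /perm_diag perm_wordE wdE ?did_okada //.
exact/gens_code_word/leqnn/code_of_le.
Qed.

Let gens_perm (s : 'S_N) : gens n (code_word (code_of s) N).
Proof. exact/gens_code_word/leqnn/code_of_le. Qed.

Lemma perm_diag_okada (s : 'S_N) : is_okada (perm_diag s).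
Proof. by rewrite perm_diagE wd_okada ?did_okada. Qed.

Lemma perm_diag_mirror (s : 'S_N) :
  mirror (perm_diag s) = wd (rev (code_word (code_of s) N)) (did N).
Proof. by rewrite perm_diagE wd_rev. Qed.

(** The count is available for the reversed word, whose diagram is the mirror image and has the same
    weight. *)
Lemma perm_diag_weight (s : 'S_N) :
  (dweight (perm_diag s) + (size (code_word (code_of s) N)).*2 = dweight (did N))%N.
Proof.
have [_ <-] := @code_idle n (code_of s) N (@code_of_le _ s) (leqnn _).
by rewrite -perm_diag_mirror dweight_mirror.
Qed.

Lemma phi_basis (s : 'S_N) : phi (@okada_basis K N X Y s) = delta (perm_diag s).
Proof.
rewrite wprod_basis /phi qact_word ?did_okada // -perm_diagE wcoef_reduced ?scale1r //.
  exact: did_okada.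
by rewrite -perm_diagE perm_diag_weight.
Qed.

Lemma perm_diag_inj : injective (@perm_diag N).
Proof.
move=> s t e; apply: perm_code_inj => i.
rewrite -!code_ofE; apply: (@code_word_inj n _ _ N) => // [j|j|x lx].
- exact: code_of_le.
- exact: code_of_le.
- by rewrite -!perm_diag_mirror e.
Qed.

Lemma okada_basis_span (u : A) :
  exists c : 'S_N -> K, u = \sum_s c s *: @okada_basis K N X Y s.
Proof.
move: u; apply: okada_basis_ind.
- by exists (fun=> 0); rewrite big1 // => s _; rewrite scale0r.
- move=> a _ _ [c ->] [d ->]; exists (fun s => a * c s + d s).
  rewrite scaler_sumr -big_split; apply: eq_bigr => s _.
  by rewrite scalerDl scalerA.
move=> s; exists (fun t => (t == s)%:R).
rewrite (bigD1 s) //= eqxx scale1r big1 ?addr0 // => t /negbTE ->.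
by rewrite scale0r.
Qed.

(** The $E_s$ span the algebra and go to distinct basis vectors of the module. *)
Lemma phi_inj : injective phi.
Proof.
suff H u : phi u = 0 -> u = 0.
  move=> u v e; apply/eqP; rewrite -subr_eq0; apply/eqP/H.
  by rewrite addrC -[- v]scaleN1r phi_lin scaleN1r e addNr.
have [c ->] := okada_basis_span u; rewrite phi_sum => e.
apply: big1 => s _; have := congr1 (fun v : dmod => v (perm_diag s)) e.
rewrite /= sum_ffunE (bigD1 s) //= phi_basis !ffunE eqxx big1 ?addr0.
  move=> h; have -> : c s = 0 by move: h; rewrite /GRing.scale /= mulr1.
  by rewrite scale0r.
move=> t ts; rewrite phi_basis !ffunE (inj_eq perm_diag_inj) eq_sym (negbTE ts).
by rewrite /GRing.scale /= mulr0.
Qed.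

(** A reduced word for [D] is sent to the basis vector of [D]. Being a combination of the $E_s$, it
    is also sent to a combination of the vectors of the $D_s$, one of which must be [D]. *)
Lemma perm_diag_surj (D : diag N) : is_okada D -> exists s : 'S_N, perm_diag s = D.
Proof.
move=> okD; have [w [gw ew sw]] := okada_word okD.
have : phi (wprod E w) = delta D.
  rewrite /phi qact_word ?did_okada // ew wcoef_reduced ?scale1r ?did_okada //.
  by rewrite ew.
have [c ->] := okada_basis_span (wprod E w); rewrite phi_sum => e.
have := congr1 (fun v : dmod => v D) e.
rewrite /= sum_ffunE !ffunE eqxx => eD.
have /existsP[s /eqP es] : [exists s, perm_diag s == D].
  apply: contraT => /existsPn no; move/eqP: eD; rewrite big1 ?(eq_sym 0) ?oner_eq0 // => s _.
  by rewrite phi_basis !ffunE eq_sym (negbTE (no s)) /GRing.scale /= mulr0.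
by exists s.
Qed.

Lemma phi_diag_elt (D : diag N) : is_okada D -> phi (@diag_elt K N X Y D) = delta D.
Proof.
move=> okD; rewrite /diag_elt; case: pickP => [s /eqP <-|no]; first exact: phi_basis.
by have [s /eqP] := perm_diag_surj okD; rewrite no.
Qed.

Lemma diag_elt_perm (s : 'S_N) : @diag_elt K N X Y (perm_diag s) = @okada_basis K N X Y s.
Proof. by apply: phi_inj; rewrite phi_basis phi_diag_elt ?perm_diag_okada. Qed.

Lemma gen_diag_elt k (D : diag N) : (0 < k < N)%N -> is_okada D ->
  E k * @diag_elt K N X Y D = gcoef k.-1 D *: @diag_elt K N X Y (rwd D k.-1).
Proof.
move=> rk okD; have la : (k.-1.+1 < N)%N by lia.
apply: phi_inj; rewrite -[_ *: _]addr0 phi_lin phi0 addr0.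
rewrite (phi_diag_elt (rwd_okada okD la)) /phi qactM -/(phi _) phi_diag_elt //.
by rewrite qact_gen // dext_delta gact_ok.
Qed.

End Module.

(** * The involution *)

Section Star.
Variables (K : fieldType) (n : nat).
Local Notation N := n.+1.
Variables (X : n.-tuple K) (Y : n.-1.-tuple K).
Local Notation A := (@okada_algebra K N X Y).
Local Notation E := (@okada_gen K N X Y).
Local Notation cl := (\pi_A)%qT.
Local Notation repr := generic_quotient.repr.

Fixpoint oexpr_rev (s : oexpr K N) : oexpr K N :=
  match s with
  | OScal a => OScal N a
  | OGen i => OGen K i
  | OAdd s t => OAdd (oexpr_rev s) (oexpr_rev t)
  | OMul s t => OMul (oexpr_rev t) (oexpr_rev s)
  end.

Lemma oexpr_revK : involutive oexpr_rev.
Proof. by elim=> //= s -> t ->. Qed.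

Let mulCl a s : @okada_cong K N X Y (OMul s (OScal N a)) (OMul (OScal N a) s).
Proof. exact/oc_sym/oc_scalC. Qed.

(** The square and braid relations are palindromic up to central scalars, and the commutation
    relation is symmetric. *)
Lemma oexpr_rev_cong s t : @okada_cong K N X Y s t ->
  @okada_cong K N X Y (oexpr_rev s) (oexpr_rev t).
Proof.
elim=> {s t} /=.
- by move=> s; apply: oc_refl.
- by move=> s t _; apply: oc_sym.
- by move=> t s u _ h1 _; apply: oc_trans.
- by move=> s s' t t' _ h1 _ h2; apply: oc_addE.
- by move=> s s' t t' _ h1 _ h2; apply: oc_mulE.
- by move=> s t u; apply: oc_addA.
- by move=> s t; apply: oc_addC.
- by move=> s; apply: oc_add0.
- move=> s; apply: oc_trans; last exact: (oc_addN _ _ (oexpr_rev s)).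
  by apply: oc_addE; [apply: mulCl|apply: oc_refl].
- by move=> s t u; apply/oc_sym/oc_mulA.
- by move=> s; apply: oc_trans; [apply: mulCl|apply: oc_mul1].
- by move=> s t u; apply: oc_mulDr.
- by move=> s t u; apply: oc_mulDl.
- by move=> a b; apply: oc_scalD.
- by move=> a b; apply: oc_trans; [apply: oc_scalM|apply: mulCl].
- by move=> a s; apply: mulCl.
- by move=> i; apply: oc_trans; [apply: oc_sq|apply: oc_scalC].
- by move=> i j h; apply/oc_sym/oc_comm.
- move=> i j k ej ek; apply: oc_trans; first exact: oc_mulA.
  apply: oc_trans. exact: (@oc_braid K N X Y i j k ej ek).  exact: oc_scalC.
Qed.

Definition ostar (u : A) : A := cl (oexpr_rev (repr u)).

Lemma ostarE s : ostar (cl s) = cl (oexpr_rev s).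
Proof. exact/okada_eqP/oexpr_rev_cong/okada_repr. Qed.

Lemma ostar_linear : linear ostar.
Proof.
move=> a; elim/quotW=> s; elim/quotW=> t.
rewrite (okada_scaleE _ _ a s) okada_addE (ostarE (OAdd _ _)) (ostarE s) (ostarE t) okada_scaleE okada_addE.
by apply/okada_eqP/oc_addE; [apply: mulCl|apply: oc_refl].
Qed.

HB.instance Definition _ :=
  GRing.isLinear.Build K A A _ ostar ostar_linear.

Lemma ostarM u v : ostar (u * v) = ostar v * ostar u.
Proof.
elim/quotW: u => s; elim/quotW: v => t.
by rewrite okada_mulE (ostarE (OMul _ _)) (ostarE s) (ostarE t) okada_mulE.
Qed.

Lemma ostarK : involutive ostar.
Proof. by elim/quotW=> s; rewrite (ostarE s) (ostarE (oexpr_rev s)) oexpr_revK. Qed.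

Lemma ostar1 : ostar 1 = 1.
Proof. by rewrite -[1]scale1r -okada_scalE (ostarE (OScal N 1)). Qed.

Lemma ostar_gen k : (0 < k < N)%N -> ostar (E k) = E k.
Proof.
move=> rk; have l : (k.-1 < n)%N by lia.
have -> : k = (Ordinal l).+1 by rewrite /=; lia.
by rewrite okada_genE ostarE.
Qed.

Lemma ostar_wprod w : gens n w -> ostar (wprod E w) = wprod E (rev w).
Proof.
elim: w => [|k w IH] /= => [_|/andP[rk gw]]; first by rewrite /wprod !big_nil ostar1.
rewrite rev_cons -cats1 wprod_cat wprod1 -IH //.
have -> : wprod E (k :: w) = E k * wprod E w by rewrite /wprod big_cons.
by rewrite ostarM ostar_gen.
Qed.

(** The reversed word is again reduced, as mirroring preserves the weight, so it yields the mirror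
    image with coefficient 1. *)
Lemma ostar_diag_elt (D : diag N) : is_okada D ->
  ostar (@diag_elt K N X Y D) = @diag_elt K N X Y (mirror D).
Proof.
move=> okD; have [s es] := perm_diag_surj X Y okD.
have gs : gens n (code_word (code_of s) N).
  exact/gens_code_word/leqnn/code_of_le.
have gr : gens n (rev (code_word (code_of s) N)) by rewrite /gens all_rev.
rewrite -es diag_elt_perm wprod_basis ostar_wprod //; apply: phi_inj.
rewrite phi_diag_elt ?mirror_okada ?perm_diag_okada // perm_diag_mirror.
rewrite /phi qact_word ?did_okada // wcoef_reduced ?scale1r ?did_okada //.
by rewrite -perm_diag_mirror dweight_mirror size_rev perm_diag_weight.
Qed.

End Star.

(** * The cell datum *)

Section CellGeneric.
Variables (K : fieldType) (A : algType K) (Lam : finType) (le : rel Lam).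
Variables (M : Lam -> finType) (C : forall l : Lam, M l -> M l -> A).
Hypothesis le_anti : antisymmetric le.
Hypothesis le_trans : transitive le.

Local Notation lower := (@in_lower_span K A Lam le M C).
Local Notation elt := (@cell_elt K A Lam M C).

Lemma lower_lin l a u v : lower l u -> lower l v -> lower l (a *: u + v).
Proof.
move=> [c ->] [e ->]; exists (fun i => a * c i + e i).
rewrite scaler_sumr -big_split; apply: eq_bigr => i _.
by rewrite scalerDl scalerA.
Qed.

Lemma lower0 l : lower l 0.
Proof. by exists (fun=> 0); rewrite big1 // => i _; rewrite scale0r. Qed.

Lemma lowerD l u v : lower l u -> lower l v -> lower l (u + v).
Proof. by move=> lu lv; rewrite -[u]scale1r; apply: lower_lin. Qed.

Lemma lowerZ l a u : lower l u -> lower l (a *: u).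
Proof. by move=> lu; rewrite -[_ *: _]addr0; apply/lower_lin/lower0. Qed.

Lemma lower_sum l (I : finType) (P : pred I) (f : I -> A) :
  (forall i, P i -> lower l (f i)) -> lower l (\sum_(i | P i) f i).
Proof.
move=> lf; elim/big_rec: _ => [|i u Pi lu]; first exact: lower0.
exact/lowerD/lu/lf.
Qed.

Lemma lower_elt l i : le (tag i) l -> tag i != l -> lower l (elt i).
Proof.
move=> li ni; exists (fun j => (j == i)%:R).
rewrite (bigD1 i) ?li //= eqxx scale1r big1 ?addr0 // => j /andP[_ /negbTE ->].
by rewrite scale0r.
Qed.

Lemma lower_mono l m v : le m l -> m != l -> lower m v -> lower l v.
Proof.
move=> ml nm [c ->]; apply: lower_sum => i /andP[im ni]; apply/lowerZ/lower_elt.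
  exact: le_trans im ml.
apply: contraNneq nm => e; apply/eqP/le_anti; rewrite ml /=.
by rewrite -e im.
Qed.

(** The multiplication axiom for a single element, so that it can pass from scalars and generators
    to all expressions. *)
Definition cell_mult (a : A) : Prop := forall l : Lam, exists r : M l -> M l -> K,
  forall L R : M l, lower l (a * C L R - \sum_(L' : M l) r L' L *: C L' R).

Lemma cell_mult_lower a l v : cell_mult a -> lower l v -> lower l (a * v).
Proof.
move=> ca [c ->]; rewrite mulr_sumr; apply: lower_sum => -[m [P Q]] /= /andP[ml nm].
rewrite -scalerAr; apply: lowerZ; have [r hr] := ca m.
rewrite -[_ * _](subrK (\sum_(L' : M m) r L' P *: C L' Q)); apply: lowerD.
  exact: lower_mono (hr P Q).
apply: lower_sum => L' _; apply: lowerZ.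
exact: (@lower_elt l (Tagged (fun l => (M l * M l)%type) (L', Q))).
Qed.

Lemma cell_mult_scal a : cell_mult a%:A.
Proof.
move=> l; exists (fun L' L => if L' == L then a else 0) => L R.
rewrite (bigD1 L) //= eqxx big1 => [|L' /negbTE ->]; last by rewrite scale0r.
by rewrite addr0 -scalerAl mul1r subrr; apply: lower0.
Qed.

Lemma cell_multD a b : cell_mult a -> cell_mult b -> cell_mult (a + b).
Proof.
move=> ca cb l; have [r hr] := ca l; have [s hs] := cb l.
exists (fun L' L => r L' L + s L' L) => L R.
under eq_bigr do rewrite scalerDl.
by rewrite big_split mulrDl opprD addrACA; apply: lowerD.
Qed.

(** The matrices of structure constants multiply; the lower terms left by [b] stay lower under [a]
    by [cell_mult_lower]. *)
Lemma cell_multM a b : cell_mult a -> cell_mult b -> cell_mult (a * b).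
Proof.
move=> ca cb l; have [r hr] := ca l; have [s hs] := cb l.
exists (fun L' L => \sum_L'' r L' L'' * s L'' L) => L R.
have -> : a * b * C L R - \sum_L' (\sum_L'' r L' L'' * s L'' L) *: C L' R =
    a * (b * C L R - \sum_L' s L' L *: C L' R) +
    \sum_L' s L' L *: (a * C L' R - \sum_L'' r L'' L' *: C L'' R).
  under [X in _ = _ + X]eq_bigr do rewrite scalerBr.
  rewrite sumrB mulrBr mulrA mulr_sumr.
  under [X in _ = _ - X + _]eq_bigr do rewrite -scalerAr.
  rewrite addrA subrK; congr (_ - _).
  under eq_bigr do rewrite scaler_suml.
  rewrite exchange_big; apply: eq_bigr => L' _; rewrite scaler_sumr.
  by apply: eq_bigr => L'' _; rewrite scalerA mulrC.
apply: lowerD; first exact/cell_mult_lower/hs.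
by apply: lower_sum => L' _; apply/lowerZ/hr.
Qed.

End CellGeneric.

Section OkadaCell.
Variables (K : fieldType) (n : nat).
Local Notation N := n.+1.
Variables (X : n.-tuple K) (Y : n.-1.-tuple K).
Local Notation A := (@okada_algebra K N X Y).
Local Notation E := (@okada_gen K N X Y).
Local Notation cl := (\pi_A)%qT.
Local Notation index := (@cell_index (yfs N) (@half_with N)).
Local Notation C := (@okada_cell K N X Y).

Definition cell_diag (i : index) : diag N :=
  join (val (tagged i).1) (val (tagged i).2).

Lemma cell_eltE (i : index) : cell_elt C i = @diag_elt K N X Y (cell_diag i).
Proof. by []. Qed.

Lemma join_cell (S : yfs N) (L R : half_with S) :
  [/\ is_okada (join (val L) (val R)), lhalf (join (val L) (val R)) = val L &
      rhalf (join (val L) (val R)) = val R].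
Proof.
have /andP[hL /eqP pL] := valP L; have /andP[hR /eqP pR] := valP R.
by apply: join_halvesP; rewrite // pL pR.
Qed.

Lemma cell_diag_okada i : is_okada (cell_diag i).
Proof. by case: (join_cell (tagged i).1 (tagged i).2). Qed.

Lemma cell_diag_inj : injective cell_diag.
Proof.
move=> [S [L R]] [S' [L' R']]; rewrite /cell_diag /= => e.
have [_ l r] := join_cell L R; have [_ l' r'] := join_cell L' R'.
have eS : S = S'.
  apply: val_inj; have /andP[_ /eqP <-] := valP L; have /andP[_ /eqP <-] := valP L'.
  by rewrite -l -l' e.
subst S'; have -> : L = L' by apply: val_inj; rewrite -l -l' e.
by have -> : R = R' by apply: val_inj; rewrite -r -r' e.
Qed.

Lemma cell_diag_surj (D : diag N) : is_okada D ->
  exists2 i : index, cell_diag i = D & val (tag i) = plab (lhalf D).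
Proof.
move=> okD; pose S : yfs N := Sub (plab (lhalf D)) (plab_yfs okD).
have hL : is_half (lhalf D) && (plab (lhalf D) == val S) by rewrite lhalf_half /=.
have hR : is_half (rhalf D) && (plab (rhalf D) == val S).
  by rewrite rhalf_half ?plab_rhalf /=.
exists (Tagged (fun S => (half_with S * half_with S)%type)
   (Sub (lhalf D) hL : half_with S, Sub (rhalf D) hR : half_with S)) => //.
exact: join_halves.
Qed.

Lemma gen_cell_mult k : (0 < k < N)%N ->
  cell_mult (@dominance N) C (E k : A).
Proof.
move=> rk S; set a := k.-1; have la : (a.+1 < N)%N by rewrite /a; lia.
(* The join of [L] with itself represents all diagrams with left half [L]: the coefficient and the
   left half of the product depend on that half alone, so the scalars do not see [R]. *)
exists (fun L' L : half_with S =>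
  if val L' == lhalf (rwd (join (val L) (val L)) a)
  then gcoef X Y a (join (val L) (val L)) else 0) => L R.
have [okD lD rD] := join_cell L R; have [okD0 lD0 _] := join_cell L L.
set D := join (val L) (val R) in okD lD rD *.
set D0 := join (val L) (val L) in okD0 lD0 *.
have el : lhalf D = lhalf D0 by rewrite lD lD0.
have eg : gcoef X Y a D0 = gcoef X Y a D.
  by rewrite /gcoef -!ql_lhalf ?el // ltnW.
rewrite -(lhalf_rwd okD okD0 la el) eg.
have -> : E k * C L R = gcoef X Y a D *: @diag_elt K N X Y (rwd D a).
  exact: gen_diag_elt.
have okR := rwd_okada okD la; have pS : plab (lhalf D) = val S.
  by rewrite lD; have /andP[_ /eqP] := valP L.
(* If the propagating labels are unchanged, the right half is still [R] and one cell element
   remains. Otherwise no [L'] contributes and the product is strictly lower by [count_ge_rwd]. *)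
case: (eqVneq (plab (lhalf (rwd D a))) (val S)) => [e|ne].
  have hL : is_half (lhalf (rwd D a)) && (plab (lhalf (rwd D a)) == val S).
    by rewrite lhalf_half // e eqxx.
  pose L1 : half_with S := Sub (lhalf (rwd D a)) hL.
  rewrite (bigD1 L1) //= eqxx big1 ?addr0 => [|L' nL']; last first.
    by rewrite ifN ?scale0r // -[lhalf _]/(val L1) (inj_eq val_inj).
  have -> : C L1 R = @diag_elt K N X Y (rwd D a).
    rewrite /okada_cell /= -rD -(rhalf_rwd okD la) ?pS //.
    by rewrite join_halves.
  by rewrite subrr; apply: lower0.
rewrite big1 ?subr0 => [|L' _]; last first.
  rewrite ifN ?scale0r //; apply: contraNneq ne => <-.
  by have /andP[_] := valP L'.
have [i ei ti] := cell_diag_surj okR.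
apply: lowerZ; rewrite -ei -cell_eltE; apply: lower_elt.
  by apply/dominanceP => t; rewrite ti -pS; apply: count_ge_rwd.
by rewrite -(inj_eq val_inj) ti.
Qed.

Lemma okada_cell_mult (u : A) : cell_mult (@dominance N) C u.
Proof.
have anti := @dominance_anti N; have trans := @dominance_trans N.
elim/quotW: u; elim=> [a|i|s IHs t IHt|s IHs t IHt].
- by rewrite okada_scalE; apply: cell_mult_scal.
- by rewrite -okada_genE; apply: gen_cell_mult; have := ltn_ord i; rewrite /=; lia.
- by rewrite -okada_addE; apply: cell_multD.
- by rewrite -okada_mulE; apply: cell_multM.
Qed.

Lemma okada_cell_datum :
  is_cell_datum A (yfs N) (@dominance N) (@half_with N) C (@ostar K n X Y).
Proof.
split.
- exact: dominance_refl.
- exact: dominance_anti.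
- exact: dominance_trans.
(* The coefficients are read off in the module, where distinct indices give distinct basis
   vectors. *)
- move=> c e i; have := congr1 (fun u : A => phi u (cell_diag i)) e.
  rewrite phi_sum phi0 sum_ffunE (bigD1 i) //= cell_eltE phi_diag_elt ?cell_diag_okada //.
  rewrite !ffunE eqxx big1 ?addr0 => [|j ji].
    by rewrite /GRing.scale /= mulr1.
  rewrite cell_eltE phi_diag_elt ?cell_diag_okada // !ffunE.
  by rewrite (inj_eq cell_diag_inj) eq_sym (negbTE ji) /GRing.scale /= mulr0.
- move=> u; have [c ->] := okada_basis_span u.
  elim/big_rec: _ => [|s v _ [e ->]].
    by exists (fun=> 0); rewrite big1 // => i _; rewrite scale0r.
  have [i ei _] := cell_diag_surj (perm_diag_okada s).
  exists (fun j => (if j == i then c s else 0) + e j).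
  rewrite [RHS](eq_bigr (fun j => (if j == i then c s else 0) *: cell_elt C j + e j *: cell_elt C j)).
    rewrite big_split /=. congr (_ + _); rewrite (bigD1 i) //= eqxx big1 ?addr0.
      by rewrite cell_eltE ei diag_elt_perm.
    by move=> j /negbTE ->; rewrite scale0r.
  by move=> j _; rewrite scalerDl.
- exact: ostarK.
- exact: ostar1.
- exact: ostarM.
- move=> S L R; have [okD lD rD] := join_cell L R.
  apply: etrans (ostar_diag_elt X Y okD) _; congr diag_elt.
  have okM := mirror_okada okD.
  rewrite -[mirror _]join_halves // -[lhalf (mirror _)]/(rhalf _) rD; congr join.
  by rewrite /rhalf mirrorK lD.
- exact: okada_cell_mult.
Qed.

End OkadaCell.

Theorem theorem6p2 (N : nat) (K : fieldType)
    (X : N.-1.-tuple K) (Y : N.-2.-tuple K) :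
  (1 <= N)%N ->
  exists star : {linear okada_algebra X Y -> okada_algebra X Y},
    (forall D : diag N, is_okada D ->
       star (diag_elt X Y D) = diag_elt X Y (mirror D)) /\
    is_cell_datum (okada_algebra X Y) (yfs N) (@dominance N)
      (@half_with N) (@okada_cell K N X Y) star.
Proof.
case: N X Y => // n X Y _; exists (@ostar K n X Y); split.
  exact: ostar_diag_elt.
exact: okada_cell_datum.
Qed.
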